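(* Let $A=u\,\mathrm{Diag}(\{\lambda_i\}_{i\in\mathbb N})\,u^*\in\mathcal K(\mathcal H)^h$ with $u\in\mathcal U_c(\mathcal H)$ and $\{\lambda_i\}_{i\in\mathbb N}\subset\mathbb R$ such that $\lambda_i\neq\lambda_j$ for $i\neq j$, and let $b=\mathrm{Diag}(\{\lambda_i\}_{i\in\mathbb N})\in\mathcal O_A$. With $Y_n,D_n,P_n,Y_r,D_0,M_0,\gamma$ as in the context and $Z_r=Y_r+D_0$, put $$\beta(t)=e^{tZ_r}be^{-tZ_r},\qquad \beta_n(t)=e^{t(Y_n+D_n+\frac{i}{1-\gamma}P_n)}\,b\,e^{-t(Y_n+D_n+\frac{i}{1-\gamma}P_n)}\quad(n\ge2).$$ Then, for each $n\ge 2$: (1) $\beta_n(0)=b$ and $\beta_n'(0)=Y_nb-bY_n\in(T\mathcal O_A)_b$. (2) $\beta_n(t)=e^{t(Y_n+D_n)}be^{-t(Y_n+D_n)}$ for all $t$. (3) For each $t_0\in\left[-\frac{\pi}{2\|[Y_n]\|},\frac{\pi}{2\|[Y_n]\|}\right]=\left[-\frac{\pi}{2M_0},\frac{\pi}{2M_0}\right]$, $$\mathrm L(\beta_n|_{[0,t_0]})=|t_0|\,\|[Y_n]\|=|t_0|\,M_0=\mathrm L(\beta|_{[0,t_0]}).$$ (4) For each $t_0\in\left[-\frac{\pi}{2M_0},\frac{\pi}{2M_0}\right]$, $\beta_n|_{[0,t_0]}$ is a minimal length curve in $\mathcal O_A$ (its length is minimal among all smooth curves in $\mathcal O_A$ joining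 $b$ with $\beta_n(t_0)$). Furthermore: (5) $\beta_n'(0)\to\beta'(0)$ as $n\to\infty$ in the norm $\|\cdot\|_b$ of $(T\mathcal O_A)_b$. Moreover, $\beta_n\to\beta$ uniformly in the operator norm on the interval $\left[-\frac{\pi}{2M_0},\frac{\pi}{2M_0}\right]$.
   Context: $\mathcal H$ is an infinite-dimensional separable complex Hilbert space with a fixed orthonormal basis $\{e_k\}_{k\in\mathbb N}$; operators are identified with their infinite matrices in this basis. $\mathcal B(\mathcal H)$, $\mathcal K(\mathcal H)$ are the bounded and compact operators, $\|\cdot\|$ is the operator norm, and the superscripts $h$, $ah$ denote Hermitian and anti-Hermitian elements. $\mathrm{Diag}(\{d_n\})$ is the diagonal operator with entries $d_n$; $\mathcal D(\mathcal K(\mathcal H)^{ah})$ is the set of diagonal operators in $\mathcal K(\mathcal H)^{ah}$; for $Y\in \mathcal K(\mathcal H)^{ah}$, $\|[Y]\|=\inf_{D\in\mathcal D(\mathcal K(\mathcal H)^{ah})}\|Y+D\|$. $c_1(T)=Te_1$ is the first column of $T$, with its Hilbert space norm. $\mathcal U_c(\mathcal H)=\{u\in\mathcal B(\mathcal H): u \text{ unitary},\ u-I\in\mathcal K(\mathcal H)\}$. For $A\in\mathcal K(\mathcal H)^h$, $\mathcal O_A=\{uAu^*:u\in\mathcal U_c(\mathcal H)\}$. For $b\in\mathcal O_A$, $(T\mathcal O_A)_b=\{Yb-bY:Y\in\mathcal K(\mathcal H)^{ah}\}$, with the Finsler norm $\|x\|_b=\inf\{\|Y\|:Y\in\mathcal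 K(\mathcal H)^{ah},\ Yb-bY=x\}$. A smooth curve is a $C^1$ curve with non-vanishing derivative; the length of a (piecewise) smooth curve $\chi:[a_1,a_2]\to\mathcal O_A$ is $\mathrm L(\chi)=\int_{a_1}^{a_2}\|\chi'(t)\|_{\chi(t)}\,dt$. For $t_0<0$, $[0,t_0]$ means the segment between $0$ and $t_0$. Operators: let $\gamma\in\mathbb R$, $0<|\gamma|<1$. $L$ is the operator with $L_{1j}=L_{j1}=i\gamma^{j-1}$ for $j\ge2$ and all other entries $0$. $Y^{[1]}$ is the operator with entries $(Y^{[1]})_{jk}=i\gamma^{\max(j,k)-2}$ for $j,k\ge2$, $j\neq k$, and all other entries $0$. $D_0=i\,\mathrm{Diag}(\{d_j\})$ with $d_1=0$ and $d_j=-\frac{1-\gamma^{j-2}}{1-\gamma}-\frac{\gamma^j}{1-\gamma^2}$ for $j\ge2$. $P_n$ is the orthogonal projection onto $\mathrm{span}\{e_1,\dots,e_n\}$. $D_n=i\,\mathrm{Diag}(\{d_k^{(n)}\}_{k})$ with $d_1^{(n)}=0$, $d_k^{(n)}=0$ for $k>n$, and $d_k^{(n)}=-\sum_{j=0}^{k-3}\gamma^j-\sum_{j=k}^{n-1}\gamma^{2j-k}$ for $2\le k\le n$ (empty sums are $0$). $M_0=\max\{\sup_{n}\|P_nY^{[1]}P_n+D_n\|,\ \|Y^{[1]}+D_0\|\}$, which is finite and positive. $r=M_0/\|c_1(L)\|$, $r_n=M_0/\|c_1(P_nLP_n)\|$ for $n\geq 2$, $Y_r=rL+Y^{[1]}$,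 $Y_n=r_nP_nLP_n+P_nY^{[1]}P_n$. *)

(* Defs.v *)
From HB Require Import structures.
From mathcomp Require Import all_boot all_order all_algebra.
From mathcomp Require Import all_classical all_reals all_analysis.
From mathcomp Require Import complex.

Set Implicit Arguments.
Unset Strict Implicit.
Unset Printing Implicit Defensive.

Import Order.TTheory GRing.Theory Num.Theory.
Import numFieldNormedType.Exports.

Local Open Scope classical_set_scope.
Local Open Scope ring_scope.

(* Complex Hilbert spaces; the inner product is linear on the left. *)
HB.mixin Record isHilbert (R : realType) V of CompleteNormedModule R[i] V := {
  dot : V -> V -> R[i] ;
  dotDl : forall x y z, dot (x + y) z = dot x z + dot y z ;
  dotZl : forall (a : R[i]) x y, dot (a *: x) y = a * dot x y ;
  dotC : forall x y, dot y x = ((dot x y)^*)%C ;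
  dotxx : forall x, dot x x = `|x| ^+ 2
}.

#[short(type="hilbertType")]
HB.structure Definition Hilbert (R : realType) :=
  {V of isHilbert R V & CompleteNormedModule R[i] V}.

(* Norms in a [normedModType R[i]] are elements of [R[i]]. *)
Definition hnorm (R : realType) (H : hilbertType R) (x : H) : R :=
  complex.Re `|x|.

Section BoundedOperators.
Variables (R : realType) (H : hilbertType R).

Record bop := Bop {
  bop_fun :> H -> H ;
  bop_linear : linear bop_fun ;
  bop_cont : continuous bop_fun
}.

HB.instance Definition _ := gen_eqMixin bop.
HB.instance Definition _ := gen_choiceMixin bop.

Implicit Types (S T U : bop).

Lemma bopP S T : S =1 T -> S = T.
Proof.
case: S T => [s ls cs] [t lt ct] /= /funext st; rewrite st in ls cs *.
by congr Bop; exact: Prop_irrelevance.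
Qed.

Lemma bopD T : {morph T : x y / x + y}.
Proof. by move=> x y; have := bop_linear T 1 x y; rewrite !scale1r. Qed.

Lemma bop0r T : T 0 = 0.
Proof. by apply: (addrI (T 0)); rewrite -bopD !addr0. Qed.

Lemma bopZ T (a : R[i]) x : T (a *: x) = a *: T x.
Proof. by have := bop_linear T a x 0; rewrite bop0r !addr0. Qed.

Lemma zero_linear : linear (fun _ : H => 0 : H).
Proof. by move=> a x y; rewrite scaler0 addr0. Qed.

Lemma zero_cont : continuous (fun _ : H => 0 : H).
Proof. by move=> x; exact: cvg_cst. Qed.

Definition bop_zero := Bop zero_linear zero_cont.

Lemma add_linear S T : linear (fun x => S x + T x).
Proof. by move=> a x y; rewrite !bop_linear scalerDr addrACA. Qed.

Lemma add_cont S T : continuous (fun x => S x + T x).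
Proof. by move=> x; apply: cvgD; exact: bop_cont. Qed.

Definition bop_add S T := Bop (add_linear S T) (@add_cont S T).

Lemma opp_linear T : linear (fun x => - T x).
Proof. by move=> a x y; rewrite bop_linear opprD scalerN. Qed.

Lemma opp_cont T : continuous (fun x => - T x).
Proof. by move=> x; apply: cvgN; exact: bop_cont. Qed.

Definition bop_opp T := Bop (opp_linear T) (@opp_cont T).

Lemma scale_linear (r : R) T : linear (fun x => r%:C%C *: T x).
Proof.
by move=> a x y; rewrite bop_linear scalerDr !scalerA [_ * a]mulrC.
Qed.

Lemma scale_cont (r : R) T : continuous (fun x => r%:C%C *: T x).
Proof. by move=> x; apply: cvgZr; exact: bop_cont. Qed.

Definition bop_scale r T := Bop (scale_linear r T) (@scale_cont r T).

Lemma one_linear : linear (fun x : H => x). Proof. by []. Qed.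

Lemma one_cont : continuous (fun x : H => x). Proof. by move=> x; exact: cvg_id. Qed.

Definition bop_one := Bop one_linear one_cont.

Lemma mul_linear S T : linear (fun x => S (T x)).
Proof. by move=> a x y; rewrite !bop_linear. Qed.

Lemma mul_cont S T : continuous (fun x => S (T x)).
Proof. by move=> x; apply: continuous_comp; exact: bop_cont. Qed.

Definition bop_mul S T := Bop (mul_linear S T) (@mul_cont S T).

Lemma bop_addA : associative bop_add.
Proof. by move=> S T U; apply: bopP => x /=; rewrite addrA. Qed.
Lemma bop_addC : commutative bop_add.
Proof. by move=> S T; apply: bopP => x /=; rewrite addrC. Qed.
Lemma bop_add0 : left_id bop_zero bop_add.
Proof. by move=> S; apply: bopP => x /=; rewrite add0r. Qed.
Lemma bop_addN : left_inverse bop_zero bop_opp bop_add.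
Proof. by move=> S; apply: bopP => x /=; rewrite addNr. Qed.

HB.instance Definition _ :=
  GRing.isZmodule.Build bop bop_addA bop_addC bop_add0 bop_addN.

Lemma bop_mulA : associative bop_mul.
Proof. by move=> S T U; apply: bopP. Qed.
Lemma bop_mul1 : left_id bop_one bop_mul.
Proof. by move=> S; apply: bopP. Qed.
Lemma bop_mulr1 : right_id bop_one bop_mul.
Proof. by move=> S; apply: bopP. Qed.
Lemma bop_mulDl : left_distributive bop_mul bop_add.
Proof. by move=> S T U; apply: bopP. Qed.
Lemma bop_mulDr : right_distributive bop_mul bop_add.
Proof. by move=> S T U; apply: bopP => x /=; rewrite bopD. Qed.

HB.instance Definition _ := GRing.Zmodule_isPzRing.Build bop
  bop_mulA bop_mul1 bop_mulr1 bop_mulDl bop_mulDr.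

Lemma bop_scaleA (a b : R) T : bop_scale a (bop_scale b T) = bop_scale (a * b) T.
Proof. by apply: bopP => x /=; rewrite scalerA rmorphM. Qed.
Lemma bop_scale1 : left_id 1 bop_scale.
Proof. by move=> T; apply: bopP => x /=; rewrite scale1r. Qed.
Lemma bop_scaleDr : right_distributive bop_scale +%R.
Proof. by move=> a S T; apply: bopP => x /=; rewrite scalerDr. Qed.
Lemma bop_scaleDl T : {morph bop_scale^~ T : a b / a + b}.
Proof. by move=> a b; apply: bopP => x /=; rewrite rmorphD scalerDl. Qed.

HB.instance Definition _ := GRing.Zmodule_isLmodule.Build R bop
  bop_scaleA bop_scale1 bop_scaleDr bop_scaleDl.

Definition opnorm T : R := sup [set hnorm (T x) | x in [set x | hnorm x <= 1]].

Lemma hnormE (x : H) : `|x| = (hnorm x)%:C%C.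
Proof.
rewrite /hnorm; have := normr_ge0 x; case: `|x| => a b.
by rewrite lecE /= => /andP[/eqP -> _].
Qed.

Lemma hnorm_ge0 (x : H) : 0 <= hnorm x.
Proof. by have := normr_ge0 x; rewrite hnormE lecR. Qed.

Lemma hnormD (x y : H) : hnorm (x + y) <= hnorm x + hnorm y.
Proof. by have := ler_normD x y; rewrite !hnormE -rmorphD lecR. Qed.

Lemma hnormZ (a : R) (x : H) : hnorm (a%:C%C *: x) = `|a| * hnorm x.
Proof.
apply: complexI; rewrite rmorphM -hnormE normrZ hnormE; congr (_ * _).
by rewrite normc_def /= expr0n addr0 sqrtr_sqr.
Qed.

Lemma hnorm0_eq0 (x : H) : hnorm x = 0 -> x = 0.
Proof. by move=> x0; apply/normr0_eq0; rewrite hnormE x0. Qed.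

Lemma hnorm0 : hnorm (0 : H) = 0.
Proof. by rewrite /hnorm normr0. Qed.

Lemma bop_bounded T : exists2 M : R, 0 <= M & forall x, hnorm (T x) <= M * hnorm x.
Proof.
pose lT := GRing.isLinear.Build _ _ _ _ (bop_fun T) (bop_linear T).
pose f : {linear H -> H} := HB.pack (bop_fun T) lT.
have /linear_boundedP[M0 [M0r M0P]] : bounded_near f (nbhs (0 : H)).
  by apply: continuous_linear_bounded; exact: bop_cont.
pose M := complex.Re M0 + 1.
have MP x : hnorm (T x) <= M * hnorm x.
  rewrite -lecR rmorphM /= -!hnormE; apply: M0P.
  move: M0r; rewrite /M; case: (M0) => a b /complex_realP[c [-> ->]] /=.
  by rewrite ltcR ltrDl.
exists `|M| => // x; apply: le_trans (MP x) _.
by rewrite ler_wpM2r ?hnorm_ge0 ?ler_norm.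
Qed.

Lemma opnorm_has_sup T :
  has_sup [set hnorm (T x) | x in [set x | hnorm x <= 1]].
Proof.
split; first by exists (hnorm (T 0)), 0; rewrite //= hnorm0.
have [M M0 MP] := bop_bounded T; exists M => _ [x /= x1 <-].
by apply: le_trans (MP x) _; rewrite ler_piMr.
Qed.

Lemma opnorm_ub T x : hnorm x <= 1 -> hnorm (T x) <= opnorm T.
Proof. by move=> x1; apply: sup_upper_bound; [exact: opnorm_has_sup|exists x]. Qed.

Lemma opnorm_le T (M : R) :
  (forall x, hnorm x <= 1 -> hnorm (T x) <= M) -> opnorm T <= M.
Proof.
move=> TM; apply: ge_sup; first by case: (opnorm_has_sup T).
by move=> _ [x /= x1 <-]; exact: TM.
Qed.

Lemma opnormD S T : opnorm (S + T) <= opnorm S + opnorm T.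
Proof.
apply: opnorm_le => x x1; apply: le_trans (hnormD _ _) _.
by rewrite lerD ?opnorm_ub.
Qed.

Lemma opnormZ_le (r : R) T : opnorm (r *: T) <= `|r| * opnorm T.
Proof.
by apply: opnorm_le => x x1; rewrite hnormZ ler_wpM2l ?opnorm_ub.
Qed.

Lemma opnormZ (r : R) T : opnorm (r *: T) = `|r| * opnorm T.
Proof.
apply/eqP; rewrite eq_le opnormZ_le /=; have [->|r0] := eqVneq r 0.
  rewrite normr0 mul0r; apply: le_trans (opnorm_ub _ (x := 0) _).
    exact: hnorm_ge0.
  by rewrite hnorm0.
have := opnormZ_le r^-1 (r *: T).
by rewrite scalerA mulVf // scale1r normfV -ler_pdivlMl ?invr_gt0 ?normr_gt0 // invrK.
Qed.

Lemma opnorm0_eq0 T : opnorm T = 0 -> T = 0.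
Proof.
move=> T0; apply: bopP => x /=; have [->|x0] := eqVneq x 0; first exact: bop0r.
have hx : 0 < hnorm x.
  by rewrite lt_def hnorm_ge0 andbT; apply: contra x0 => /eqP/hnorm0_eq0 ->.
have := @opnorm_ub T ((hnorm x)^-1%:C%C *: x).
rewrite hnormZ ger0_norm ?invr_ge0 ?hnorm_ge0 // mulVf ?gt_eqF // => /(_ (lexx _)).
rewrite T0 bopZ hnormZ gtr0_norm ?invr_gt0 // pmulr_rle0 ?invr_gt0 // => Tx0.
by apply/hnorm0_eq0/eqP; rewrite eq_le Tx0 hnorm_ge0.
Qed.

(* B(H) as a normed space over the reals. *)
HB.instance Definition _ :=
  Lmodule_isNormed.Build R bop opnormD opnormZ opnorm0_eq0.

End BoundedOperators.

Section Operators.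
Variables (R : realType) (H : hilbertType R).
Implicit Types (A T Y D u b : bop H) (e : nat -> H).

Definition adj T : bop H :=
  get [set S : bop H | forall x y, dot (T x) y = dot x (S y)].

Definition op_hermitian T := forall x y, dot (T x) y = dot x (T y).

Definition op_antihermitian T := forall x y, dot (T x) y = - dot x (T y).

Definition op_unitary u := adj u * u = 1 /\ u * adj u = 1.

Definition compact_op T :=
  compact (closure (T @` [set x : H | hnorm x <= 1])).

Definition Kah : set (bop H) := [set Y | compact_op Y /\ op_antihermitian Y].

Definition Uc : set (bop H) := [set u | op_unitary u /\ compact_op (u - 1)].

Definition exp_op T : bop H :=
  limn (series (fun k => (k`!%:R : R)^-1 *: T ^+ k)).

Definition orthonormal_basis e :=
  (forall j k, dot (e j) (e k) = (j == k)%:R) /\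
  (forall x, series (fun k => dot x (e k) *: e k) @ \oo --> x).

Definition diagonal e T := forall j k, j != k -> dot (T (e k)) (e j) = 0.

(* T = Diag(d) *)
Definition is_diag e T (d : nat -> R[i]) := forall k, T (e k) = d k *: e k.

(* The bounded operator with matrix m (0 if there is none). *)
Definition op_of_matrix e (m : nat -> nat -> R[i]) : bop H :=
  get [set T : bop H | forall j k, dot (T (e k)) (e j) = m j k].

Definition Diag e (d : nat -> R[i]) : bop H :=
  op_of_matrix e (fun j k => if j == k then d k else 0).

Definition qnorm e Y : R :=
  inf [set `|Y + D| | D in [set D | Kah D /\ diagonal e D]].

Definition orbit A : set (bop H) := [set u * A * adj u | u in Uc].

Definition tangent b : set (bop H) := [set Y * b - b * Y | Y in Kah].

(* +oo outside of the tangent space *)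
Definition finsler b (x : bop H) : \bar R :=
  ereal_inf [set `|Y|%:E | Y in [set Y | Kah Y /\ Y * b - b * Y = x]].

(* C^1 curves [a1, a2] -> orbit A, with non-vanishing derivative, for the
   operator norm. They are represented by maps on R that also have two-sided
   derivatives at a1 and a2: this is no restriction, since a C^1 curve on
   [a1, a2] extends by its tangents at the endpoints, and what happens outside
   of [a1, a2] is otherwise irrelevant. *)
Definition smooth_curve A (a1 a2 : R) (chi : R -> bop H) :=
  [/\ a1 <= a2,
      forall t, t \in `[a1, a2] -> orbit A (chi t),
      forall t, t \in `[a1, a2] -> derivable chi t 1,
      {within `[a1, a2], continuous (derive1 chi)} &
      forall t, t \in `[a1, a2] -> derive1 chi t != 0].

Definition curve_length (a1 a2 : R) (chi : R -> bop H) : \bar R :=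
  (\int[lebesgue_measure]_(t in `[a1, a2]) finsler (chi t) (derive1 chi t))%E.

Definition joins (a1 a2 : R) (chi : R -> bop H) (x y : bop H) :=
  (chi a1 = x /\ chi a2 = y) \/ (chi a1 = y /\ chi a2 = x).

Definition minimal_length_curve A (a1 a2 : R) (chi : R -> bop H) :=
  smooth_curve A a1 a2 chi /\
  forall (c1 c2 : R) (omega : R -> bop H), smooth_curve A c1 c2 omega ->
    joins c1 c2 omega (chi a1) (chi a2) ->
    (curve_length a1 a2 chi <= curve_length c1 c2 omega)%E.

End Operators.

(* In the entry functions below rows and columns are numbered from 1, whereas
   [e] is numbered from 0: hence the successors when the entries are turned
   into operators. [d0] and [dn] make the columns k >= 2 of [Y1 + D0], resp. of
   its n x n analogue, orthogonal to the first column of [L]. *)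
Section Example.
Variables (R : realType) (H : hilbertType R) (e : nat -> H) (gamma : R).
Implicit Types (j k n : nat) (b : bop H) (t : R).

Definition L_entry j k : R :=
  if (j == 1)%N && (2 <= k)%N then gamma ^+ (k - 1)
  else if (k == 1)%N && (2 <= j)%N then gamma ^+ (j - 1)
  else 0.

Definition Y1_entry j k : R :=
  if [&& (2 <= j)%N, (2 <= k)%N & j != k] then gamma ^+ (maxn j k - 2) else 0.

Definition d0 k : R :=
  if (2 <= k)%N
  then - ((1 - gamma ^+ (k - 2)) / (1 - gamma)) - gamma ^+ k / (1 - gamma ^+ 2)
  else 0.

Definition dn n k : R :=
  if (2 <= k <= n)%N
  then - (\sum_(0 <= j < k - 2) gamma ^+ j)
       - (\sum_(k <= j < n) gamma ^+ (2 * j - k))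
  else 0.

Definition L_op : bop H :=
  op_of_matrix e (fun j k => (0 +i* L_entry j.+1 k.+1)%C).

Definition Y1_op : bop H :=
  op_of_matrix e (fun j k => (0 +i* Y1_entry j.+1 k.+1)%C).

Definition D0_op : bop H := Diag e (fun k => (0 +i* d0 k.+1)%C).

Definition Dn_op n : bop H := Diag e (fun k => (0 +i* dn n k.+1)%C).

(* the orthogonal projection onto the span of the first n basis vectors *)
Definition P_op n : bop H :=
  get [set P : bop H | forall x, P x = \sum_(k < n) dot x (e k) *: e k].

(* (i / (1 - gamma)) P_n: [bop H] only has real scalars *)
Definition iP_op n : bop H :=
  get [set Q : bop H |
    forall x, Q x = (0 +i* (1 - gamma)^-1)%C *: P_op n x].

Definition M0 : R :=
  Num.max
    (sup [set `|P_op n * Y1_op * P_op n + Dn_op n| | n in [set n | (1 <= n)%N]])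
    `|Y1_op + D0_op|.

Definition c1 (T : bop H) : H := T (e 0).

Definition r_coef : R := M0 / hnorm (c1 L_op).

Definition rn_coef n : R := M0 / hnorm (c1 (P_op n * L_op * P_op n)).

Definition Yr_op : bop H := r_coef *: L_op + Y1_op.

Definition Yn_op n : bop H :=
  rn_coef n *: (P_op n * L_op * P_op n) + P_op n * Y1_op * P_op n.

Definition Zr_op : bop H := Yr_op + D0_op.

Definition beta b t : bop H :=
  exp_op (t *: Zr_op) * b * exp_op (- (t *: Zr_op)).

Definition betan b n t : bop H :=
  exp_op (t *: (Yn_op n + Dn_op n + iP_op n)) * b *
  exp_op (- (t *: (Yn_op n + Dn_op n + iP_op n))).

End Example.

(* Main.v *)
Require Import Defs.
From HB Require Import structures.
From mathcomp Require Import all_boot all_order all_algebra.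
From mathcomp Require Import all_classical all_reals all_analysis.
From mathcomp Require Import complex ring lra zify.
(* Again, to give back to [hnormD] its meaning for the Hilbert norm. *)
Require Import Defs.

(** Write [M] for [M0], [e 0] for the first basis vector, [Z_n = Y_n + D_n],
    and [W_n = P_n Y1 P_n + D_n], [W = Y1 + D0].

    Speed. The diagonals are chosen so that [W_n] annihilates the first column of
    [P_n L P_n] ([column_orthogonal]) as well as [e 0], and [W] does the same with
    [L] in the limit. The scaling by [r_n] or [r] gives the first column of [Z_n]
    or [Z_r] the norm [M]. Hence each of these operators turns the plane of [e 0]
    and its first column with speed [M], and acts as [W_n] or [W], of norm at most
    [M], on the orthogonal complement: its norm is at most [M] ([block_norm]). A
    diagonal perturbation only adds a multiple of [e 0] to the first column, which
    is orthogonal to [e 0], so it cannot bring the norm below [M]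
    ([diagonal_lower]). This gives the quotient norm of [Y_n]. As [b] has distinct
    eigenvalues, two lifts of a tangent vector at [b] differ by a diagonal
    operator, so the same two bounds show that the Finsler norm of the commutator
    of [Z_n] or [Z_r] with [b] is [M] ([finsler_value]); [Z_r] itself is not
    compact, but [M] is approached by the norms of compact lifts. Conjugation by
    unitaries preserves the Finsler norm, so both curves have constant speed [M].
    The summand [i / (1 - gamma) P_n] commutes with [Z_n] and with [b], and therefore
    does not change the curve ([conj_curve_comm]).

    Minimality. A competitor [w] moves the eigenline of the first eigenvalue [l]
    of [b], and the line moves at angular speed at most [|Y|] for every lift [Y]
    of the velocity of [w]. The line is observed through the large powers of
    [S = 1 - (w - l)^2 / C], polynomials in [w] that tend strongly to the
    projection, even when [l] is not isolated in the spectrum. For a Hermitian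
    contraction [T] with [|T x|^2 <= <T x, x>] and a unit vector [x], the mass
    [f = <T x, x>] satisfies [|f'| <= 2 |Y| sqrt (f (1 - f))] ([driven_rate]), so
    that [acos (2 f - 1) / 2] varies at most by the length of [w]
    ([angle_le_length]). In the limit of large powers [f] is the squared cosine of
    the angle between [e 0] and the eigenline; it is [1] at [b], and
    [cos (M t0) ^ 2] at the other end of [betan], because
    [<exp (t Z_n) (e 0), e 0> = cos (M t)] ([block_cos]). For [|t0| M <= pi / 2]
    the length is at least [|t0| M] ([minimal_angle]).

    Convergence. Apart from the factors [r_n -> r], the entries of
    [Y_n + D_n + i / (1 - gamma) P_n - (Z_r + i / (1 - gamma))] are bounded by a
    multiple of [|gamma| ^ max (j, k, n)], and a matrix with such entries has norm
    [O (|gamma| ^ (n / 2))] ([max_entries_norm]). Norm convergence of the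
    generators bounds the Finsler distance of the initial velocities, and gives
    uniform convergence of the curves since the exponential is Lipschitz on
    bounded sets ([exp_op_lipschitz]). *)

Set Implicit Arguments.
Unset Strict Implicit.
Unset Printing Implicit Defensive.

Import Order.TTheory GRing.Theory Num.Theory.
Import numFieldNormedType.Exports.

Local Open Scope classical_set_scope.
Local Open Scope ring_scope.

(** * Inner product and bounded operators *)

Section ComplexModulus.
Variable R : realType.
Implicit Types z w : R[i].

Definition cmod z : R := complex.Re `|z|.

Lemma cmodE z : `|z| = (cmod z)%:C%C.
Proof. by rewrite /cmod normc_def. Qed.

Lemma cmod_ge0 z : 0 <= cmod z.
Proof. by rewrite -lecR -cmodE normr_ge0. Qed.

Lemma cmodM z w : cmod (z * w) = cmod z * cmod w.
Proof. by apply: complexI; rewrite rmorphM /= -!cmodE normrM. Qed.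

Lemma cmodD z w : cmod (z + w) <= cmod z + cmod w.
Proof. by rewrite -lecR rmorphD /= -!cmodE ler_normD. Qed.

Lemma cmodN z : cmod (- z) = cmod z.
Proof. by rewrite /cmod normrN. Qed.

Lemma cmod0 : cmod 0 = 0.
Proof. by rewrite /cmod normr0. Qed.

Lemma cmod_eq0 z : cmod z = 0 -> z = 0.
Proof. by move=> z0; apply: normr0_eq0; rewrite cmodE z0. Qed.

Lemma cmodJ z : cmod (z^*)%C = cmod z.
Proof. by rewrite /cmod normcJ. Qed.

Lemma cmodR (x : R) : cmod x%:C%C = `|x|.
Proof. by rewrite /cmod normc_def /= expr0n addr0 sqrtr_sqr. Qed.

Lemma cmodI (x : R) : cmod (0 +i* x)%C = `|x|.
Proof. by rewrite /cmod normc_def /= expr0n add0r sqrtr_sqr. Qed.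

Lemma complex_gt0 z : 0 < z -> exists2 r : R, 0 < r & z = r%:C%C.
Proof.
rewrite ltcE /= => /andP[/eqP zi zr]; exists (complex.Re z) => //.
by case: z zi {zr} => a b /= ->.
Qed.

Lemma cmod_Re z : `|complex.Re z| <= cmod z.
Proof. by rewrite -lecR -cmodE normc_ge_Re. Qed.

End ComplexModulus.

Section InnerProduct.
Variables (R : realType) (H : hilbertType R).
Implicit Types (x y z : H) (a : R[i]).

Lemma dot0l x : dot (0 : H) x = 0.
Proof. by rewrite -(scale0r (0 : H)) dotZl mul0r. Qed.

Lemma dotNl x y : dot (- x) y = - dot x y.
Proof. by rewrite -scaleN1r dotZl mulN1r. Qed.

Lemma dotBl x y z : dot (x - y) z = dot x z - dot y z.
Proof. by rewrite dotDl dotNl. Qed.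

Lemma dotDr x y z : dot x (y + z) = dot x y + dot x z.
Proof. by rewrite dotC dotDl rmorphD /= -!dotC. Qed.

Lemma dotZr a x y : dot x (a *: y) = (a^*)%C * dot x y.
Proof. by rewrite dotC dotZl rmorphM /= -dotC. Qed.

Lemma dot0r x : dot x (0 : H) = 0.
Proof. by rewrite dotC dot0l rmorph0. Qed.

Lemma dotNr x y : dot x (- y) = - dot x y.
Proof. by rewrite dotC dotNl rmorphN /= -dotC. Qed.

Lemma dotBr x y z : dot x (y - z) = dot x y - dot x z.
Proof. by rewrite dotDr dotNr. Qed.

Lemma dot_suml (I : Type) (r : seq I) (P : pred I) (F : I -> H) x :
  dot (\sum_(i <- r | P i) F i) x = \sum_(i <- r | P i) dot (F i) x.
Proof. by elim/big_rec2: _ => [|i a b _ <-]; rewrite ?dot0l ?dotDl. Qed.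

Lemma dot_sumr (I : Type) (r : seq I) (P : pred I) (F : I -> H) x :
  dot x (\sum_(i <- r | P i) F i) = \sum_(i <- r | P i) dot x (F i).
Proof. by elim/big_rec2: _ => [|i a b _ <-]; rewrite ?dot0r ?dotDr. Qed.

Lemma dot_hnorm x : dot x x = (hnorm x ^+ 2)%:C%C.
Proof. by rewrite dotxx hnormE rmorphXn. Qed.

Lemma hnorm_sqr x : hnorm x ^+ 2 = complex.Re (dot x x).
Proof. by rewrite dot_hnorm. Qed.

Lemma hnormZc a x : hnorm (a *: x) = cmod a * hnorm x.
Proof. by apply: complexI; rewrite rmorphM /= -hnormE normrZ hnormE cmodE. Qed.

Lemma hnormN x : hnorm (- x) = hnorm x.
Proof. by rewrite /hnorm normrN. Qed.

Lemma hnorm_gt0 x : x != 0 -> 0 < hnorm x.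
Proof. by move=> x0; rewrite lt_def hnorm_ge0 andbT; apply: contra x0 => /eqP/hnorm0_eq0 ->. Qed.

Lemma hnorm_gt0_of_dot x y : dot x y <> 0 -> 0 < hnorm x.
Proof. by move=> xy; apply: hnorm_gt0; apply/eqP => x0; apply: xy; rewrite x0 dot0l. Qed.

Lemma hnormB x y : hnorm (x - y) = hnorm (y - x).
Proof. by rewrite -opprB hnormN. Qed.

Lemma hnorm_sum (I : Type) (r : seq I) (P : pred I) (F : I -> H) :
  hnorm (\sum_(i <- r | P i) F i) <= \sum_(i <- r | P i) hnorm (F i).
Proof.
elim/big_ind2: _ => [|x a y b xa yb|//]; first by rewrite hnorm0.
by apply: (le_trans (hnormD a b)); exact: lerD.
Qed.

Lemma hnorm_sqrD x y :
  hnorm (x + y) ^+ 2 = hnorm x ^+ 2 + hnorm y ^+ 2 + 2 * complex.Re (dot x y).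
Proof.
rewrite !hnorm_sqr !dotDl !dotDr !raddfD /= (dotC x y).
by case: (dot x y) => u v /=; ring.
Qed.

Lemma pythagoras x y :
  dot x y = 0 -> hnorm (x + y) ^+ 2 = hnorm x ^+ 2 + hnorm y ^+ 2.
Proof. by move=> xy; rewrite hnorm_sqrD xy /= mulr0 addr0. Qed.

(** Expanding [0 <= |y - c x|^2] for the minimizing coefficient [c]. *)
Lemma cauchy_schwarz x y : cmod (dot x y) <= hnorm x * hnorm y.
Proof.
have [->|x0] := eqVneq x 0; first by rewrite dot0l cmod0 hnorm0 mul0r.
have nx := hnorm_gt0 x0.
rewrite -(@ler_pXn2r _ 2) ?nnegrE ?cmod_ge0 ?mulr_ge0 ?hnorm_ge0 // exprMn.
pose c := dot y x * ((hnorm x ^+ 2)^-1)%:C%C.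
have yE : y = (y - c *: x) + c *: x by rewrite subrK.
have orth : dot (y - c *: x) (c *: x) = 0.
  rewrite dotZr dotBl dotZl dot_hnorm /c -mulrA -rmorphM /= mulVf ?mulr1 ?subrr ?mulr0 //.
  by rewrite expf_neq0 // gt_eqF.
have := pythagoras orth; rewrite -yE hnormZc /c cmodM cmodR ger0_norm ?invr_ge0 ?sqr_ge0 //.
move=> ->; rewrite mulrDr ler_wpDl ?mulr_ge0 ?hnorm_ge0 //.
rewrite (dotC x y) cmodJ le_eqVlt; apply/orP; left; apply/eqP.
by field; rewrite gt_eqF.
Qed.

Lemma dot_ext x y : (forall z, dot x z = dot y z) -> x = y.
Proof.
move=> xy; apply/subr0_eq/hnorm0_eq0/eqP; rewrite -sqrf_eq0 hnorm_sqr.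
by rewrite dotBl xy subrr.
Qed.

End InnerProduct.

Section HilbertLimits.
Variables (R : realType) (H : hilbertType R).

(** The filter lemmas measure distances in [H] by numbers of [R[i]], which are
    awkward to compare with real bounds. *)
Lemma cvg_hnormP (T : Type) (F : set_system T) (FF : Filter F) (f : T -> H) (y : H) :
  f @ F --> y <-> (forall eps : R, 0 < eps -> \forall t \near F, hnorm (y - f t) < eps).
Proof.
split => [/cvgrPdist_lt fy eps e0|fy].
  have /fy : 0 < eps%:C%C :> R[i] by rewrite ltcR.
  by apply: filterS => t; rewrite hnormE ltcR.
apply/cvgrPdist_lt => eps e0.
have [r r0 er] := complex_gt0 e0.
by have := fy _ r0; apply: filterS => t; rewrite er hnormE ltcR.
Qed.

Lemma hnorm_lim_le (T : Type) (F : set_system T) (FF : ProperFilter F) (f : T -> H)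
    (a y : H) (r : R) :
  f @ F --> y -> (\forall t \near F, hnorm (a - f t) <= r) -> hnorm (a - y) <= r.
Proof.
move=> /cvg_hnormP fy fr; apply/ler_addgt0Pr => eps e0.
have [t [t1 t2]] := filter_ex (filterI fr (fy _ e0)).
have -> : a - y = (a - f t) + (f t - y) by rewrite addrA subrK.
by apply: le_trans (hnormD _ _) _; rewrite lerD // hnormB ltW.
Qed.

Lemma linear_bounded_cont (f : H -> H) (M : R) :
  linear f -> (forall x, hnorm (f x) <= M * hnorm x) -> continuous f.
Proof.
move=> lf fM.
pose g : {linear H -> H} := HB.pack f (GRing.isLinear.Build _ _ _ _ f lf).
suff : bounded_near g (nbhs (0 : H)) by move/linear_bounded_continuous.
apply/linear_boundedP; exists M%:C%C; split; first by apply/complex_realP; exists M.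
move=> r Mr x; rewrite !hnormE; apply: (@le_trans _ _ ((M * hnorm x)%:C%C)).
  by rewrite lecR fM.
by rewrite rmorphM /= ler_wpM2r ?lecR ?hnorm_ge0 // ltW.
Qed.

Lemma bop_of_bound (f : H -> H) (M : R) :
  linear f -> (forall x, hnorm (f x) <= M * hnorm x) ->
  exists T : bop H, forall x, T x = f x.
Proof.
by move=> lf fM; exists (Bop lf (linear_bounded_cont lf fM)).
Qed.

End HilbertLimits.

Section OperatorAlgebra.
Variables (R : realType) (H : hilbertType R).
Implicit Types (S T : bop H) (x y : H) (a : R).

Lemma bop_addE S T x : (S + T) x = S x + T x. Proof. by []. Qed.
Lemma bop_oppE T x : (- T) x = - T x. Proof. by []. Qed.
Lemma bop_subE S T x : (S - T) x = S x - T x. Proof. by []. Qed.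
Lemma bop_mulE S T x : (S * T) x = S (T x). Proof. by []. Qed.
Lemma bop_scaleE a T x : (a *: T) x = a%:C%C *: T x. Proof. by []. Qed.
Lemma bop_oneE x : (1 : bop H) x = x. Proof. by []. Qed.
Lemma bop_zeroE x : (0 : bop H) x = 0. Proof. by []. Qed.
Definition bopE := (bop_addE, bop_oppE, bop_mulE, bop_scaleE, bop_oneE, bop_zeroE).

Lemma bop_sumE (I : Type) (r : seq I) (P : pred I) (F : I -> bop H) x :
  (\sum_(i <- r | P i) F i) x = \sum_(i <- r | P i) F i x.
Proof. by elim/big_rec2: _ => // i y T _ <-. Qed.

Lemma bopB T x y : T (x - y) = T x - T y.
Proof. by rewrite bopD -scaleN1r bopZ scaleN1r. Qed.

Lemma bop_sum T (I : Type) (r : seq I) (P : pred I) (F : I -> H) :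
  T (\sum_(i <- r | P i) F i) = \sum_(i <- r | P i) T (F i).
Proof. by elim/big_rec2: _ => [|i x y _ <-]; rewrite ?bop0r ?bopD. Qed.

Lemma bop_le T x : hnorm (T x) <= `|T| * hnorm x.
Proof.
have [->|x0] := eqVneq x 0; first by rewrite bop0r hnorm0 mulr0.
have nx := hnorm_gt0 x0.
have := @opnorm_ub _ _ T ((hnorm x)^-1%:C%C *: x).
rewrite bopZ !hnormZ ger0_norm ?invr_ge0 ?hnorm_ge0 // mulVf ?gt_eqF //.
by move=> /(_ (lexx _)); rewrite mulrC ler_pdivrMr.
Qed.

Lemma bop_norm_le T (M : R) :
  0 <= M -> (forall x, hnorm (T x) <= M * hnorm x) -> `|T| <= M.
Proof.
move=> M0 TM; apply: opnorm_le => x x1; apply: le_trans (TM x) _.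
by rewrite ler_piMr.
Qed.

Lemma bop_normM S T : `|S * T| <= `|S| * `|T|.
Proof.
apply: bop_norm_le => [|x]; first by rewrite mulr_ge0.
by apply: le_trans (bop_le S (T x)) _; rewrite -mulrA ler_wpM2l // bop_le.
Qed.

Lemma bop_norm1 : `|1 : bop H| <= 1.
Proof. by apply: bop_norm_le => // x; rewrite mul1r. Qed.

Lemma bop_normX T n : `|T ^+ n| <= `|T| ^+ n.
Proof.
elim: n => [|n IH]; first exact: bop_norm1.
by rewrite !exprS; apply: le_trans (bop_normM _ _) _; rewrite ler_wpM2l.
Qed.

Lemma bop_scaleAl a S T : (a *: S) * T = a *: (S * T).
Proof. exact: bopP. Qed.

Lemma bop_scaleAr a S T : S * (a *: T) = a *: (S * T).
Proof. by apply: bopP => x; rewrite !bopE bopZ. Qed.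

Lemma cscale_linear (z : R[i]) T : linear (fun x => z *: T x).
Proof. by move=> w x y; rewrite bop_linear scalerDr !scalerA mulrC. Qed.

Lemma cscale_cont (z : R[i]) T : continuous (fun x => z *: T x).
Proof. by move=> x; apply: cvgZr; exact: bop_cont. Qed.

(** [bop H] only has real scalars, whereas the example involves multiples of [i]. *)
Definition cscale (z : R[i]) T := Bop (cscale_linear z T) (@cscale_cont z T).

Lemma cscale_norm z T : `|cscale z T| <= cmod z * `|T|.
Proof.
apply: bop_norm_le => [|x]; first by rewrite mulr_ge0 ?cmod_ge0.
by rewrite /= hnormZc -mulrA ler_wpM2l ?cmod_ge0 ?bop_le.
Qed.

Lemma rank1_linear (u v : H) : linear (fun x => dot x u *: v).
Proof. by move=> a x y; rewrite dotDl dotZl scalerDl scalerA. Qed.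

Lemma rank1_bound (u v x : H) : hnorm (dot x u *: v) <= hnorm u * hnorm v * hnorm x.
Proof.
rewrite hnormZc mulrAC ler_wpM2r ?hnorm_ge0 // (mulrC (hnorm u)).
exact: cauchy_schwarz.
Qed.

Definition rank1 (u v : H) : bop H :=
  Bop (rank1_linear u v) (linear_bounded_cont (rank1_linear u v) (rank1_bound u v)).

Lemma rank1_norm (u v : H) : `|rank1 u v| <= hnorm u * hnorm v.
Proof.
apply: bop_norm_le => [|x]; first by rewrite mulr_ge0 ?hnorm_ge0.
exact: rank1_bound.
Qed.

(** The limit is taken pointwise; the Cauchy bounds pass to it and give both its
    boundedness and the convergence in norm. *)
Lemma bop_cauchy_cvg (F : set_system (bop H)) :
  ProperFilter F -> cauchy F -> cvg F.
Proof.
move=> FF /cauchyP cF.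
have F2 (eps : R) : 0 < eps -> exists T, F [set S | `|T - S| < eps].
  by move=> /cF[T FT]; exists T; move: FT; rewrite -ball_normE.
have cFx x : cvg ((fun T : bop H => T x) @ F).
  apply/cauchy_cvgP/cauchyP => eps e0.
  have [r r0 er] := complex_gt0 e0.
  have h1 : 0 < hnorm x + 1 by rewrite ltr_pwDr ?hnorm_ge0.
  have [T FT] := F2 _ (divr_gt0 r0 h1).
  exists (T x).
  suff : F [set S | ball (T x) eps (S x)] by [].
  apply: filterS FT => S /= TS.
  rewrite -ball_normE /= er hnormE ltcR -bop_subE.
  apply: le_lt_trans (bop_le _ _) _.
  apply: le_lt_trans (_ : r / (hnorm x + 1) * hnorm x < r).
    by rewrite ler_wpM2r ?hnorm_ge0 // ltW.
  by rewrite mulrAC ltr_pdivrMr // ltr_pM2l // ltrDl.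
pose g x := lim ((fun T : bop H => T x) @ F).
have gP x : (fun T : bop H => T x) @ F --> g x by exact: cFx.
have lg : linear g.
  move=> a x y; apply: (cvg_unique (@norm_hausdorff _ _) (gP _)).
  have -> : (fun T : bop H => T (a *: x + y)) = (fun T : bop H => a *: T x + T y).
    by apply: funext => T; rewrite bop_linear.
  by apply: cvgD => //; apply: cvgZr.
have gF T (r : R) : F [set S | `|T - S| < r] -> forall x, hnorm (T x - g x) <= r * hnorm x.
  move=> FT x; apply: hnorm_lim_le (gP x) _.
  apply: filterS FT => S TS; rewrite -bop_subE; apply: le_trans (bop_le _ _) _.
  by rewrite ler_wpM2r ?hnorm_ge0 // ltW.
have [T0 FT0] := F2 1 ltr01.
have [G GE] : exists G : bop H, forall x, G x = g x.
  apply: (@bop_of_bound _ _ _ (`|T0| + 1)) => // x.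
  have -> : g x = T0 x - (T0 x - g x) by rewrite opprB addrC subrK.
  apply: le_trans (hnormD _ _) _; rewrite hnormN mulrDl.
  by rewrite lerD ?bop_le // gF.
apply/cvg_ex; exists G; apply/cvgrPdist_le => eps e0.
have e2 : 0 < eps / 2 by rewrite divr_gt0.
have [T FT] := F2 _ e2; apply: filterS (FT) => S /= TS.
have -> : G - S = (G - T) + (T - S) by rewrite addrA subrK.
apply: le_trans (ler_normD _ _) _; rewrite [leRHS]splitr lerD ?(ltW TS) //.
apply: bop_norm_le => [|x]; first exact: ltW.
by rewrite bop_subE hnormB GE; exact: gF.
Qed.

Lemma bop_series_cvg (u : nat -> bop H) (a : nat -> R) :
  (forall k, `|u k| <= a k) -> cvgn (series a) -> cvgn (series u).
Proof.
move=> ua ca; have a0 k : 0 <= a k by exact: le_trans (normr_ge0 _) (ua k).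
have nu : cvgn (series (fun k => `|u k|)).
  by apply: series_le_cvg ca => k; rewrite ?ua ?a0.
pose mC := Uniform_isComplete.Build (bop H) bop_cauchy_cvg.
pose cT : completeNormedModType R := HB.pack (bop H) mC.
exact: (@normed_cvg _ cT u nu).
Qed.

End OperatorAlgebra.

(** * Limits and exponentials of operators *)

Section Limits.
Variables (R : realType) (H : hilbertType R).
Implicit Types (S T : bop H) (x y : H).

Lemma cvg_bopM (I : Type) (F : set_system I) (FF : Filter F) (f g : I -> bop H) S T :
  f @ F --> S -> g @ F --> T -> (fun t => f t * g t) @ F --> S * T.
Proof.
move=> fS gT; apply/subr_cvg0/norm_cvg0P.
have fS0 : `|f t - S| @[t --> F] --> (0 : R) by apply/norm_cvg0P/subr_cvg0.
have gT0 : `|g t - T| @[t --> F] --> (0 : R) by apply/norm_cvg0P/subr_cvg0.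
have gn : `|g t| @[t --> F] --> `|T| by exact: cvg_norm.
have h : `|f t - S| * `|g t| + `|S| * `|g t - T| @[t --> F] --> (0 : R).
  have -> : (0 : R) = 0 * `|T| + `|S| * 0 by rewrite mul0r mulr0 addr0.
  by apply: cvgD; apply: cvgM => //; exact: cvg_cst.
apply: (squeeze_cvgr _ (cvg_cst _) h); apply: nearW => t; rewrite normr_ge0 /=.
have -> : f t * g t - S * T = (f t - S) * g t + S * (g t - T).
  by rewrite mulrBl mulrBr addrA subrK.
by apply: le_trans (ler_normD _ _) _; rewrite lerD // bop_normM.
Qed.

Lemma bop_cvg_unique (u : nat -> bop H) S T :
  u @ \oo --> S -> u @ \oo --> T -> S = T.
Proof. by move=> uS uT; exact: (cvg_unique (@norm_hausdorff _ _) uS uT). Qed.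

Lemma bop_cvg_norm_le (u : nat -> bop H) (v : nat -> R) T (r : R) :
  u @ \oo --> T -> v @ \oo --> r -> (forall n, `|u n| <= v n) -> `|T| <= r.
Proof.
move=> uT vr uv; apply: (ler_cvg_to (cvg_norm uT) vr).
by apply: nearW => n; exact: uv.
Qed.

(** Convergence in [R[i]] through the real modulus, so that real estimates apply. *)
Definition ccvg (z : nat -> R[i]) (a : R[i]) :=
  (fun n => cmod (z n - a)) @ \oo --> (0 : R).

Lemma ccvg_unique (z : nat -> R[i]) a b : ccvg z a -> ccvg z b -> a = b.
Proof.
move=> za zb; apply/subr0_eq/cmod_eq0/eqP; rewrite eq_le cmod_ge0 andbT.
have zab : (fun n => cmod (z n - a) + cmod (z n - b)) @ \oo --> (0 : R).
  by rewrite -[X in _ --> X]addr0; exact: cvgD.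
apply: (ler_cvg_to (cvg_cst (cmod (a - b))) zab); apply: nearW => n.
have -> : a - b = - (z n - a) + (z n - b) by rewrite opprB addrA subrK.
by apply: le_trans (cmodD _ _) _; rewrite cmodN.
Qed.

Lemma ccvg_near_eq (z : nat -> R[i]) a : (\forall n \near \oo, z n = a) -> ccvg z a.
Proof.
move=> za; apply: cvg_near_cst; apply: filterS za => n ->.
by rewrite subrr cmod0.
Qed.

Lemma ccvg_le (z : nat -> R[i]) a (v : nat -> R) :
  v @ \oo --> (0 : R) -> (forall n, cmod (z n - a) <= v n) -> ccvg z a.
Proof.
move=> v0 zv; apply: (squeeze_cvgr _ (cvg_cst _) v0); apply: nearW => n.
by rewrite cmod_ge0 zv.
Qed.

Lemma ccvg_Re (z : nat -> R[i]) a :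
  ccvg z a -> (fun n => complex.Re (z n)) @ \oo --> complex.Re a.
Proof.
move=> za; apply/subr_cvg0/norm_cvg0P.
apply: (squeeze_cvgr _ (cvg_cst _) za); apply: nearW => n; rewrite normr_ge0 /=.
by rewrite -raddfB cmod_Re.
Qed.

Lemma ccvg_dotl (u : nat -> bop H) T x y :
  u @ \oo --> T -> ccvg (fun n => dot (u n x) y) (dot (T x) y).
Proof.
move=> uT.
have uT0 : (fun n => `|u n - T| * (hnorm x * hnorm y)) @ \oo --> (0 : R).
  rewrite -[X in _ --> X](mul0r (hnorm x * hnorm y)).
  by apply: cvgM; [exact/norm_cvg0P/subr_cvg0 | exact: cvg_cst].
apply: ccvg_le uT0 _ => n; rewrite -dotBl.
apply: le_trans (cauchy_schwarz _ _) _.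
by rewrite mulrA ler_wpM2r ?hnorm_ge0 // -[_ - _]/((u n - T) x) bop_le.
Qed.

Arguments ccvg_dotl [u T] x y _ [t] _.

Lemma ccvg_dotr (u : nat -> bop H) T x y :
  u @ \oo --> T -> ccvg (fun n => dot y (u n x)) (dot y (T x)).
Proof.
move=> uT; have := ccvg_dotl x y uT; rewrite /ccvg.
apply: cvg_trans; rewrite (_ : (fun n => cmod (dot y _ - _)) = 
   (fun n => cmod (dot (u n x) y - dot (T x) y))) //.
by apply: funext => n; rewrite -cmodJ rmorphB /= -!dotC.
Qed.

Arguments ccvg_dotr [u T] x y _ [t] _.

Lemma bop_cvg_bounded (u : nat -> bop H) T : u @ \oo --> T -> exists B, forall n, `|u n| <= B.
Proof.
move=> uT; have [B [_ BP]] := cvg_seq_bounded (cvgP _ uT).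
by exists (B + 1) => n; apply: BP => //; rewrite ltrDl.
Qed.

Lemma hnorm_op_cvg (u : nat -> bop H) T x : u @ \oo --> T ->
  (fun n => hnorm (u n x)) @ \oo --> hnorm (T x).
Proof.
move=> uT; apply/subr_cvg0/norm_cvg0P.
have lim : (fun n => `|u n - T| * hnorm x) @ \oo --> (0 : R).
  rewrite -[X in _ --> X](mul0r (hnorm x)).
  by apply: cvgM; [exact/norm_cvg0P/subr_cvg0 | exact: cvg_cst].
apply: (squeeze_cvgr _ (cvg_cst _) lim); apply: nearW => n; rewrite normr_ge0 /=.
apply: le_trans (bop_le (u n - T) x); rewrite bop_subE ler_norml.
have h (a b : H) : hnorm a - hnorm b <= hnorm (a - b).
  by rewrite lerBlDr; have := hnormD (a - b) b; rewrite subrK.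
by rewrite lerNl opprB {1}hnormB !h.
Qed.

End Limits.

Section Exponential.
Variables (R : realType) (H : hilbertType R).
Implicit Types (S T X Y B : bop H) (x y : H).

Definition exp_sum T n : bop H := series (fun k => (k`!%:R : R)^-1 *: T ^+ k) n.

Lemma exp_term_norm T k : `|(k`!%:R : R)^-1 *: T ^+ k| <= exp_coeff `|T| k.
Proof.
rewrite normrZ ger0_norm ?invr_ge0 // /exp_coeff /= [leRHS]mulrC.
by rewrite ler_wpM2l ?invr_ge0 ?bop_normX.
Qed.

Lemma exp_sum_cvg T : exp_sum T @ \oo --> exp_op T.
Proof.
by have := bop_series_cvg (exp_term_norm T) (is_cvg_series_exp_coeff `|T|).
Qed.

Arguments exp_sum_cvg T [t] _.

Lemma exp_coeff_cvg (a : R) : series (exp_coeff a) @ \oo --> expR a.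
Proof. exact: is_cvg_series_exp_coeff. Qed.

Lemma exp_op0 : exp_op (0 : bop H) = 1.
Proof.
apply: (bop_cvg_unique (exp_sum_cvg 0)); apply: cvg_near_cst.
exists 1%N => // -[//|n] _; rewrite /exp_sum /series /= big_nat_recl // big1.
  by rewrite fact0 invr1 scale1r expr0 addr0.
by move=> k _; rewrite expr0n /= scaler0.
Qed.

Lemma exp_op_comm X B : X * B = B * X -> exp_op X * B = B * exp_op X.
Proof.
move=> XB.
have XkB k : X ^+ k * B = B * X ^+ k by exact/esym/(commrX k (esym XB)).
have sB n : exp_sum X n * B = B * exp_sum X n.
  rewrite /exp_sum /series /= mulr_suml mulr_sumr; apply: eq_bigr => k _.
  by rewrite bop_scaleAl bop_scaleAr XkB.
apply: (@bop_cvg_unique _ _ (fun n => exp_sum X n * B)).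
  by apply: cvg_bopM; [exact: exp_sum_cvg | exact: cvg_cst].
rewrite (_ : (fun n => _) = (fun n => B * exp_sum X n)); last exact: funext.
by apply: cvg_bopM; [exact: cvg_cst | exact: exp_sum_cvg].
Qed.

(** Both sums run over pairs [(k, i)]: the triangle [k + i < n] is cut out of the
    square. *)
Lemma cauchy_product_rest (V : zmodType) (f : nat -> nat -> V) n :
  \sum_(0 <= i < n) \sum_(0 <= k < n) f k i -
  \sum_(0 <= m < n) \sum_(0 <= i < m.+1) f (m - i)%N i =
  \sum_(0 <= i < n) \sum_(n - i <= k < n) f k i.
Proof.
have -> : \sum_(0 <= m < n) \sum_(0 <= i < m.+1) f (m - i)%N i =
    \sum_(0 <= i < n) \sum_(i <= m < n) f (m - i)%N i.
  under eq_big_nat => m /andP[_ mn] do rewrite (big_nat_widen _ _ _ _ _ mn).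
  rewrite (exchange_big_dep_nat predT) //=; apply: eq_bigr => i _.
  by rewrite [RHS](big_nat_widenl _ _ _ _ _ (leq0n i)).
rewrite -sumrB; apply: eq_big_nat => i /andP[_ ni].
have -> : \sum_(i <= m < n) f (m - i)%N i = \sum_(0 <= k < n - i) f k i.
  by rewrite -{1}(add0n i) big_addn; apply: eq_bigr => k _; rewrite addnK.
by rewrite (@big_cat_nat _ _ _ (n - i)%N) //= ?leq_subr // addrAC subrr add0r.
Qed.

Lemma binomial_coeffE n (i : nat) : (i <= n)%N ->
  (n`!%:R : R)^-1 * 'C(n, i)%:R = ((n - i)`!%:R)^-1 * (i`!%:R)^-1.
Proof.
move=> ni; rewrite -(bin_fact ni) !natrM.
by field; rewrite !pnatr_eq0 -!lt0n !fact_gt0 bin_gt0.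
Qed.

Lemma exp_termD X Y n : X * Y = Y * X ->
  (n`!%:R : R)^-1 *: (X + Y) ^+ n =
  \sum_(0 <= i < n.+1) ((n - i)`!%:R : R)^-1 *: X ^+ (n - i) * ((i`!%:R : R)^-1 *: Y ^+ i).
Proof.
move=> XY; rewrite exprDn_comm // scaler_sumr big_mkord.
apply: eq_bigr => i _; have sn (v : bop H) k : v *+ k = (k%:R : R) *: v by rewrite scaler_nat.
rewrite sn scalerA binomial_coeffE -1?ltnS //.
by rewrite bop_scaleAl bop_scaleAr scalerA.
Qed.

Lemma exp_coeffD (a b : R) n :
  exp_coeff (a + b) n = \sum_(0 <= i < n.+1) exp_coeff a (n - i)%N * exp_coeff b i.
Proof.
rewrite /exp_coeff /= exprDn big_mkord mulr_suml; apply: eq_bigr => i _.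
have ni : (i <= n)%N by rewrite -ltnS.
rewrite [LHS](_ : _ = a ^+ (n - i) * b ^+ i * ((n`!%:R)^-1 * 'C(n, i)%:R)).
  by rewrite binomial_coeffE //; ring.
move: (a ^+ (n - i) * b ^+ i) => c.
by rewrite -(mulr_natr c) -mulrA [X in c * X]mulrC.
Qed.

(** The remainder of the Cauchy product of operator exponentials is dominated
    by the one of the real exponentials of the norms, which vanishes. *)
Lemma exp_opD X Y : X * Y = Y * X -> exp_op (X + Y) = exp_op X * exp_op Y.
Proof.
move=> XY; apply/esym/subr0_eq/normr0_eq0/eqP; rewrite eq_le normr_ge0 andbT.
have L : (fun n => exp_sum X n * exp_sum Y n - exp_sum (X + Y) n) @ \oo -->
    exp_op X * exp_op Y - exp_op (X + Y).
  by apply: cvgB; [apply: cvg_bopM|]; exact: exp_sum_cvg.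
set a := `|X|; set b := `|Y|.
have r : (fun n => series (exp_coeff a) n * series (exp_coeff b) n -
    series (exp_coeff (a + b)) n) @ \oo --> (0 : R).
  rewrite -[X in _ --> X](subrr (expR (a + b))) {1}expRD.
  by apply: cvgB; [apply: cvgM|]; exact: exp_coeff_cvg.
apply: (bop_cvg_norm_le L r) => n.
have -> : exp_sum X n * exp_sum Y n - exp_sum (X + Y) n =
    \sum_(0 <= i < n) \sum_(n - i <= k < n)
      (k`!%:R : R)^-1 *: X ^+ k * ((i`!%:R : R)^-1 *: Y ^+ i).
  rewrite -cauchy_product_rest; congr (_ - _).
    by rewrite mulr_sumr; apply: eq_bigr => i _; rewrite mulr_suml.
  by apply: eq_bigr => m _; exact: exp_termD.
have -> : series (exp_coeff a) n * series (exp_coeff b) n - series (exp_coeff (a + b)) n =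
    \sum_(0 <= i < n) \sum_(n - i <= k < n) exp_coeff a k * exp_coeff b i.
  rewrite -(cauchy_product_rest (fun k i => exp_coeff a k * exp_coeff b i)); congr (_ - _).
    by rewrite mulr_sumr; apply: eq_bigr => i _; rewrite mulr_suml.
  by apply: eq_bigr => m _; exact: exp_coeffD.
apply: le_trans (ler_norm_sum _ _ _) _; apply: ler_sum => i _.
apply: le_trans (ler_norm_sum _ _ _) _; apply: ler_sum => k _.
by apply: le_trans (bop_normM _ _) _; rewrite ler_pM // exp_term_norm.
Qed.

Lemma exp_opK X : exp_op X * exp_op (- X) = 1.
Proof. by rewrite -exp_opD ?subrr ?exp_op0 // mulrN mulNr. Qed.

Lemma exp_opNK X : exp_op (- X) * exp_op X = 1.
Proof. by rewrite -{2}[X]opprK exp_opK. Qed.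

(** The remainder series is dominated by the one of the real exponential at
    [|X|], hence by [a ^ 2 exp a] with [a = |X|]. *)
Lemma exp_op_rest X : `|exp_op X - 1 - X| <= `|X| ^+ 2 * expR `|X|.
Proof.
have h (a : R) : 0 <= a -> expR a - 1 - a <= a ^+ 2 * expR a.
  move=> a0; have e1 := expR_ge1Dx (- a).
  have e2 : expR a * (1 - a) <= 1.
    by have := ler_wpM2l (expR_ge0 a) e1; rewrite expRxMexpNx_1.
  have e3 : expR a - 1 <= a * expR a by nra.
  by have e4 : a * (expR a - 1) <= a * (a * expR a) by [apply: ler_wpM2l]; nra.
apply: le_trans (h _ _); last exact: normr_ge0.
apply: (@bop_cvg_norm_le _ _ (fun n => exp_sum X n.+2 - 1 - X)
  (fun n => series (exp_coeff `|X|) n.+2 - 1 - `|X|)).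
- do 2![apply: cvgB; last exact: cvg_cst].
  by rewrite (cvg_shiftS (fun n => exp_sum X n.+1)) cvg_shiftS; exact: exp_sum_cvg.
- do 2![apply: cvgB; last exact: cvg_cst].
  rewrite (cvg_shiftS (fun n => series (exp_coeff `|X|) n.+1)) cvg_shiftS.
  exact: exp_coeff_cvg.
move=> n; rewrite /exp_sum /series /= !big_nat_recl // /exp_coeff /=.
rewrite !expr0 !expr1 fact0 invr1 !scale1r mulr1.
have E (V : zmodType) (a b c : V) : a + (b + c) - a - b = c.
  by rewrite (addrC a) addrK (addrC b) addrK.
rewrite E mulr1 E; apply: le_trans (ler_norm_sum _ _ _) _; apply: ler_sum => k _.
exact: exp_term_norm.
Qed.

Lemma bop_powerB X Y (M : R) k : `|X| <= M -> `|Y| <= M ->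
  `|X ^+ k.+1 - Y ^+ k.+1| <= k.+1%:R * M ^+ k * `|X - Y|.
Proof.
move=> XM YM; have M0 : 0 <= M by exact: le_trans (normr_ge0 _) XM.
elim: k => [|k IH]; first by rewrite !expr1 expr0 !mul1r.
have -> : X ^+ k.+2 - Y ^+ k.+2 = X * (X ^+ k.+1 - Y ^+ k.+1) + (X - Y) * Y ^+ k.+1.
  by rewrite mulrBr mulrBl -!exprS addrA subrK.
apply: le_trans (ler_normD _ _) _.
have a1 : `|X * (X ^+ k.+1 - Y ^+ k.+1)| <= M * (k.+1%:R * M ^+ k * `|X - Y|).
  by apply: le_trans (bop_normM _ _) _; rewrite ler_pM.
have a2 : `|(X - Y) * Y ^+ k.+1| <= `|X - Y| * M ^+ k.+1.
  apply: le_trans (bop_normM _ _) _; rewrite ler_wpM2l //.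
  by apply: le_trans (bop_normX _ _) _; rewrite lerXn2r ?nnegrE.
apply: le_trans (lerD a1 a2) _; rewrite -[in leRHS]natr1 exprS.
by rewrite le_eqVlt; apply/orP; left; apply/eqP; ring.
Qed.

(** Termwise, [|X ^ k - Y ^ k| <= k M ^ (k - 1) |X - Y|]. *)
Lemma exp_op_lipschitz X Y (M : R) : `|X| <= M -> `|Y| <= M ->
  `|exp_op X - exp_op Y| <= `|X - Y| * expR M.
Proof.
move=> XM YM.
apply: (@bop_cvg_norm_le _ _ (fun n => exp_sum X n.+1 - exp_sum Y n.+1)
  (fun n => `|X - Y| * series (exp_coeff M) n)).
- by apply: cvgB; rewrite cvg_shiftS; exact: exp_sum_cvg.
- by apply: cvgM; [exact: cvg_cst | exact: exp_coeff_cvg].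
move=> n; rewrite /exp_sum /series /= !big_nat_recl // !expr0 opprD addrACA subrr add0r.
rewrite -sumrB mulr_sumr; apply: le_trans (ler_norm_sum _ _ _) _.
apply: ler_sum => k _; rewrite -scalerBr normrZ ger0_norm ?invr_ge0 //.
apply: (@le_trans _ _ ((k.+1`!%:R)^-1 * (k.+1%:R * M ^+ k * `|X - Y|))).
  by rewrite ler_wpM2l ?invr_ge0 // bop_powerB.
rewrite /exp_coeff /= factS natrM le_eqVlt; apply/orP; left; apply/eqP.
have kf : (k`!%:R : R) != 0 by rewrite pnatr_eq0 -lt0n fact_gt0.
have k1 : (k.+1%:R : R) != 0 by rewrite pnatr_eq0.
by move: kf k1; move: (k.+1%:R : R) (k`!%:R : R) => p q q0 p0; field; rewrite q0.
Qed.

Lemma antiherm_sum X x y n : op_antihermitian X ->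
  dot (exp_sum X n x) y = dot x (exp_sum (- X) n y).
Proof.
move=> aX; have XN : forall u v, dot (X u) v = dot u (- X v).
  by move=> u v; rewrite aX dotNr.
rewrite /exp_sum /series /= !bop_sumE dot_suml dot_sumr; apply: eq_bigr => k _.
rewrite !bop_scaleE dotZl dotZr conjc_real; congr (_ * _).
elim: k x y => [|k IH] x y; first by rewrite !expr0.
by rewrite exprSr bop_mulE IH XN exprS.
Qed.

Lemma exp_op_adjoint X x y : op_antihermitian X ->
  dot (exp_op X x) y = dot x (exp_op (- X) y).
Proof.
move=> aX; have := ccvg_dotr y x (exp_sum_cvg (- X)).
under [fun n => _]funext do rewrite -antiherm_sum //.
exact: ccvg_unique (ccvg_dotl x y (exp_sum_cvg X)).
Qed.

End Exponential.

(** * Derivatives of operator curves *)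

Section Derivatives.
Variables (R : realType) (H : hilbertType R).
Implicit Types (Z B : bop H) (f g : R -> bop H) (t : R).

Lemma is_derive_quotient (V : normedModType R) (f : R -> V) (t : R) (df : V) :
  is_derive t 1 f df <-> (fun h : R => h^-1 *: (f (t + h) - f t)) @ 0^' --> df.
Proof.
have E : (fun h : R => h^-1 *: ((f \o shift t) (h *: (1 : R)) - f t)) =
         (fun h : R => h^-1 *: (f (t + h) - f t)).
  apply: funext => h; have -> : h *: (1 : R) = h by exact: mulr1.
  by congr (_ *: (f _ - _)); exact: addrC.
split => [[cf <-]|cf]; first by rewrite -E; exact: cf.
split; first by rewrite /derivable E; apply: cvgP cf.
by rewrite /derive E; apply: cvg_lim cf; exact: norm_hausdorff.
Qed.

Lemma is_derive_shift_cvg (V : normedModType R) (f : R -> V) (t : R) (df : V) :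
  is_derive t 1 f df -> (fun h : R => f (t + h)) @ 0^' --> f t.
Proof.
move=> /is_derive_quotient qf.
have : (fun h : R => h *: (h^-1 *: (f (t + h) - f t)) + f t) @ 0^' --> (0 : R) *: df + f t.
  apply: cvgD; last exact: cvg_cst.
  by apply: cvgZ => //; exact: nbhs_dnbhs.
rewrite scale0r add0r; apply: cvg_trans; apply: near_eq_cvg.
near=> h; have h0 : h != 0 by near: h; exact: nbhs_dnbhs_neq.
by rewrite scalerA divff // scale1r subrK.
Unshelve. all: by end_near.
Qed.

Lemma is_derive_bopM f g t df dg :
  is_derive t 1 f df -> is_derive t 1 g dg ->
  is_derive t 1 (fun s => f s * g s) (df * g t + f t * dg).
Proof.
move=> Df Dg; have qf := (is_derive_quotient _ _ _).1 Df.
have qg := (is_derive_quotient _ _ _).1 Dg; apply/is_derive_quotient.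
have -> : (fun h : R => h^-1 *: (f (t + h) * g (t + h) - f t * g t)) =
  (fun h : R => (h^-1 *: (f (t + h) - f t)) * g (t + h) +
                f t * (h^-1 *: (g (t + h) - g t))).
  apply: funext => h; rewrite bop_scaleAl bop_scaleAr -scalerDr; congr (_ *: _).
  by rewrite mulrBl mulrBr addrA subrK.
apply: cvgD; apply: cvg_bopM => //; first exact: is_derive_shift_cvg Dg.
exact: cvg_cst.
Qed.

(** The group law reduces the derivative at [t] to the one at [0], which is
    controlled by [exp_op_rest]. *)
Lemma is_derive_exp_op Z t :
  is_derive t 1 (fun s => exp_op (s *: Z)) (Z * exp_op (t *: Z)).
Proof.
apply/is_derive_quotient.
have -> : (fun h : R => h^-1 *: (exp_op ((t + h) *: Z) - exp_op (t *: Z))) =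
    (fun h : R => (h^-1 *: (exp_op (h *: Z) - 1)) * exp_op (t *: Z)).
  apply: funext => h; rewrite (addrC t h) scalerDl exp_opD; last first.
    by rewrite !bop_scaleAl !bop_scaleAr !scalerA mulrC.
  by rewrite bop_scaleAl mulrBl mul1r.
apply: cvg_bopM; last exact: cvg_cst.
apply/subr_cvg0/norm_cvg0P.
pose M := `|Z| ^+ 2 * expR `|Z|.
have hM : (fun h : R => `|h| * M) @ 0^' --> (0 : R).
  rewrite -[X in _ --> X](mul0r M); apply: cvgM; last exact: cvg_cst.
  by apply/norm_cvg0P; exact: nbhs_dnbhs.
apply: (squeeze_cvgr _ (cvg_cst _) hM); near=> h.
have h0 : h != 0 by near: h; exact: nbhs_dnbhs_neq.
have h1 : `|h| <= 1.
  near: h; apply: nbhs_dnbhs; exists 1 => //= x /=.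
  by rewrite sub0r normrN => /ltW.
rewrite normr_ge0 /=.
have -> : h^-1 *: (exp_op (h *: Z) - 1) - Z = h^-1 *: (exp_op (h *: Z) - 1 - h *: Z).
  by rewrite [in RHS]scalerBr scalerA mulVf // scale1r.
rewrite normrZ normfV ler_pdivrMl ?normr_gt0 //.
apply: le_trans (exp_op_rest _) _; rewrite normrZ exprMn /M.
have -> : `|h| * (`|h| * (`|Z| ^+ 2 * expR `|Z|)) = `|h| ^+ 2 * `|Z| ^+ 2 * expR `|Z|.
  by ring.
rewrite ler_wpM2l ?mulr_ge0 ?sqr_ge0 // ler_expR ler_piMl //.
Unshelve. all: by end_near.
Qed.

Definition conj_curve Z B t : bop H := exp_op (t *: Z) * B * exp_op (- (t *: Z)).

Lemma exp_op_commZ Z t : exp_op (t *: Z) * Z = Z * exp_op (t *: Z).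
Proof. by apply: exp_op_comm; rewrite bop_scaleAl bop_scaleAr. Qed.

Lemma is_derive_conj_curve Z B t :
  is_derive t 1 (conj_curve Z B) (conj_curve Z (Z * B - B * Z) t).
Proof.
have D2 : is_derive t 1 (fun s => exp_op (- (s *: Z))) (- Z * exp_op (- (t *: Z))).
  have := is_derive_exp_op (- Z) t; rewrite scalerN.
  by under [fun s => _]funext do rewrite scalerN.
have D3 := is_derive_bopM (is_derive_bopM (is_derive_exp_op Z t) (is_derive_cst B t 1)) D2.
rewrite /= mulr0 addr0 in D3.
suff <- : Z * exp_op (t *: Z) * B * exp_op (- (t *: Z)) +
   exp_op (t *: Z) * B * (- Z * exp_op (- (t *: Z))) = conj_curve Z (Z * B - B * Z) t.
  exact: D3.
rewrite /conj_curve -exp_op_commZ mulrBr mulrBl !mulrA; congr (_ + _).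
by rewrite mulrN mulNr.
Qed.

(** Conjugation only sees a generator modulo its commuting perturbations that
    also commute with the conjugated operator. *)
Lemma conj_curve_comm Z C B t : Z * C = C * Z -> C * B = B * C ->
  conj_curve (Z + C) B t = conj_curve Z B t.
Proof.
move=> ZC CB; rewrite /conj_curve scalerDr.
have ZCt : t *: Z * (t *: C) = t *: C * (t *: Z).
  by rewrite !bop_scaleAl !bop_scaleAr ZC.
have -> : exp_op (- (t *: Z + t *: C)) = exp_op (- (t *: C)) * exp_op (- (t *: Z)).
  by rewrite opprD addrC exp_opD // !mulrNN ZCt.
have CtB : exp_op (t *: C) * B = B * exp_op (t *: C).
  by apply: exp_op_comm; rewrite bop_scaleAl bop_scaleAr CB.
rewrite exp_opD // -!mulrA; congr (_ * _).
by rewrite mulrA CtB -mulrA (mulrA (exp_op _)) exp_opK mul1r.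
Qed.

Lemma conj_curve0 Z B : conj_curve Z B 0 = B.
Proof. by rewrite /conj_curve scale0r oppr0 exp_op0 mul1r mulr1. Qed.

Lemma conj_curve_cvg Z B t : conj_curve Z B s @[s --> t] --> conj_curve Z B t.
Proof.
have [D _] := is_derive_conj_curve Z B t.
by apply: differentiable_continuous; apply/derivable1_diffP.
Qed.

End Derivatives.

(** * Compact operators *)

Section Compactness.
Variables (R : realType) (H : hilbertType R).
Implicit Types (S T : bop H) (x y : H).

Lemma compact_op_sub T (C : set H) :
  compact C -> (forall x, hnorm x <= 1 -> C (T x)) -> compact_op T.
Proof.
move=> cC TC; apply: (subclosed_compact _ cC); first exact: closed_closure.
have {1}-> : C = closure C.
  by apply/closure_id; apply: compact_closed cC; exact: norm_hausdorff.
by apply: closure_subset => _ [x /= x1 <-]; exact: TC.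
Qed.

Lemma compact_op_image T x : hnorm x <= 1 -> closure (T @` [set x | hnorm x <= 1]) (T x).
Proof. by move=> x1; apply: subset_closure; exists x. Qed.

Lemma compact_opD S T : compact_op S -> compact_op T -> compact_op (S + T).
Proof.
move=> cS cT; have cST := compact_setX cS cT.
have add_c : {within closure (S @` [set x | hnorm x <= 1]) `*`
    closure (T @` [set x | hnorm x <= 1]), continuous (fun p : H * H => p.1 + p.2)}.
  by apply: continuous_subspaceT => p; exact: add_continuous.
apply: (compact_op_sub (continuous_compact add_c cST)) => x x1.
by exists (S x, T x) => //; split; exact: compact_op_image.
Qed.

Lemma compact_opMl S T : compact_op T -> compact_op (S * T).
Proof.
move=> cT; have Sc : {within closure (T @` [set x | hnorm x <= 1]), continuous S}.
  by apply: continuous_subspaceT => p; exact: bop_cont.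
apply: (compact_op_sub (continuous_compact Sc cT)) => x x1.
by exists (T x) => //; exact: compact_op_image.
Qed.

Lemma compact_opZ (a : R) T : compact_op T -> compact_op (a *: T).
Proof. by rewrite -(mul1r T) -bop_scaleAl; exact: compact_opMl. Qed.

Lemma compact_opN T : compact_op T -> compact_op (- T).
Proof. by rewrite -scaleN1r; exact: compact_opZ. Qed.

Lemma compact_opMr S T : compact_op T -> compact_op (T * S).
Proof.
move=> cT; have r0 : 0 < `|S| + 1 by rewrite ltr_wpDl.
pose r := `|S| + 1; have cC : compact_op (r *: T) by exact: compact_opZ.
apply: (compact_op_sub cC) => x x1.
have -> : (T * S) x = (r *: T) (r^-1%:C%C *: S x).
  rewrite !bopE bopZ scalerA -rmorphM /= mulfV ?scale1r // gt_eqF //.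
apply: compact_op_image; rewrite hnormZ ger0_norm ?invr_ge0 ?(ltW r0) //.
rewrite ler_pdivrMl // mulr1; apply: le_trans (bop_le S x) _.
apply: (@le_trans _ _ `|S|); first by rewrite ler_piMr.
by rewrite lerDl.
Qed.

(** Norm limits of compact operators are compact: an ultrafilter on the closed
    image of the ball that lies near a compact set has arbitrarily small members,
    so it is Cauchy. *)
Lemma compact_op_approx T :
  (forall eps : R, 0 < eps -> exists2 S, compact_op S & `|T - S| <= eps) ->
  compact_op T.
Proof.
move=> TS; rewrite /compact_op compact_ultra => F FU FK.
set K := closure _ in FK *.
suff /cauchy_cvgP /cvg_ex[p Fp] : cauchy F.
  exists p; split => //; apply: closed_closure => B /Fp FB.
  exact: filter_ex (filterI FK FB).
apply/cauchyP => eps0 e0.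
have [eps ep ->] := complex_gt0 e0.
apply: contrapT => nF.
have FN p : F (~` [set x | hnorm (p - x) < eps]).
  case: (in_ultra_setVsetC [set x | hnorm (p - x) < eps] FU) => // Fp.
  by case: nF; exists p; apply: filterS Fp => x; rewrite -ball_normE /= hnormE ltcR.
have [e3 e2] : 0 < eps / 4 /\ 0 < eps / 2 by split; rewrite divr_gt0.
have [S cS TSe] := TS _ e3.
move: cS; rewrite /compact_op => /compact_near_coveringP cS.
have /filterI/(_ FK)/filter_ex[x [xC xK]] :
    \forall i \near F, closure (S @` [set x | hnorm x <= 1]) `<=`
      [set c | eps / 2 <= hnorm (c - i)].
  apply: cS => c _.
  exists ([set c' | hnorm (c - c') < eps / 2], ~` [set x | hnorm (c - x) < eps]) => /=.
    split => //; apply/nbhs_normP; exists (eps / 2)%:C%C; first by rewrite /= ltcR.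
    by move=> z; rewrite /= hnormE ltcR.
  move=> [c' i] /= [cc' /negP]; rewrite -leNgt => ci.
  have : hnorm (c - i) <= hnorm (c - c') + hnorm (c' - i).
    by rewrite (_ : c - i = (c - c') + (c' - i)) ?hnormD // addrA subrK.
  by lra.
have [_ [[y /= y1 <-]]] : exists z, (T @` [set x | hnorm x <= 1]) z /\ hnorm (x - z) < eps / 4.
  have nx : nbhs x [set z | hnorm (x - z) < eps / 4].
    apply/nbhs_normP; exists (eps / 4)%:C%C; first by rewrite /= ltcR.
    by move=> z; rewrite /= hnormE ltcR.
  by have [z [z1 z2]] := xK _ nx; exists z.
have := xC (S y) (@compact_op_image S y y1) => /= h1 h2.
have h3 : hnorm (T y - S y) <= eps / 4.
  rewrite -[_ - _]/((T - S) y); apply: le_trans (bop_le _ _) _.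
  by apply: (le_trans _ TSe); rewrite ler_piMr.
have : hnorm (S y - x) <= hnorm (S y - T y) + hnorm (T y - x).
  by rewrite (_ : S y - x = (S y - T y) + (T y - x)) ?hnormD // addrA subrK.
by rewrite hnormB in h2; rewrite (hnormB (S y) (T y)); lra.
Qed.

Lemma compact_op0 : compact_op (0 : bop H).
Proof. by apply: (compact_op_sub (@compact_set1 _ (0 : H))). Qed.

Lemma real_scale_continuous (v : H) : continuous (fun a : R => a%:C%C *: v).
Proof.
move=> a; apply/cvg_hnormP => eps e0.
have v1 : 0 < hnorm v + 1 by rewrite ltr_wpDl ?hnorm_ge0.
exists (eps / (hnorm v + 1)) => /=; first by rewrite divr_gt0.
move=> c /= ac; rewrite -scalerBl -rmorphB /= hnormZ.
apply: (@le_lt_trans _ _ (`|a - c| * (hnorm v + 1))).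
  by rewrite ler_wpM2l // lerDl.
by rewrite -ltr_pdivlMr.
Qed.

(** The image of the ball lies in that of a square under a continuous map of
    two real variables. *)
Lemma compact_rank1 (u v : H) : compact_op (rank1 u v).
Proof.
pose f (p : R * R) : H := p.1%:C%C *: v + p.2%:C%C *: ('i%C *: v).
have cf : continuous f.
  have c1 : continuous (fun p : R * R => p.1%:C%C *: v).
    move=> p; apply: (@continuous_comp _ _ _ (fst : R * R -> R) (fun a => a%:C%C *: v)).
      exact: cvg_fst.
    exact: real_scale_continuous.
  have c2 : continuous (fun p : R * R => p.2%:C%C *: ('i%C *: v)).
    move=> p; apply: (@continuous_comp _ _ _ (snd : R * R -> R) (fun a => a%:C%C *: ('i%C *: v))).
      exact: cvg_snd.
    exact: real_scale_continuous.
  by move=> p; exact: cvgD (c1 p) (c2 p).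
pose r := hnorm u.
have cI : compact (`[(- r), r]%classic `*` `[(- r), r]%classic : set (R * R)).
  by apply: compact_setX; exact: segment_compact.
apply: (compact_op_sub (continuous_compact (continuous_subspaceT cf) cI)) => x x1.
have b1 : cmod (dot x u) <= r.
  by apply: le_trans (cauchy_schwarz _ _) _; rewrite ler_piMl ?hnorm_ge0.
exists (complex.Re (dot x u), complex.Im (dot x u)).
  have bI : `|complex.Im (dot x u)| <= cmod (dot x u).
    case: (dot x u) => p q; rewrite /cmod normc_def /= -sqrtr_sqr ler_sqrt ?lerDr ?sqr_ge0 //.
    by rewrite addr_ge0 ?sqr_ge0.
  split => /=; rewrite in_itv /= -ler_norml.
    by apply: le_trans (cmod_Re _) b1.
  exact: le_trans bI b1.
rewrite /f /= scalerA -scalerDl; congr (_ *: _).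
by case: (dot x u) => p q; simpc.
Qed.

Lemma compact_op_sum (I : Type) (r : seq I) (P : pred I) (F : I -> bop H) :
  (forall i, P i -> compact_op (F i)) -> compact_op (\sum_(i <- r | P i) F i).
Proof.
by move=> cF; elim/big_ind: _ => //; [exact: compact_op0 | exact: compact_opD].
Qed.

Lemma compact_op_lim (u : nat -> bop H) T :
  u @ \oo --> T -> (forall n, compact_op (u n)) -> compact_op T.
Proof.
move=> /cvgrPdist_le uT cu; apply: compact_op_approx => eps e0.
by have [n un] := filter_ex (uT _ e0); exists (u n).
Qed.

End Compactness.

(** * Matrices in an orthonormal basis *)

Section Basis.
Variables (R : realType) (H : hilbertType R) (e : nat -> H).
Hypothesis e_basis : orthonormal_basis e.
Implicit Types (S T : bop H) (x y : H) (m : nat -> nat -> R[i]) (j k n : nat).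

Lemma e_dot j k : dot (e j) (e k) = (j == k)%:R.
Proof. exact: e_basis.1. Qed.

Lemma hnorm_e k : hnorm (e k) = 1.
Proof.
apply/eqP; rewrite -(@eqrXn2 _ 2) ?hnorm_ge0 //; apply/eqP.
by rewrite hnorm_sqr e_dot eqxx expr1n.
Qed.

Lemma dot_e_suml n (c : nat -> R[i]) j :
  dot (\sum_(0 <= k < n) c k *: e k) (e j) = if (j < n)%N then c j else 0.
Proof.
rewrite dot_suml; under eq_bigr do rewrite dotZl e_dot.
case: ltnP => jn; last first.
  rewrite big_nat_cond big1 // => k; rewrite andbT => /andP[_ kn].
  by rewrite ltn_eqF ?mulr0 //; exact: leq_trans kn jn.
rewrite (bigD1_seq j) ?iota_uniq ?mem_index_iota //= eqxx mulr1 big1 ?addr0 //.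
by move=> k /negPf ->; rewrite mulr0.
Qed.

Lemma vec_ext x y : (forall k, dot x (e k) = dot y (e k)) -> x = y.
Proof.
move=> xy; have := e_basis.2 y.
rewrite (_ : series _ = series (fun k => dot x (e k) *: e k)).
  exact: (cvg_unique (@norm_hausdorff _ _) (e_basis.2 x)).
by congr series; apply: funext => k; rewrite xy.
Qed.

Lemma bop_ext_basis S T : (forall k, S (e k) = T (e k)) -> S = T.
Proof.
move=> ST; apply: bopP => x.
have L (U : bop H) : (fun n => U (series (fun k => dot x (e k) *: e k) n)) @ \oo --> U x.
  by apply: (cvg_comp _ _ (e_basis.2 x)); exact: bop_cont.
have := L T; rewrite (_ : (fun n => _) =
    (fun n => S (series (fun k => dot x (e k) *: e k) n))).
  exact: (cvg_unique (@norm_hausdorff _ _) (L S)).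
apply: funext => n; rewrite /series /= !bop_sum; apply: eq_bigr => k _.
by rewrite !bopZ ST.
Qed.

Lemma bop_ext_entries S T :
  (forall j k, dot (S (e k)) (e j) = dot (T (e k)) (e j)) -> S = T.
Proof. by move=> ST; apply: bop_ext_basis => k; apply: vec_ext. Qed.

Lemma bop_geom_series (u : nat -> bop H) (C s : R) :
  0 <= s < 1 -> (forall k, `|u k| <= C * s ^+ k) ->
  exists T, [/\ series u @ \oo --> T, `|T| <= C / (1 - s) &
    (forall k, compact_op (u k)) -> compact_op T].
Proof.
move=> /andP[s0 s1] uC; have s1' : `|s| < 1 by rewrite ger0_norm.
have gC := @cvg_geometric_series _ C s s1'.
have cu : cvgn (series u) by apply: bop_series_cvg uC _; exact: cvgP gC.
exists (limn (series u)); split => //.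
  apply: (bop_cvg_norm_le cu gC) => n; rewrite /series /=.
  by apply: le_trans (ler_norm_sum _ _ _) _; apply: ler_sum => k _; exact: uC.
by move=> ku; apply: compact_op_lim cu _ => n; exact: compact_op_sum.
Qed.

Lemma series_single_entry (u : nat -> bop H) T x y N :
  series u @ \oo --> T -> (forall k, k != N -> dot (u k x) y = 0) ->
  dot (T x) y = dot (u N x) y.
Proof.
move=> uT u0; apply: ccvg_unique (ccvg_dotl x y uT) _; apply: ccvg_near_eq.
exists N.+1 => // n /= Nn; rewrite /series /= bop_sumE dot_suml.
rewrite (bigD1_seq N) ?iota_uniq ?mem_index_iota //= big1 ?addr0 //.
Qed.

(** A matrix bounded by a product of two geometric sequences is the double,
    absolutely convergent sum of its entries times matrix units. *)
Lemma matrix_op_exists m (C s : R) :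
  0 <= s < 1 -> (forall j k, cmod (m j k) <= C * s ^+ j * s ^+ k) ->
  exists T, [/\ forall j k, dot (T (e k)) (e j) = m j k, compact_op T &
    `|T| <= C / (1 - s) / (1 - s)].
Proof.
move=> s01 mC.
have row j : exists T : bop H, [/\ forall i k, dot (T (e k)) (e i) = if i == j then m j k else 0,
    compact_op T & `|T| <= C / (1 - s) * s ^+ j].
  have uC k : `|rank1 (e k) (m j k *: e j)| <= C * s ^+ j * s ^+ k.
    by apply: le_trans (rank1_norm _ _) _; rewrite hnormZc !hnorm_e mulr1 mul1r.
  have [T [uT TC cT]] := bop_geom_series s01 uC; exists T; split.
  - move=> i k; rewrite (series_single_entry (N := k) uT) /=.
      by rewrite dotZl dotZl !e_dot eqxx mul1r eq_sym; case: eqP => _; rewrite ?mulr1 ?mulr0.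
    by move=> k' kk'; rewrite /= e_dot eq_sym (negPf kk') scale0r dot0l.
  - by apply: cT => k; exact: compact_rank1.
  - by rewrite mulrAC.
have [T_ TP] := choice row.
have TC j : `|T_ j| <= C / (1 - s) * s ^+ j by case: (TP j).
have [T [uT TC' cT]] := bop_geom_series s01 TC; exists T; split => //.
- move=> j k; rewrite (series_single_entry (N := j) uT).
    by case: (TP j) => -> _ _; rewrite eqxx.
  by move=> j' jj'; case: (TP j') => -> _ _; rewrite eq_sym (negPf jj').
- by apply: cT => j; case: (TP j).
Qed.

(** An operator is determined by its entries, so it is the one that
    [matrix_op_exists] builds from them. *)
Lemma geom_entries T (C s : R) : 0 <= s < 1 ->
  (forall j k, cmod (dot (T (e k)) (e j)) <= C * s ^+ j * s ^+ k) ->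
  compact_op T /\ `|T| <= C / (1 - s) / (1 - s).
Proof.
move=> s01 TC; have [S [SE cS nS]] := matrix_op_exists s01 TC.
by have -> : T = S by exact: bop_ext_entries.
Qed.

Lemma op_of_matrixP m : (exists T, forall j k, dot (T (e k)) (e j) = m j k) ->
  forall j k, dot (op_of_matrix e m (e k)) (e j) = m j k.
Proof. exact: getPex. Qed.

Lemma cvg_dot (x_ y_ : nat -> H) x y :
  x_ @ \oo --> x -> y_ @ \oo --> y -> ccvg (fun n => dot (x_ n) (y_ n)) (dot x y).
Proof.
have dist (z_ : nat -> H) z : z_ @ \oo --> z -> (fun n => hnorm (z_ n - z)) @ \oo --> (0 : R).
  move=> /cvg_hnormP zz; apply/cvgrPdist_lt => eps /zz; apply: filterS => n.
  by rewrite sub0r normrN ger0_norm ?hnorm_ge0 // hnormB.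
move=> /dist xx /dist yy.
have L : (fun n => hnorm (x_ n - x) * (hnorm (y_ n - y) + hnorm y) +
    hnorm x * hnorm (y_ n - y)) @ \oo --> (0 : R).
  have -> : (0 : R) = 0 * (0 + hnorm y) + hnorm x * 0 by rewrite mul0r mulr0 addr0.
  apply: cvgD; apply: cvgM => //; last exact: cvg_cst.
  by apply: cvgD => //; exact: cvg_cst.
apply: ccvg_le L _ => n.
have -> : dot (x_ n) (y_ n) - dot x y = dot (x_ n - x) (y_ n) + dot x (y_ n - y).
  by rewrite dotBl dotBr addrA subrK.
apply: le_trans (cmodD _ _) _; apply: lerD; last exact: cauchy_schwarz.
apply: le_trans (cauchy_schwarz _ _) _; rewrite ler_wpM2l ?hnorm_ge0 //.
by rewrite -{1}[y_ n](subrK y) hnormD.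
Qed.

(** Both sides are limits of the same double sums over the expansions of [x]
    and [y]. *)
Lemma antiherm_entries T :
  (forall j k, dot (T (e k)) (e j) = - dot (e k) (T (e j))) -> op_antihermitian T.
Proof.
move=> aT x y.
pose S z := series (fun k => dot z (e k) *: e k).
have Sz z : S z @ \oo --> z by exact: e_basis.2.
have TS z : (fun n => T (S z n)) @ \oo --> T z.
  by apply: (cvg_comp _ _ (Sz z)); exact: bop_cont.
have L2 := cvg_dot (Sz x) (cvgN (TS y)).
rewrite -dotNr; apply: ccvg_unique (cvg_dot (TS x) (Sz y)) _.
rewrite (_ : (fun n => _) = (fun n => dot (S x n) (- T (S y n)))); first exact: L2.
apply: funext => n; rewrite dotNr /S /series /= !bop_sum !dot_suml -sumrN.
apply: eq_bigr => k _; rewrite !dot_sumr -sumrN; apply: eq_bigr => j _.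
by rewrite !bopZ !dotZl !dotZr aT !mulrN.
Qed.

Lemma P_opE n x : P_op e n x = \sum_(k < n) dot x (e k) *: e k.
Proof.
suff : exists P : bop H, forall x, P x = \sum_(k < n) dot x (e k) *: e k.
  by move=> /getPex; exact.
by exists (\sum_(k < n) rank1 (e k) (e k)) => z; rewrite bop_sumE.
Qed.

Lemma P_op_e n k : P_op e n (e k) = if (k < n)%N then e k else 0.
Proof.
rewrite P_opE; apply: vec_ext => j.
rewrite -(big_mkord predT (fun k' => dot (e k) (e k') *: e k')) dot_e_suml e_dot.
case: (eqVneq k j) => [->|kj]; first by case: ifP => _; rewrite ?e_dot ?eqxx ?dot0l.
by case: ifP => _; case: ifP => _; rewrite ?e_dot ?dot0l ?(negPf kj).
Qed.

Lemma P_op_dot n x j : dot (P_op e n x) (e j) = if (j < n)%N then dot x (e j) else 0.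
Proof.
by rewrite P_opE -(big_mkord predT (fun k => dot x (e k) *: e k)) dot_e_suml.
Qed.

Lemma P_compress_entry n T j k :
  dot ((P_op e n * T * P_op e n) (e k)) (e j) =
  if (j < n)%N && (k < n)%N then dot (T (e k)) (e j) else 0.
Proof.
rewrite !bop_mulE P_op_dot P_op_e; case: ifP => //= _.
by case: ifP => // _; rewrite bop0r dot0l.
Qed.

Lemma P_op_norm n : `|P_op e n| <= 1.
Proof.
apply: bop_norm_le => // x; rewrite mul1r.
have h : P_op e n x = x - (x - P_op e n x) by rewrite opprB addrC subrK.
have orth : dot (P_op e n x) (x - P_op e n x) = 0.
  rewrite {1}P_opE dot_suml big1 // => k _; rewrite dotZl.
  by rewrite (dotC (x - P_op e n x) (e k)) dotBl P_op_dot ltn_ord subrr conjc0 mulr0.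
rewrite -(@ler_pXn2r _ 2) ?nnegrE ?hnorm_ge0 //.
have -> : hnorm x ^+ 2 = hnorm (P_op e n x) ^+ 2 + hnorm (x - P_op e n x) ^+ 2.
  by rewrite -pythagoras // addrC subrK.
by rewrite lerDl sqr_ge0.
Qed.

Lemma diag_of_entries T (d : nat -> R[i]) :
  (forall j k, dot (T (e k)) (e j) = if j == k then d k else 0) -> is_diag e T d.
Proof.
move=> TE k; apply: vec_ext => j; rewrite TE dotZl e_dot eq_sym.
by case: eqP => _; rewrite ?mulr1 ?mulr0.
Qed.

(** An operator commuting with a diagonal one with distinct real entries is
    diagonal: its [(j, k)] entry is multiplied by [lambda k - lambda j]. *)
Lemma commutant_diagonal b Y (lambda : nat -> R) :
  is_diag e b (fun k => (lambda k)%:C%C) -> op_hermitian b -> injective lambda ->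
  Y * b = b * Y -> diagonal e Y.
Proof.
move=> bd bh linj Yb j k jk.
have E : dot ((Y * b) (e k)) (e j) = dot ((b * Y) (e k)) (e j) by rewrite Yb.
rewrite !bop_mulE bd bopZ dotZl bh bd dotZr conjc_real in E.
have lkj : (lambda k)%:C%C - (lambda j)%:C%C != 0 :> R[i].
  by rewrite subr_eq0; apply: contra jk => /eqP/complexI/linj ->.
by apply: (mulfI lkj); rewrite mulr0 mulrBl E subrr.
Qed.

(** [D] only adds to [Z (e 0)] a multiple of [e 0], which is orthogonal to it. *)
Lemma diagonal_lower (Z D : bop H) : diagonal e D -> dot (Z (e 0%N)) (e 0%N) = 0 ->
  hnorm (Z (e 0%N)) <= `|Z + D|.
Proof.
move=> dD Z0; apply: (@le_trans _ _ (hnorm ((Z + D) (e 0%N)))); last first.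
  by have := bop_le (Z + D) (e 0%N); rewrite hnorm_e // mulr1.
have DE : D (e 0%N) = dot (D (e 0%N)) (e 0%N) *: e 0%N.
  apply: vec_ext => j; rewrite dotZl e_dot.
  by case: (eqVneq 0%N j) => [<-|j0]; rewrite ?mulr1 // mulr0 dD // eq_sym.
rewrite -(@ler_pXn2r _ 2) ?nnegrE ?hnorm_ge0 // bop_addE pythagoras.
  by rewrite lerDl sqr_ge0.
by rewrite DE dotZr Z0 mulr0.
Qed.

Lemma diagonalB S T : diagonal e S -> diagonal e T -> diagonal e (S - T).
Proof. by move=> dS dT j k jk; rewrite bop_subE dotBl dS // dT // subrr. Qed.

End Basis.

(** * Unitary operators and orbits *)

Section Unitaries.
Variables (R : realType) (H : hilbertType R).
Implicit Types (S T u v b A K : bop H) (x y : H).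

Lemma adj_unique T S : (forall x y, dot (T x) y = dot x (S y)) -> adj T = S.
Proof.
move=> TS; have E : exists S : bop H, forall x y, dot (T x) y = dot x (S y) by exists S.
have TA : forall x y, dot (T x) y = dot x (adj T y) by exact: getPex E.
apply: bopP => y; apply: dot_ext => z.
by rewrite dotC -TA TS -dotC.
Qed.

(** An operator without adjoint would get the default value [0] for [adj], which
    cannot be an inverse unless [H] is trivial. *)
Lemma unitary_adj u : op_unitary u -> forall x y, dot (u x) y = dot x (adj u y).
Proof.
move=> [u1 _].
have [E|nE] := pselect (exists S : bop H, forall x y, dot (u x) y = dot x (S y)).
  exact: getPex E.
have u0 : adj u = 0.
  by rewrite /adj getPN // => S SP; apply: nE; exists S.
have triv x : x = 0.
  by rewrite -[x]/((1 : bop H) x) -u1 u0 mul0r.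
by move=> x y; rewrite (triv y) dot0r bop0r dot0r.
Qed.

Lemma unitary_intro u v : u * v = 1 -> v * u = 1 ->
  (forall x y, dot (u x) y = dot x (v y)) -> op_unitary u /\ adj u = v.
Proof. by move=> uv vu /adj_unique uE; rewrite /op_unitary uE. Qed.

Lemma unitary_adj_unitary u : op_unitary u -> op_unitary (adj u) /\ adj (adj u) = u.
Proof.
move=> uU; have [u1 u2] := uU; apply: unitary_intro => // x y.
by rewrite dotC -(unitary_adj uU) -dotC.
Qed.

Lemma unitary_mul u v : op_unitary u -> op_unitary v ->
  op_unitary (u * v) /\ adj (u * v) = adj v * adj u.
Proof.
move=> uU vU; have [[u1 u2] [v1 v2]] := (uU, vU); apply: unitary_intro.
- by rewrite !mulrA -(mulrA u) v2 mulr1 u2.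
- by rewrite !mulrA -(mulrA (adj v)) u1 mulr1 v1.
- by move=> x y; rewrite !bop_mulE (unitary_adj uU) (unitary_adj vU).
Qed.

Lemma unitary_hnorm u x : op_unitary u -> hnorm (u x) = hnorm x.
Proof.
move=> uU; apply/eqP; rewrite -(@eqrXn2 _ 2) ?hnorm_ge0 //; apply/eqP.
by rewrite !hnorm_sqr (unitary_adj uU) -bop_mulE uU.1.
Qed.

Lemma unitary_norm_le u : op_unitary u -> `|u| <= 1.
Proof. by move=> uU; apply: bop_norm_le => // x; rewrite unitary_hnorm // mul1r. Qed.

Lemma unitary_conj_norm u T : op_unitary u -> `|u * T * adj u| = `|T|.
Proof.
have le v S : op_unitary v -> `|v * S * adj v| <= `|S|.
  move=> vU; apply: le_trans (bop_normM _ _) _.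
  apply: le_trans (ler_wpM2l (normr_ge0 _) (unitary_norm_le (unitary_adj_unitary vU).1)) _.
  rewrite mulr1; apply: le_trans (bop_normM _ _) _.
  by apply: le_trans (ler_wpM2r (normr_ge0 _) (unitary_norm_le vU)) _; rewrite mul1r.
move=> uU; apply/eqP; rewrite eq_le le //=.
have [aU aE] := unitary_adj_unitary uU.
have := le (adj u) (u * T * adj u) aU; rewrite aE !mulrA uU.1 mul1r.
by rewrite -mulrA uU.1 mulr1.
Qed.

Lemma unitary_conj_herm u b : op_unitary u -> op_hermitian b -> op_hermitian (u * b * adj u).
Proof.
move=> uU bh x y; have [aU aE] := unitary_adj_unitary uU.
by rewrite !bop_mulE (unitary_adj uU) bh (unitary_adj aU) aE.
Qed.

Lemma antiherm_conj u K : op_unitary u -> op_antihermitian K ->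
  op_antihermitian (u * K * adj u).
Proof.
move=> uU Ka x y; have [aU aE] := unitary_adj_unitary uU.
by rewrite !bop_mulE (unitary_adj uU) Ka (unitary_adj aU) aE.
Qed.

Lemma antihermZ (a : R) K : op_antihermitian K -> op_antihermitian (a *: K).
Proof. by move=> Ka x y; rewrite !bop_scaleE dotZl dotZr conjc_real Ka mulrN. Qed.

Lemma antihermD S T : op_antihermitian S -> op_antihermitian T -> op_antihermitian (S + T).
Proof. by move=> Sa Ta x y; rewrite !bop_addE dotDl dotDr Sa Ta opprD. Qed.

Lemma antihermN T : op_antihermitian T -> op_antihermitian (- T).
Proof. by move=> Ta x y; rewrite !bop_oppE dotNl dotNr Ta. Qed.

Lemma exp_unitary K : op_antihermitian K ->
  op_unitary (exp_op K) /\ adj (exp_op K) = exp_op (- K).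
Proof.
move=> Ka; apply: unitary_intro; [exact: exp_opK | exact: exp_opNK |].
by move=> x y; exact: exp_op_adjoint.
Qed.

Lemma Uc_exp K : Kah K -> Uc (exp_op K).
Proof.
move=> [cK Ka]; split; first by case: (exp_unitary Ka).
have L : (fun n => exp_sum K n.+1 - 1) @ \oo --> exp_op K - 1.
  by apply: cvgB; [rewrite cvg_shiftS; exact: exp_sum_cvg | exact: cvg_cst].
apply: compact_op_lim L _ => n; rewrite /exp_sum /series /= big_nat_recl // fact0 invr1.
rewrite scale1r expr0 addrAC subrr add0r; apply: compact_op_sum => k _.
by apply: compact_opZ; rewrite exprSr; exact: compact_opMl.
Qed.

Lemma Uc_mul u v : Uc u -> Uc v -> Uc (u * v).
Proof.
move=> [uU cu] [vU cv]; split; first by case: (unitary_mul uU vU).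
have -> : u * v - 1 = (u - 1) * v + (v - 1) by rewrite mulrBl mul1r addrA subrK.
by apply: compact_opD => //; exact: compact_opMr.
Qed.

Lemma Uc_adj u : Uc u -> Uc (adj u).
Proof.
move=> [uU cu]; split; first by case: (unitary_adj_unitary uU).
have -> : adj u - 1 = - ((u - 1) * adj u) by rewrite mulrBl mul1r uU.2 opprB.
by apply: compact_opN; exact: compact_opMr.
Qed.

Lemma orbit_conj A u b v : Uc u -> A = u * b * adj u -> Uc v -> orbit A (v * b * adj v).
Proof.
move=> uU AE vU; exists (v * adj u); first exact: Uc_mul (Uc_adj uU).
have [[uU' _] [vU' _]] := (uU, vU); have [aU aE] := unitary_adj_unitary uU'.
rewrite (unitary_mul vU' aU).2 aE AE !mulrA -(mulrA v) uU'.1 mulr1.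
by rewrite -(mulrA (v * b)) uU'.1 mulr1.
Qed.

Lemma orbit_unitary A u b (w : bop H) : Uc u -> A = u * b * adj u -> orbit A w ->
  exists2 v, op_unitary v & w = v * b * adj v.
Proof.
move=> [uU _] AE [v [vU _] <-]; have [vuU vuE] := unitary_mul vU uU.
by exists (v * u) => //; rewrite vuE AE !mulrA.
Qed.

End Unitaries.

(** * A lower bound for the length of curves in an orbit *)

Section LengthBound.
Variable R : realType.
Local Open Scope ereal_scope.

(** The integral of a nonnegative function is a supremum over the simple
    functions below it, hence it is monotone even without measurability. *)
Lemma ge0_le_integral_nomeas (D : set R) (f1 f2 : R -> \bar R) :
  (forall x, D x -> 0 <= f1 x) -> (forall x, D x -> f1 x <= f2 x) ->
  \int[lebesgue_measure]_(x in D) f1 x <= \int[lebesgue_measure]_(x in D) f2 x.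
Proof.
move=> f10 f12; have f20 x : D x -> 0 <= f2 x by move=> Dx; exact: le_trans (f10 _ Dx) (f12 _ Dx).
rewrite !ge0_integralE //; apply: ge_ereal_sup => _ [h /= hf <-].
apply: ereal_sup_ubound; exists h => // x; apply: (le_trans (hf x)).
by rewrite !patchE; case: ifPn => // /[!inE]; exact: f12.
Qed.

(** The integral of [F], which need not be measurable, is compared with the one
    of [|dg|], to which the fundamental theorem of calculus applies. *)
Lemma increment_le_integral (a c : R) (g dg : R -> R) (F : R -> \bar R) : (a <= c)%R ->
  (forall t, t \in `[a, c] -> is_derive t 1%R g (dg t)) ->
  {within `[a, c], continuous dg} ->
  (forall t, t \in `[a, c] -> (`|dg t|)%:E <= F t) ->
  (`|g c - g a|)%:E <= \int[lebesgue_measure]_(t in `[a, c]) F t.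
Proof.
move=> ac Dg cdg dgF.
have F0 t : `[a, c]%classic t -> 0 <= F t.
  by move=> tI; apply: (le_trans _ (dgF _ _)); rewrite ?lee_fin.
move: ac; rewrite le_eqVlt => /orP[/eqP ac|ac].
  by subst c; rewrite subrr normr0; exact: integral_ge0.
have cg t : t \in `[a, c] -> {for t, continuous g}.
  move=> /Dg[D _]; by apply: differentiable_continuous; apply/derivable1_diffP.
have FTC : \int[lebesgue_measure]_(t in `[a, c]) (dg t)%:E = (g c)%:E - (g a)%:E.
  apply: continuous_FTC2 => //.
    split => [t tI||].
    - by have [|D _] := Dg t => //; exact: subset_itv_oo_cc.
    - by apply: cvg_at_right_filter; apply: cg; rewrite in_itv /= lexx ltW.
    - by apply: cvg_at_left_filter; apply: cg; rewrite in_itv /= lexx ltW.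
  move=> t tI; have := Dg t (subset_itv_oo_cc tI).
  by move=> D; rewrite derive1E; exact: derive_val.
have mdg : measurable_fun `[a, c]%classic dg.
  by apply: measurable_realfun.subspace_continuous_measurable_fun => //; exact: measurable_itv.
have -> : (`|g c - g a|)%:E = `| \int[lebesgue_measure]_(t in `[a, c]) (dg t)%:E |.
  by rewrite FTC.
apply: (le_trans (le_abse_integral _ _ _)) => //; first exact/measurable_realfun.measurable_EFinP.
by apply: ge0_le_integral_nomeas => t tI; rewrite ?lee_fin //; exact: dgF.
Qed.

End LengthBound.

Section Lifted.
Variables (R : realType) (H : hilbertType R).
Implicit Types (Y S T B : bop H) (x y : H) (a c t : R).

Lemma bop_entry_cvg (I : Type) (F : set_system I) {FF : Filter F} (f : I -> bop H) T x y :
  f @ F --> T ->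
  (fun i => complex.Re (dot (f i x) y)) @ F --> complex.Re (dot (T x) y).
Proof.
move=> fT; apply/subr_cvg0/norm_cvg0P.
have L : (fun i => `|f i - T| * (hnorm x * hnorm y)) @ F --> (0 : R).
  rewrite -[X in _ --> X](mul0r (hnorm x * hnorm y)).
  by apply: cvgM; [exact/norm_cvg0P/subr_cvg0 | exact: cvg_cst].
apply: (squeeze_cvgr _ (cvg_cst _) L); apply: nearW => i; rewrite normr_ge0 /=.
rewrite -raddfB -dotBl; apply: le_trans (cmod_Re _) _.
apply: le_trans (cauchy_schwarz _ _) _.
by rewrite mulrA ler_wpM2r ?hnorm_ge0 // -[_ - _]/((f i - T) x) bop_le.
Qed.

Lemma is_derive_entry (f : R -> bop H) t df x y : is_derive t 1 f df ->
  is_derive t 1 (fun s => complex.Re (dot (f s x) y)) (complex.Re (dot (df x) y)).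
Proof.
move=> /is_derive_quotient Df; apply/is_derive_quotient.
have -> : (fun h : R => h^-1 *: (complex.Re (dot (f (t + h) x) y) - complex.Re (dot (f t x) y))) =
  (fun h : R => complex.Re (dot ((h^-1 *: (f (t + h) - f t)) x) y)).
  apply: funext => h; rewrite !bopE dotZl dotBl -raddfB /=.
  by case: (dot _ _ - dot _ _) => p q /=; rewrite mul0r subr0.
exact: bop_entry_cvg.
Qed.

(** [T] is a C^1 curve of operators whose derivative [dT] is driven by every
    [Y] that drives [w]; such curves form an algebra containing [w]. *)
Definition driven a c (w dw T dT : R -> bop H) :=
  [/\ forall t, t \in `[a, c] -> is_derive t 1 T (dT t),
      {within `[a, c], continuous T}, {within `[a, c], continuous dT} &
      forall t, t \in `[a, c] -> forall Y, Y * w t - w t * Y = dw t ->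
        dT t = Y * T t - T t * Y].

Lemma driven_one a c w dw : driven a c w dw (fun=> 1) (fun=> 0).
Proof.
split => [t _|||t _ Y _]; first exact: is_derive_cst.
- by move=> t; exact: cvg_cst.
- by move=> t; exact: cvg_cst.
- by rewrite mulr1 mul1r subrr.
Qed.

Lemma drivenM a c w dw (T dT S dS : R -> bop H) : driven a c w dw T dT -> driven a c w dw S dS ->
  driven a c w dw (fun t => T t * S t) (fun t => dT t * S t + T t * dS t).
Proof.
move=> [D1 c1 d1 l1] [D2 c2 d2 l2]; split => [t tI|t|t|t tI Y Yw].
- exact: is_derive_bopM (D1 t tI) (D2 t tI).
- by apply: cvg_bopM; [exact: c1 | exact: c2].
- by apply: cvgD; apply: cvg_bopM; [exact: d1|exact: c2|exact: c1|exact: d2].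
- rewrite (l1 t tI Y Yw) (l2 t tI Y Yw) mulrBl mulrBr !mulrA.
  by rewrite addrA subrK.
Qed.

Lemma drivenD a c w dw (T dT S dS : R -> bop H) : driven a c w dw T dT -> driven a c w dw S dS ->
  driven a c w dw (fun t => T t + S t) (fun t => dT t + dS t).
Proof.
move=> [D1 c1 d1 l1] [D2 c2 d2 l2]; split => [t tI|t|t|t tI Y Yw].
- exact: is_deriveD (D1 t tI) (D2 t tI).
- by apply: cvgD; [exact: c1 | exact: c2].
- by apply: cvgD; [exact: d1|exact: d2].
- by rewrite (l1 t tI Y Yw) (l2 t tI Y Yw) mulrDl mulrDr opprD addrACA.
Qed.

Lemma drivenZ a c w dw (T dT : R -> bop H) (r : R) : driven a c w dw T dT ->
  driven a c w dw (fun t => r *: T t) (fun t => r *: dT t).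
Proof.
move=> [D1 c1 d1 l1]; split => [t tI|t|t|t tI Y Yw].
- by have D1t := D1 t tI; exact: is_deriveZ.
- by apply: cvgZr; exact: c1.
- by apply: cvgZr; exact: d1.
- by rewrite (l1 t tI Y Yw) bop_scaleAl bop_scaleAr scalerBr.
Qed.

Lemma drivenX a c w dw (T dT : R -> bop H) n : driven a c w dw T dT ->
  exists dTn, driven a c w dw (fun t => T t ^+ n) dTn.
Proof.
move=> dT1; elim: n => [|n [dTn IH]]; first by exists (fun=> 0); exact: driven_one.
exists (fun t => dT t * T t ^+ n + T t * dTn t).
rewrite (_ : (fun t => _) = (fun t => T t * T t ^+ n)); first exact: drivenM.
by apply: funext => t; rewrite exprS.
Qed.

(** The rate at which [<T x, x>] changes when [T] is conjugated: if [T] is a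
    Hermitian contraction dominating its square then only the component of
    [x] orthogonal to [T x] matters. *)
Lemma driven_rate Y T x : op_antihermitian Y -> op_hermitian T -> hnorm x = 1 ->
  hnorm (T x) ^+ 2 <= complex.Re (dot (T x) x) ->
  complex.Re (dot ((Y * T - T * Y) x) x) ^+ 2 <=
  4 * `|Y| ^+ 2 * (complex.Re (dot (T x) x) - complex.Re (dot (T x) x) ^+ 2).
Proof.
move=> aY hT x1 Tx; set y := T x in Tx *; set f := complex.Re (dot y x) in Tx *.
have dyx : dot y x = f%:C%C.
  have : (dot y x)^*%C = dot y x by rewrite -dotC /y hT.
  rewrite /f; case: (dot y x) => p q /= [/eqP].
  by rewrite eq_sym -addr_eq0 -mulr2n mulrn_eq0 /= => /eqP ->.
have dYyy : complex.Re (dot (Y y) y) = 0.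
  have /(congr1 (@complex.Re R)) := aY y y.
  rewrite (dotC (Y y) y); case: (dot (Y y) y) => p q /= /eqP.
  by rewrite -addr_eq0 -mulr2n mulrn_eq0 /= => /eqP.
set D := complex.Re (dot (Y y) x).
have -> : complex.Re (dot ((Y * T - T * Y) x) x) = 2 * D.
  have TYx : dot (T (Y x)) x = - dot x (Y y) by rewrite hT aY.
  rewrite !bopE dotBl -/y TYx opprK raddfD /= (dotC (Y y) x) /D.
  by case: (dot (Y y) x) => p q /=; ring.
pose n2 := hnorm y ^+ 2; pose z := n2%:C%C *: x - f%:C%C *: y.
have z2 : hnorm z ^+ 2 = n2 * (n2 - f ^+ 2).
  rewrite hnorm_sqr /z !dotBl !dotBr !dotZl !dotZr !conjc_real !dot_hnorm x1.
  rewrite (dotC y x) dyx conjc_real -/n2 -!rmorphM -!rmorphB /=.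
  by ring.
have Dz : complex.Re (dot (Y y) z) = n2 * D.
  rewrite /z dotBr !dotZr !conjc_real raddfB /=.
  have Rs (r : R) (w : R[i]) : complex.Re (r%:C%C * w) = r * complex.Re w.
    by case: w => p q /=; rewrite mul0r subr0.
  by rewrite !Rs dYyy mulr0 subr0.
have bound : (n2 * D) ^+ 2 <= `|Y| ^+ 2 * n2 * (n2 * (n2 - f ^+ 2)).
  rewrite -Dz -z2 -[_ ^+ 2]real_normK ?num_real // -mulrA /n2 -!exprMn.
  rewrite lerXn2r ?nnegrE ?mulr_ge0 ?hnorm_ge0 //.
  apply: le_trans (cmod_Re _) _; apply: le_trans (cauchy_schwarz _ _) _.
  by rewrite mulrA ler_wpM2r ?hnorm_ge0 // bop_le.
have [y0|y0] := eqVneq y 0.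
  by rewrite /D y0 bop0r dot0l /= mulr0 expr0n /= !mulr_ge0 ?sqr_ge0 // /f y0 dot0l /= expr0n subr0.
have n20 : 0 < n2.
  by rewrite exprn_gt0 // hnorm_gt0.
have D2 : D ^+ 2 <= `|Y| ^+ 2 * (n2 - f ^+ 2).
  have n22 : 0 < n2 ^+ 2 by rewrite exprn_gt0.
  rewrite -(ler_pM2l n22) -exprMn (le_trans bound) // le_eqVlt; apply/orP; left; apply/eqP.
  by ring.
rewrite exprMn -mulrA -natrX ler_wpM2l // (le_trans D2) // ler_wpM2l ?sqr_ge0 //.
by rewrite lerD2r.
Qed.

End Lifted.

Section Arccos.
Variable R : realType.
Implicit Types (f df : R -> R) (t k y : R).

(** For a mass [s] between [0] and [1], [acos (2 s - 1) / 2] is the angle whose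
    squared cosine is [s]; the factor [k < 1] keeps it differentiable at both ends
    without increasing its speed. *)
Definition angle k s : R := acos (k * (2 * s - 1)) / 2.

Definition angle_rate k s ds : R := - (k * ds) / Num.sqrt (1 - (k * (2 * s - 1)) ^+ 2).

Lemma angle_arg k s : 0 < k < 1 -> 0 <= s <= 1 -> -1 < k * (2 * s - 1) < 1.
Proof. by move=> /andP[k0 k1] /andP[s0 s1]; apply/andP; split; nra. Qed.

Lemma angle_radicand k s : 0 < k < 1 -> 0 <= s <= 1 -> 0 < 1 - (k * (2 * s - 1)) ^+ 2.
Proof. by move=> k01 s01; have /andP[h1 h2] := angle_arg k01 s01; nra. Qed.

Lemma is_derive_angle f t (df : R) k : 0 < k < 1 -> 0 <= f t <= 1 -> is_derive t 1 f df ->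
  is_derive t 1 (fun s => angle k (f s)) (angle_rate k (f t) df).
Proof.
move=> k01 f01 Df; have Da := is_derive1_acos (angle_arg k01 f01).
have Dg : is_derive t 1 (fun s => k * (2 * f s - 1)) (k * (2 * df)).
  have D1 : is_derive t 1 (fun s => 2 *: f s - 1) (2 *: df - 0).
    by apply: is_deriveB.
  by have := is_deriveZ k D1; rewrite subr0.
have DD : is_derive t 1 (fun s => 2^-1 *: acos (k * (2 * f s - 1)))
    (2^-1 *: (- (Num.sqrt (1 - (k * (2 * f t - 1)) ^+ 2))^-1 * (k * (2 * df)))).
  by have Dc := @is_derive1_comp _ _ (fun s => k * (2 * f s - 1)) t _ _ Da Dg; exact: is_deriveZ.
rewrite (_ : angle_rate _ _ _ =
    2^-1 *: (- (Num.sqrt (1 - (k * (2 * f t - 1)) ^+ 2))^-1 * (k * (2 * df)))).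
  rewrite (_ : (fun s => angle k (f s)) = (fun s => 2^-1 *: acos (k * (2 * f s - 1)))) //.
  by apply: funext => s; rewrite /angle mulrC.
rewrite /angle_rate /GRing.scale /=; field.
by rewrite gt_eqF // sqrtr_gt0 angle_radicand.
Qed.

(** With [y = |Y|] the hypothesis is the conclusion of [driven_rate]; the bound
    amounts to [4 k^2 s (1 - s) <= 1 - k^2 (2 s - 1)^2], that is to [k^2 <= 1]. *)
Lemma angle_rate_le k s ds y : 0 < k < 1 -> 0 <= s <= 1 -> 0 <= y ->
  ds ^+ 2 <= 4 * y ^+ 2 * (s - s ^+ 2) -> `|angle_rate k s ds| <= y.
Proof.
move=> k01 s01 y0 dsy; have r0 := angle_radicand k01 s01.
rewrite /angle_rate normrM normfV normrN (ger0_norm (sqrtr_ge0 _)).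
rewrite ler_pdivrMr ?sqrtr_gt0 // -(@ler_pXn2r _ 2) ?nnegrE ?mulr_ge0 ?sqrtr_ge0 //.
rewrite real_normK ?num_real // !exprMn sqr_sqrtr -?exprMn ?(ltW r0) // !exprMn.
have /andP[k0 k1] := k01; have kk : k ^+ 2 <= 1 by nra.
have h1 : k ^+ 2 * ds ^+ 2 <= k ^+ 2 * (4 * y ^+ 2 * (s - s ^+ 2)).
  by rewrite ler_wpM2l ?sqr_ge0.
have yy := sqr_ge0 y.
apply: (le_trans h1).
have -> : k ^+ 2 * (4 * y ^+ 2 * (s - s ^+ 2)) = y ^+ 2 * (k ^+ 2 * (4 * (s - s ^+ 2))) by ring.
by rewrite ler_wpM2l //; nra.
Qed.

Lemma angle_rate_cvg (T : Type) (F : set_system T) {FF : Filter F} (f df : T -> R)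
    (k s ds : R) :
  0 < k < 1 -> 0 <= s <= 1 -> f @ F --> s -> df @ F --> ds ->
  (fun i => angle_rate k (f i) (df i)) @ F --> angle_rate k s ds.
Proof.
move=> k01 s01 cf cdf.
have ca : (fun i => k * (2 * f i - 1)) @ F --> k * (2 * s - 1).
  apply: cvgM; first exact: cvg_cst.
  by apply: cvgB; [apply: cvgM => //|]; exact: cvg_cst.
apply: cvgM; first by apply: cvgN; apply: cvgM => //; exact: cvg_cst.
apply: cvgV; first by rewrite gt_eqF // sqrtr_gt0 angle_radicand.
apply: (continuous_cvg _ (@sqrt_continuous R _)).
apply: cvgB; first exact: cvg_cst.
by rewrite /GRing.exp /=; exact: cvgM.
Qed.

End Arccos.

Section MinimalAngle.
Variables (R : realType) (H : hilbertType R).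
Implicit Types (S T B b v u : bop H) (x y : H) (a c t l k : R).

Lemma hermB S T : op_hermitian S -> op_hermitian T -> op_hermitian (S - T).
Proof. by move=> hS hT x y; rewrite !bopE dotBl dotBr hS hT. Qed.

Lemma hermZ (r : R) T : op_hermitian T -> op_hermitian (r *: T).
Proof. by move=> hT x y; rewrite !bopE dotZl dotZr conjc_real hT. Qed.

Lemma hermX T n : op_hermitian T -> op_hermitian (T ^+ n).
Proof.
by move=> hT; elim: n => [//|n IH] x y; rewrite {1}exprS exprSr !bop_mulE hT IH.
Qed.

Lemma contractionX T n x : (forall x, hnorm (T x) <= hnorm x) ->
  hnorm ((T ^+ n) x) <= hnorm x.
Proof.
move=> cT; elim: n => [//|n IH]; rewrite exprS bop_mulE.
exact: le_trans (cT _) IH.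
Qed.

(** The parabola [1 - (z - l)^2 / C]: its large powers single out the spectral
    value [l], even when [l] is not isolated. *)
Definition bump l (C : R) T : bop H :=
  1 - C^-1 *: ((T - l *: (1 : bop H)) * (T - l *: (1 : bop H))).

Lemma herm_bump l C T : op_hermitian T -> op_hermitian (bump l C T).
Proof.
move=> hT; apply: hermB => //; apply: hermZ; rewrite -expr2; apply: hermX.
by apply: hermB => //; exact: hermZ.
Qed.

Lemma bump_contraction l C T x : op_hermitian T -> 0 < C -> `|T - l *: (1 : bop H)| ^+ 2 <= C ->
  hnorm (bump l C T x) <= hnorm x.
Proof.
move=> hT C0; rewrite /bump; set B := T - _ => BC.
have hB : op_hermitian B by apply: hermB => //; exact: hermZ.
move: B BC hB => B BC hB.
rewrite -(@ler_pXn2r _ 2) ?nnegrE ?hnorm_ge0 // !bopE hnorm_sqrD hnormN hnormZ dotNr dotZr.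
rewrite conjc_real -hB dot_hnorm -rmorphM /= ger0_norm ?invr_ge0 ?(ltW C0) // exprMn.
have BB : hnorm (B (B x)) ^+ 2 <= C * hnorm (B x) ^+ 2.
  apply: (@le_trans _ _ (`|B| ^+ 2 * hnorm (B x) ^+ 2)).
    by rewrite -exprMn lerXn2r ?nnegrE ?mulr_ge0 ?hnorm_ge0 // bop_le.
  by rewrite ler_wpM2r ?sqr_ge0.
have h : C^-1 ^+ 2 * hnorm (B (B x)) ^+ 2 <= C^-1 * hnorm (B x) ^+ 2.
  apply: le_trans (ler_wpM2l (sqr_ge0 _) BB) _.
  have -> // : C^-1 ^+ 2 * (C * hnorm (B x) ^+ 2) = C^-1 * hnorm (B x) ^+ 2.
  by field; rewrite gt_eqF.
have h2 : 0 <= C^-1 * hnorm (B x) ^+ 2.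
  by rewrite mulr_ge0 ?sqr_ge0 ?invr_ge0 ?ltW.
by lra.
Qed.

Lemma bump_conj l C v b n : op_unitary v ->
  bump l C (v * b * adj v) ^+ n = v * bump l C b ^+ n * adj v.
Proof.
move=> vU.
have sub T S : v * (T - S) * adj v = v * T * adj v - v * S * adj v.
  by rewrite mulrBr mulrBl.
have mul T S : v * (T * S) * adj v = (v * T * adj v) * (v * S * adj v).
  by rewrite !mulrA -(mulrA _ (adj v) v) vU.1 mulr1.
have one : v * 1 * adj v = 1 by rewrite mulr1 vU.2.
have scal (r : R) T : v * (r *: T) * adj v = r *: (v * T * adj v).
  by rewrite bop_scaleAr bop_scaleAl.
elim: n => [|n IH]; first by rewrite !expr0 one.
rewrite !exprS IH mul; congr (_ * _).
by rewrite /bump sub one scal mul sub scal one.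
Qed.

Lemma driven_bump l C n a c (w dw : R -> bop H) : driven a c w dw w dw ->
  exists dT, driven a c w dw (fun t => bump l C (w t) ^+ n * bump l C (w t) ^+ n) dT.
Proof.
move=> driven_w.
have driven_B := drivenD driven_w (drivenZ (- l) (driven_one a c w dw)).
have driven_S := drivenD (driven_one a c w dw) (drivenZ (- C^-1) (drivenM driven_B driven_B)).
have [dS driven_Sn] := drivenX n driven_S; eexists.
rewrite /bump; under [fun t => _]funext do rewrite -!scaleNr.
exact: (drivenM driven_Sn driven_Sn).
Qed.

(** The share of [x] seen by the spectral window of [T] around [l]. *)
Definition bump_mass l C n x T : R := hnorm ((bump l C T ^+ n) x) ^+ 2.

(** [bump_mass] is the quadratic form at [x] of a polynomial in [w t], so it is
    driven by any lift [Y] of the velocity; the angle that it measures then moves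
    at speed at most [|Y|], whence at most the Finsler speed. *)
Lemma angle_le_length A l C b k n x (a c : R) (w : R -> bop H) :
  op_hermitian b -> 0 < C -> `|b - l *: (1 : bop H)| ^+ 2 <= C -> 0 < k < 1 -> hnorm x = 1 ->
  smooth_curve A a c w ->
  (forall t, t \in `[a, c] -> exists2 v, op_unitary v & w t = v * b * adj v) ->
  (`|angle k (bump_mass l C n x (w c)) - angle k (bump_mass l C n x (w a))|%:E
     <= curve_length a c w)%E.
Proof.
move=> hb C0 bC k01 x1 [ac wA wD wc w0] wv.
pose f t := bump_mass l C n x (w t); rewrite -/(f a) -/(f c).
pose dw := derive1 w.
have Dw t : t \in `[a, c] -> is_derive t 1 w (dw t).
  by move=> /wD D; split => //; rewrite /dw derive1E.
have driven_w : driven a c w dw w dw.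
  by split => //; apply: derivable_within_continuous => t /wD.
have [dT [D cT cdT lT]] := driven_bump l C n driven_w.
pose T t := bump l C (w t) ^+ n * bump l C (w t) ^+ n.
have wh t : t \in `[a, c] -> op_hermitian (w t).
  by move=> /wv[v vU ->]; exact: unitary_conj_herm.
have contr t y : t \in `[a, c] -> hnorm (bump l C (w t) y) <= hnorm y.
  move=> tI; apply: bump_contraction => //; first exact: wh.
  have [v vU ->] := wv t tI; rewrite -(_ : v * (l *: (1 : bop H)) * adj v = l *: (1 : bop H)).
    by rewrite -mulrBl -mulrBr unitary_conj_norm.
  by rewrite bop_scaleAr mulr1 bop_scaleAl vU.2.
have fE t : t \in `[a, c] -> f t = complex.Re (dot (T t x) x).
  move=> tI; rewrite /T bop_mulE (hermX n (herm_bump l C (wh t tI))).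
  by rewrite -hnorm_sqr.
have f01 t : t \in `[a, c] -> 0 <= f t <= 1.
  move=> tI; rewrite sqr_ge0 /= expr_le1 ?hnorm_ge0 // -x1.
  by apply: contractionX => y; exact: contr.
pose F t := complex.Re (dot (T t x) x); pose dF t := complex.Re (dot (dT t x) x).
have F01 t : t \in `[a, c] -> 0 <= F t <= 1 by move=> tI; rewrite /F -fE ?f01.
have -> : f c = F c by rewrite fE // in_itv /= lexx ac.
have -> : f a = F a by rewrite fE // in_itv /= lexx ac.
apply: (@increment_le_integral _ a c (fun t => angle k (F t))
  (fun t => angle_rate k (F t) (dF t))) => //.
- move=> t tI; apply: is_derive_angle => //; first exact: F01.
  by apply: is_derive_entry; exact: D.
- rewrite continuous_subspace_in => t /[!inE] tI; apply: angle_rate_cvg => //.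
  + exact: F01.
  + by apply: bop_entry_cvg; exact: cT.
  + by apply: bop_entry_cvg; exact: cdT.
move=> t tI; apply: le_ereal_inf_tmp => _ [Y [[_ aY] Yw] <-]; rewrite lee_fin.
apply: angle_rate_le => //; first exact: F01.
rewrite /dF (lT t tI Y Yw); apply: driven_rate => //.
  have hS := hermX n (herm_bump l C (wh t tI)).
  by move=> y z; rewrite !bop_mulE !hS.
rewrite -[leRHS]/(complex.Re (dot (T t x) x)) -fE // /f /bump_mass.
rewrite lerXn2r ?nnegrE ?hnorm_ge0 // bop_mulE.
by apply: contractionX => y; exact: contr.
Qed.

Variable e : nat -> H.
Hypothesis e_basis : orthonormal_basis e.

Lemma sum_geometric_cvg0 (r s : nat -> R) N : (forall i, 0 <= s i < 1) ->
  (fun n => \sum_(0 <= i < N) r i * s i ^+ n) @ \oo --> (0 : R).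
Proof.
move=> s01; elim: N => [|N IH].
  by under eq_fun do rewrite big_nil; exact: cvg_cst.
have -> : (fun n => \sum_(0 <= i < N.+1) r i * s i ^+ n) =
    (fun n => \sum_(0 <= i < N) r i * s i ^+ n + r N * s N ^+ n).
  by apply: funext => n; rewrite big_nat_recr.
rewrite -[X in _ --> X]addr0; apply: cvgD => //.
by apply: cvg_geometric; have /andP[s0 s1] := s01 N; rewrite ger0_norm.
Qed.

(** Powers of a diagonal contraction with a single entry of modulus one tend
    strongly to the projection onto that basis vector. *)
Lemma contraction_powers_mass S (s : nat -> R) x :
  (forall y, hnorm (S y) <= hnorm y) -> (forall i, S (e i) = (s i)%:C%C *: e i) ->
  s 0%N = 1 -> (forall i, `|s i.+1| < 1) ->
  (fun n => hnorm ((S ^+ n) x) ^+ 2) @ \oo --> cmod (dot x (e 0%N)) ^+ 2.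
Proof.
move=> cS Se s0 s1.
have Sn n i : (S ^+ n) (e i) = (s i ^+ n)%:C%C *: e i.
  elim: n => [|n IH]; first by rewrite !expr0 scale1r.
  by rewrite exprS bop_mulE IH bopZ Se scalerA -rmorphM /= exprSr.
have L : (fun n => (S ^+ n) x) @ \oo --> dot x (e 0%N) *: e 0%N.
  apply/cvg_hnormP => eps e0; have e2 : 0 < eps / 2 by rewrite divr_gt0.
  have /cvg_hnormP/(_ _ e2) := e_basis.2 x.
  move=> [N _ /(_ N.+1 (leqnSn N))] /=; set xN := series _ _ => xxN.
  have rest := sum_geometric_cvg0 (fun i => cmod (dot x (e i.+1))) N
    (fun i => introT andP (conj (normr_ge0 (s i.+1)) (s1 i))).
  have small : \forall n \near \oo,
      \sum_(0 <= i < N) cmod (dot x (e i.+1)) * `|s i.+1| ^+ n < eps / 2.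
    exact: cvgr_lt rest _ e2.
  apply: filterS small => n ltn2.
  have E : (S ^+ n) xN - dot x (e 0%N) *: e 0%N =
      \sum_(0 <= i < N) (dot x (e i.+1) * (s i.+1 ^+ n)%:C%C) *: e i.+1.
    rewrite /xN /series /= bop_sum big_nat_recl // bopZ Sn s0 expr1n scale1r addrAC subrr add0r.
    by apply: eq_bigr => i _; rewrite bopZ Sn scalerA.
  have E2 : hnorm ((S ^+ n) xN - dot x (e 0%N) *: e 0%N) < eps / 2.
    apply: le_lt_trans ltn2; rewrite E; apply: le_trans (hnorm_sum _ _ _) _.
    apply: ler_sum => i _; rewrite hnormZc (hnorm_e e_basis) mulr1 cmodM cmodR normrX.
    by [].
  have -> : dot x (e 0%N) *: e 0%N - (S ^+ n) x =
      - ((S ^+ n) xN - dot x (e 0%N) *: e 0%N) - (S ^+ n) (x - xN).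
    by rewrite bopB !opprB addrA subrK.
  apply: le_lt_trans (hnormD _ _) _; rewrite !hnormN [ltRHS]splitr ltrD //.
  by apply: le_lt_trans (contractionX _ _ cS) xxN.
have := ccvg_Re (cvg_dot L L).
rewrite (_ : complex.Re (dot _ _) = cmod (dot x (e 0%N)) ^+ 2); last first.
  by rewrite -hnorm_sqr hnormZc (hnorm_e e_basis) mulr1.
by under eq_fun do rewrite -hnorm_sqr.
Qed.

Lemma bump_diag l C b (lambda : nat -> R) i : is_diag e b (fun i => (lambda i)%:C%C) ->
  bump l C b (e i) = (1 - C^-1 * (lambda i - l) ^+ 2)%:C%C *: e i.
Proof.
move=> bd; have E : (b - l *: (1 : bop H)) (e i) = (lambda i - l)%:C%C *: e i.
  by rewrite !bopE bd -scalerBl -rmorphB.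
rewrite /bump !bop_addE bop_oppE bop_scaleE bop_mulE E bopZ E bop_oneE !scalerA.
rewrite -{1}(scale1r (e i)) -scalerBl; congr (_ *: _).
by rewrite -mulrA -!rmorphM -expr2 -(rmorph1 (real_complex R)) -rmorphB.
Qed.

(** Every competitor rotates the eigenvector of [lambda 0] at a speed that is at
    most its Finsler speed, hence is at least as long as the angle between the
    eigenlines at its two ends. *)
Lemma minimal_angle A u b U (lambda : nat -> R) (theta c1 c2 : R) (w : R -> bop H) :
  is_diag e b (fun i => (lambda i)%:C%C) -> op_hermitian b -> injective lambda ->
  Uc u -> A = u * b * adj u -> op_unitary U ->
  0 <= theta <= pi / 2 -> cmod (dot (adj U (e 0%N)) (e 0%N)) = cos theta ->
  smooth_curve A c1 c2 w -> joins c1 c2 w b (U * b * adj U) ->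
  (theta%:E <= curve_length c1 c2 w)%E.
Proof.
move=> bd bh linj uU AE UU /andP[th0 thpi] Uth wS wJ.
(* With [+ 1] the weight of every other eigenvalue is at least [0] and less than
   [1]. *)
pose l := lambda 0%N; pose C := `|b - l *: (1 : bop H)| ^+ 2 + 1.
have C0 : 0 < C by rewrite ltr_wpDl ?sqr_ge0.
have bC : `|b - l *: (1 : bop H)| ^+ 2 <= C by rewrite lerDl.
have len0 : (0 <= curve_length c1 c2 w)%E.
  apply: integral_ge0 => t _; apply: le_ereal_inf_tmp => _ [Y _ <-].
  by rewrite lee_fin.
have [->//|thn0] := eqVneq theta 0.
have {thn0}th0 : 0 < theta by rewrite lt_def thn0.
pose f n := hnorm ((bump l C b ^+ n) (adj U (e 0%N))) ^+ 2.
have massb n : bump_mass l C n (e 0%N) b = 1.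
  rewrite /bump_mass.
  have -> : (bump l C b ^+ n) (e 0%N) = e 0%N.
    elim: n => [//|n IH]; rewrite exprS bop_mulE IH (bump_diag _ _ _ bd).
    by rewrite subrr expr0n /= mulr0 subr0 scale1r.
  by rewrite (hnorm_e e_basis) expr1n.
have massU n : bump_mass l C n (e 0%N) (U * b * adj U) = f n.
  by rewrite /bump_mass bump_conj // !bop_mulE unitary_hnorm.
have flim : f @ \oo --> cos theta ^+ 2.
  rewrite -Uth; apply: (@contraction_powers_mass _ (fun i => 1 - C^-1 * (lambda i - l) ^+ 2)).
  - by move=> y; exact: bump_contraction.
  - by move=> i; exact: bump_diag.
  - by rewrite subrr expr0n /= mulr0 subr0.
  move=> i; have d0 : 0 < (lambda i.+1 - l) ^+ 2.
    by rewrite exprn_even_gt0 //= subr_eq0; apply/eqP => /linj.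
  have dC : (lambda i.+1 - l) ^+ 2 < C.
    have := bop_le (b - l *: (1 : bop H)) (e i.+1).
    rewrite !bopE bd -scalerBl -rmorphB /= hnormZ !(hnorm_e e_basis) !mulr1 => h.
    have : (lambda i.+1 - l) ^+ 2 <= `|b - l *: (1 : bop H)| ^+ 2.
      by rewrite -[leLHS]real_normK ?num_real // lerXn2r ?nnegrE.
    by move=> /le_lt_trans; apply; rewrite /C ltrDl.
  have q1 : C^-1 * (lambda i.+1 - l) ^+ 2 < 1 by rewrite mulrC ltr_pdivrMr // mul1r.
  have q0 : 0 < C^-1 * (lambda i.+1 - l) ^+ 2 by rewrite mulr_gt0 ?invr_gt0.
  by rewrite ger0_norm ?ltrBlDr ?ltrDl // subr_ge0 ltW.
have f01 n : 0 <= f n <= 1.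
  rewrite /f sqr_ge0 expr_le1 ?hnorm_ge0 //=.
  rewrite -(hnorm_e e_basis 0) -[leRHS](unitary_hnorm _ (unitary_adj_unitary UU).1).
  by apply: contractionX => y; exact: bump_contraction.
have wv t : t \in `[c1, c2] -> exists2 v, op_unitary v & w t = v * b * adj v.
  by case: wS => _ wA _ _ _ /wA; exact: orbit_unitary uU AE.
have bound k n : 0 < k < 1 -> (`|angle k (f n) - angle k 1|%:E <= curve_length c1 c2 w)%E.
  move=> k01; have := angle_le_length n bh C0 bC k01 (hnorm_e e_basis 0) wS wv.
  by case: wJ => -[-> ->]; rewrite massb massU // distrC.
(* A large power [n], then a factor [k = cos h] close to [1], make the two angles
   [theta] and [0] up to [d / 2] each. *)
apply/lee_addgt0Pr => eps eps0.
pose d := Num.min eps theta; have d0 : 0 < d by rewrite lt_min eps0.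
have [deps dth] : d <= eps /\ d <= theta by split; rewrite ge_min lexx ?orbT.
have pi0 := pi_gt0 R; pose psi := 2 * theta - d.
have psiI : psi \in `[0, pi] by rewrite in_itv /= /psi; apply/andP; split; lra.
have thI : 2 * theta \in `[0, pi] by rewrite in_itv /=; apply/andP; split; lra.
have cpsi : cos (2 * theta) < cos psi by rewrite ltr_cos // /psi; lra.
have slim : (fun n => 2 * f n - 1) @ \oo --> cos (2 * theta).
  have -> : cos (2 * theta) = 2 * cos theta ^+ 2 - 1.
    have -> : 2 * theta = theta + theta by ring.
    by rewrite cosD -!expr2; have := cos2Dsin2 theta; lra.
  by apply: cvgB; [apply: cvgM => //|]; exact: cvg_cst.
have [n sn] := filter_ex (cvgr_lt _ slim _ cpsi).
have clim : (fun x : R => cos x * (2 * f n - 1)) @ 0^'+ --> 2 * f n - 1.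
  rewrite -[X in _ --> X]mul1r -cos0; apply: cvgM; last exact: cvg_cst.
  by apply: cvg_at_right_filter; exact: continuous_cos.
have pi2 : (0 : R) < pi / 2 by lra.
have [h [ch [h0 [hd hpi]]]] : exists h, cos h * (2 * f n - 1) < cos psi /\
    (0 < h /\ (h < d /\ h < pi / 2)).
  near (0 : R)^'+ => h; exists h; split; first by near: h; exact: cvgr_lt clim _ sn.
  split; first by near: h; exact: nbhs_right_gt.
  by split; near: h; exact: nbhs_right_lt.
have hI : h \in `[0, pi] by rewrite in_itv /=; apply/andP; split; lra.
have k01 : 0 < cos h < 1.
  rewrite cos_gt0_pihalf; last by apply/andP; split; lra.
  by rewrite -cos0 ltr_cos // in_itv /= lexx ltW.
have [k0 k1] := andP k01; have /andP[f0 f1] := f01 n.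
have argI : -1 <= cos h * (2 * f n - 1) <= 1.
  by have /andP[a1 a2] := angle_arg k01 (f01 n); rewrite !ltW.
have Apsi : psi <= acos (cos h * (2 * f n - 1)).
  rewrite leNgt; apply/negP => lt_psi.
  have aI : acos (cos h * (2 * f n - 1)) \in `[0, pi].
    by rewrite in_itv /= acos_ge0 ?acos_lepi.
  have := lt_psi; rewrite -ltr_cos // acosK ?in_itv //= => /(lt_trans ch).
  by rewrite ltxx.
have A1 : angle (cos h) 1 = h / 2.
  by rewrite /angle mulr1 (_ : 2 - 1 = 1) ?mulr1 ?cosK //; ring.
have : theta - d <= `|angle (cos h) (f n) - angle (cos h) 1|.
  apply: le_trans (ler_norm _); rewrite A1 /angle; move: Apsi; rewrite /psi; lra.
move=> lb; have := bound (cos h) n k01.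
move=> /(le_trans _) ub; have := ub (theta - d)%:E; rewrite lee_fin => /(_ lb) tL.
apply: (@le_trans _ _ ((theta - d)%:E + eps%:E)%E); last by rewrite leeD2r.
by rewrite lee_fin; lra.
Unshelve. all: by end_near.
Qed.

End MinimalAngle.

(** * Operators rotating a plane *)

Section BlockOperator.
Variables (R : realType) (H : hilbertType R).
Variables (W Z : bop H) (f v : H) (M : R).
Hypotheses (f1 : hnorm f = 1) (vM : hnorm v = M) (M0 : 0 < M) (vf : dot v f = 0).
Hypotheses (aW : op_antihermitian W) (WM : `|W| <= M) (Wf : W f = 0) (Wv : W v = 0).
Hypothesis ZE : forall x, Z x = dot x f *: v - dot x v *: f + W x.
Implicit Types (x : H) (t : R).

Lemma block_first : Z f = v.
Proof.
by rewrite ZE dot_hnorm f1 expr1n scale1r (dotC v f) vf conjc0 scale0r subr0 Wf addr0.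
Qed.

Lemma block_second : Z v = (- M ^+ 2)%:C%C *: f.
Proof.
by rewrite ZE vf scale0r Wv addr0 add0r dot_hnorm vM rmorphN /= scaleNr.
Qed.

(** [Z] rotates the plane of [f] and [v] with speed [M] and acts as [W] on its
    orthogonal complement, so that [|Z|] is at most [M] as soon as [|W|] is. *)
Lemma block_norm : `|Z| <= M.
Proof.
apply: bop_norm_le => [|x]; first exact: ltW.
have M20 : M ^+ 2 != 0 by rewrite expf_neq0 // gt_eqF.
pose a := dot x f; pose c := dot x v.
pose y := x - a *: f - (c * (M ^- 2)%:C%C) *: v.
have fv : dot f v = 0 by rewrite dotC vf conjc0.
have yf : dot y f = 0.
  by rewrite /y !dotBl !dotZl vf dot_hnorm f1 expr1n mulr1 mulr0 subr0 subrr.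
have yv : dot y v = 0.
  rewrite /y !dotBl !dotZl fv dot_hnorm vM mulr0 subr0 -mulrA -rmorphM /= mulVf //.
  by rewrite mulr1 subrr.
have Wxy : W x = W y by rewrite /y !bopB !bopZ Wf Wv !scaler0 !subr0.
pose d := c * (M ^- 2)%:C%C.
have xE : x = a *: f + (d *: v + y) by rewrite /y -/d [d *: v + _]addrC subrK addrC subrK.
have Wdot z w : dot z (W w) = - dot (W z) w by rewrite aW opprK.
have x2 : hnorm x ^+ 2 = cmod a ^+ 2 + (cmod d ^+ 2 * M ^+ 2 + hnorm y ^+ 2).
  rewrite xE pythagoras; last first.
    by rewrite dotDr dotZr !dotZl fv (dotC y f) yf conjc0 !mulr0 addr0.
  rewrite pythagoras; last by rewrite dotZl (dotC y v) yv conjc0 mulr0.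
  by rewrite !hnormZc f1 mulr1 exprMn vM.
have Zx2 : hnorm (Z x) ^+ 2 = cmod a ^+ 2 * M ^+ 2 + (cmod c ^+ 2 + hnorm (W y) ^+ 2).
  rewrite ZE -/a -/c Wxy -addrA pythagoras; last first.
    rewrite dotDr dotNr !dotZl !dotZr vf Wdot Wv dot0l oppr0 !mulr0.
    by rewrite oppr0 addr0.
  rewrite pythagoras; last by rewrite dotNl dotZl Wdot Wf dot0l oppr0 mulr0 oppr0.
  by rewrite hnormN !hnormZc f1 mulr1 exprMn vM.
have cd : cmod c ^+ 2 = cmod d ^+ 2 * M ^+ 2 * M ^+ 2.
  rewrite /d cmodM cmodR ger0_norm ?invr_ge0 ?sqr_ge0 // exprMn.
  by field; rewrite gt_eqF.
have Wy : hnorm (W y) ^+ 2 <= M ^+ 2 * hnorm y ^+ 2.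
  rewrite -exprMn lerXn2r ?nnegrE ?mulr_ge0 ?hnorm_ge0 ?(ltW M0) //.
  by apply: le_trans (bop_le _ _) _; rewrite ler_wpM2r ?hnorm_ge0.
rewrite -(@ler_pXn2r _ 2) ?nnegrE ?hnorm_ge0 ?mulr_ge0 ?hnorm_ge0 ?(ltW M0) //.
by rewrite exprMn Zx2 x2 cd; lra.
Qed.

(** The powers alternate between [f] and [v], gaining a factor [- M ^ 2] at each
    second step; this turns the exponential series into that of the cosine. *)
Lemma block_power n : (Z ^+ n) f = if odd n
  then ((- M ^+ 2) ^+ n./2)%:C%C *: v else ((- M ^+ 2) ^+ n./2)%:C%C *: f.
Proof.
elim: n => [|n IH]; first by rewrite !expr0 /= scale1r.
rewrite exprS bop_mulE IH /= uphalf_half; case: (odd n) => /=.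
  by rewrite bopZ block_second scalerA -rmorphM /= add1n (exprSr (- M ^+ 2)).
by rewrite bopZ block_first add0n.
Qed.

Lemma block_cos t : dot (exp_op (t *: Z) f) f = (cos (M * t))%:C%C.
Proof.
have D := ccvg_dotl f f (@exp_sum_cvg _ _ (t *: Z)).
apply: (ccvg_unique D).
have L : series (cos_coeff (M * t)) @ \oo --> cos (M * t).
  by rewrite unlock; exact: is_cvg_series_cos_coeff.
have E n : dot (exp_sum (t *: Z) n f) f = (series (cos_coeff (M * t)) n)%:C%C.
  rewrite /exp_sum /series /= bop_sumE dot_suml rmorph_sum /=; apply: eq_bigr => k _.
  have -> : (t *: Z) ^+ k = t ^+ k *: Z ^+ k.
    elim: k => [|k IH]; first by rewrite !expr0 scale1r.
    by rewrite !exprS IH bop_scaleAl bop_scaleAr scalerA.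
  rewrite bop_scaleE scalerA block_power /cos_coeff; case: ifP => ko /=.
    by rewrite scalerA dotZl vf mulr0 ko !mul0r.
  rewrite ko scalerA dotZl dot_hnorm f1 expr1n mulr1 -!rmorphM /= mul1r; congr (_ %:C)%C.
  have ke : k = (2 * k./2)%N by rewrite mul2n -[LHS]odd_double_half ko.
  have -> : (- M ^+ 2) ^+ k./2 = (-1) ^+ k./2 * M ^+ k.
    by rewrite [in M ^+ k]ke exprM -exprMn mulN1r.
  by rewrite exprMn -exprnP; ring.
rewrite /ccvg; under eq_fun do rewrite E -rmorphB /= cmodR.
by apply/norm_cvg0P/subr_cvg0.
Qed.

End BlockOperator.

(** * Orbits of one-parameter groups *)

Section ConjugationCurves.
Variables (R : realType) (H : hilbertType R).
Implicit Types (A b u K X Y U x : bop H) (t a c M : R).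

Lemma conj_curveE K b t : op_antihermitian K ->
  conj_curve K b t = exp_op (t *: K) * b * adj (exp_op (t *: K)).
Proof. by move=> aK; rewrite /conj_curve (exp_unitary (antihermZ t aK)).2. Qed.

Lemma KahZ (r : R) K : Kah K -> Kah (r *: K).
Proof. by move=> [cK aK]; split; [exact: compact_opZ | exact: antihermZ]. Qed.

Lemma KahD K Y : Kah K -> Kah Y -> Kah (K + Y).
Proof. by move=> [cK aK] [cY aY]; split; [exact: compact_opD | exact: antihermD]. Qed.

Lemma KahN K : Kah K -> Kah (- K).
Proof. by move=> [cK aK]; split; [exact: compact_opN | exact: antihermN]. Qed.

Lemma Kah_conj U K : op_unitary U -> Kah K -> Kah (U * K * adj U).
Proof.
move=> UU [cK aK]; split; last exact: antiherm_conj.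
by apply: compact_opMr; exact: compact_opMl.
Qed.

(** Conjugation by a unitary is isometric and preserves [Kah]. *)
Lemma finsler_conj U b x : op_unitary U ->
  finsler (U * b * adj U) (U * x * adj U) = finsler b x.
Proof.
have le (V b' x' : bop H) : op_unitary V ->
    (finsler (V * b' * adj V)%R (V * x' * adj V)%R <= finsler b' x')%E.
  move=> VU; apply: le_ereal_inf_tmp => _ [Y [KY Yb] <-].
  apply: ereal_inf_lbound; exists (V * Y * adj V); last by rewrite unitary_conj_norm.
  have mul S T : (V * S * adj V) * (V * T * adj V) = V * (S * T) * adj V.
    by rewrite !mulrA -(mulrA _ (adj V) V) VU.1 mulr1.
  by split; [exact: Kah_conj | rewrite !mul -mulrBl -mulrBr Yb].
move=> UU; apply/eqP; rewrite eq_le le //=.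
have [aU aE] := unitary_adj_unitary UU.
have := le (adj U) (U * b * adj U) (U * x * adj U) aU; rewrite aE.
by rewrite !mulrA UU.1 !mul1r -!mulrA UU.1 !mulr1.
Qed.

Lemma derive1_conj_curve K b t : derive1 (conj_curve K b) t = conj_curve K (K * b - b * K) t.
Proof. by rewrite derive1E; case: (is_derive_conj_curve K b t). Qed.

Lemma conj_curve_eq0 K x t : conj_curve K x t = 0 -> x = 0.
Proof.
move=> /(congr1 (fun T => exp_op (- (t *: K)) * T * exp_op (t *: K))).
by rewrite /conj_curve !mulrA exp_opNK mul1r -mulrA exp_opNK mulr1 mulr0 mul0r.
Qed.

Lemma conj_curve_smooth A u b K a c : Uc u -> A = u * b * adj u -> Kah K ->
  K * b - b * K != 0 -> a <= c -> smooth_curve A a c (conj_curve K b).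
Proof.
move=> uU AE KK Kb ac; have [_ aK] := KK; split => //.
- move=> t _; rewrite conj_curveE //; apply: orbit_conj uU AE _.
  by apply: Uc_exp; exact: KahZ.
- by move=> t _; case: (is_derive_conj_curve K b t).
- rewrite (_ : derive1 _ = conj_curve K (K * b - b * K)); last first.
    by apply: funext => t; exact: derive1_conj_curve.
  by apply: continuous_subspaceT => t; exact: conj_curve_cvg.
- move=> t _; rewrite derive1_conj_curve; apply: contra Kb => /eqP/conj_curve_eq0 ->.
  by [].
Qed.

(** The velocity at [t] is the velocity at [0] conjugated by a unitary, so the
    speed is constant by [finsler_conj]. *)
Lemma conj_curve_length b K M a c : op_antihermitian K ->
  finsler b (K * b - b * K) = M%:E -> a <= c ->
  curve_length a c (conj_curve K b) = ((c - a) * M)%:E.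
Proof.
move=> aK KM ac; rewrite /curve_length.
transitivity (\int[lebesgue_measure]_(t in `[a, c]) (cst M%:E) t)%E.
  apply: eq_integral => t _; rewrite derive1_conj_curve !conj_curveE //.
  by rewrite finsler_conj //; case: (exp_unitary (antihermZ t aK)).
rewrite integral_cst; last exact: measurable_itv.
transitivity (M%:E * (c - a)%:E)%E; last by rewrite -EFinM mulrC.
congr (_ * _)%E; have -> : (c - a)%:E = lebesgue_measure (`[a, c]%classic : set R).
  rewrite lebesgue_measure_itv /= lte_fin.
  by move: ac; rewrite le_eqVlt => /orP[/eqP ->|->//]; rewrite ltxx subrr.
by [].
Qed.

(** Unitary factors have norm at most one, so the distance comes from the two
    exponential factors, each Lipschitz in the generator. *)
Lemma conj_curve_dist K Y b t (B : R) : op_antihermitian K -> op_antihermitian Y ->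
  `|t *: K| <= B -> `|t *: Y| <= B ->
  `|conj_curve K b t - conj_curve Y b t| <= 2 * (`|t| * `|K - Y| * expR B * `|b|).
Proof.
move=> aK aY KB YB.
have -> : conj_curve K b t - conj_curve Y b t =
    (exp_op (t *: K) - exp_op (t *: Y)) * b * exp_op (- (t *: K)) +
    exp_op (t *: Y) * b * (exp_op (- (t *: K)) - exp_op (- (t *: Y))).
  by rewrite /conj_curve !mulrBl mulrBr addrA subrK.
have eK : `|exp_op (- (t *: K))| <= 1.
  by apply: unitary_norm_le; case: (exp_unitary (antihermN (antihermZ t aK))).
have eY : `|exp_op (t *: Y)| <= 1.
  by apply: unitary_norm_le; case: (exp_unitary (antihermZ t aY)).
have d1 : `|exp_op (t *: K) - exp_op (t *: Y)| <= `|t| * `|K - Y| * expR B.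
  by rewrite -normrZ scalerBr; exact: exp_op_lipschitz.
have d2 : `|exp_op (- (t *: K)) - exp_op (- (t *: Y))| <= `|t| * `|K - Y| * expR B.
  have -> : `|t| * `|K - Y| = `|- (t *: K) - - (t *: Y)|.
    by rewrite -normrZ scalerBr distrC opprK addrC.
  by apply: exp_op_lipschitz; rewrite normrN.
rewrite mulr_natl mulr2n; apply: le_trans (ler_normD _ _) _; apply: lerD.
  apply: le_trans (bop_normM _ _) _; rewrite -[leRHS]mulr1; apply: ler_pM => //.
  exact: le_trans (bop_normM _ _) (ler_wpM2r (normr_ge0 b) d1).
apply: le_trans (bop_normM _ _) _; rewrite [leRHS]mulrC ler_pM //.
apply: le_trans (bop_normM _ _) _; rewrite -[leRHS]mul1r.
by rewrite ler_wpM2r.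
Qed.

End ConjugationCurves.

(** * Imaginary matrices *)

Lemma max_exponent j k n : (2 * n + (j + k) <= 4 * maxn (maxn j k) n)%N.
Proof. lia. Qed.

Lemma double_max_exponent j k : (j + k <= 4 * maxn j k)%N.
Proof. lia. Qed.

Lemma below_diagonal_exponent j k : (j < k)%N ->
  (j.+1 + (maxn j.+1 k.+1).-1 = k.+1 + j)%N.
Proof. lia. Qed.

Lemma above_diagonal_exponent j k : (k.+1 < j)%N ->
  (j + (maxn j k.+1).-1 = k.+1 + (2 * j - k.+2))%N.
Proof. lia. Qed.

Lemma max_sub_min (R : realDomainType) (t : R) : Num.max 0 t - Num.min 0 t = `|t|.
Proof.
by have [h|h] := lerP 0 t; [rewrite subr0 ger0_norm | rewrite sub0r ltr0_norm].
Qed.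

Section ImaginaryMatrices.
Variables (R : realType) (H : hilbertType R) (e : nat -> H).
Hypothesis e_basis : orthonormal_basis e.
Implicit Types (S T b : bop H) (m : nat -> nat -> R) (j k n : nat).

(** All the operators of the example are [i] times a real matrix. *)
Definition imag_mx T m := forall j k, dot (T (e k)) (e j) = (0 +i* m j k)%C.

Lemma imag_mxD S T m m' : imag_mx S m -> imag_mx T m' ->
  imag_mx (S + T) (fun j k => m j k + m' j k).
Proof. by move=> Sm Tm j k; rewrite bopE dotDl Sm Tm; simpc. Qed.

Lemma imag_mxN T m : imag_mx T m -> imag_mx (- T) (fun j k => - m j k).
Proof. by move=> Tm j k; rewrite !bopE dotNl Tm; simpc. Qed.

Lemma imag_mxZ (r : R) T m : imag_mx T m -> imag_mx (r *: T) (fun j k => r * m j k).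
Proof. by move=> Tm j k; rewrite !bopE dotZl Tm; simpc. Qed.

Lemma imag_mx_compress n T m : imag_mx T m ->
  imag_mx (P_op e n * T * P_op e n) (fun j k => if (j < n)%N && (k < n)%N then m j k else 0).
Proof. by move=> Tm j k; rewrite P_compress_entry // Tm; case: ifP. Qed.

Lemma imag_mx_eq T S m m' : imag_mx T m -> imag_mx S m' -> (forall j k, m j k = m' j k) -> T = S.
Proof. by move=> Tm Sm mm; apply: (bop_ext_entries e_basis) => j k; rewrite Tm Sm mm. Qed.

Lemma imag_mx_antiherm T m : imag_mx T m -> (forall j k, m j k = m k j) -> op_antihermitian T.
Proof.
move=> Tm ms; apply: (antiherm_entries e_basis) => j k.
by rewrite (dotC (T (e j)) (e k)) !Tm ms; simpc.
Qed.

Lemma imag_mx_diag T m : imag_mx T m -> (forall j k, j != k -> m j k = 0) ->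
  is_diag e T (fun k => (0 +i* m k k)%C).
Proof.
move=> Tm md; apply: (diag_of_entries e_basis) => j k; rewrite Tm.
by case: eqP => [->//|/eqP/md ->].
Qed.

Lemma diag_comm S T (c d : nat -> R[i]) : is_diag e S c -> is_diag e T d -> S * T = T * S.
Proof.
move=> Sc Td; apply: (bop_ext_basis e_basis) => k.
by rewrite !bop_mulE Sc Td !bopZ Sc Td !scalerA mulrC.
Qed.

Lemma compact_P_op n : compact_op (P_op e n).
Proof.
have -> : P_op e n = \sum_(k < n) rank1 (e k) (e k).
  by apply: bopP => x; rewrite P_opE bop_sumE.
by apply: compact_op_sum => k _; exact: compact_rank1.
Qed.

Lemma imag_mx_finite n T m : imag_mx T m ->
  (forall j k, ~~ ((j < n)%N && (k < n)%N) -> m j k = 0) -> T = P_op e n * T * P_op e n.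
Proof.
move=> Tm m0; apply: imag_mx_eq Tm (imag_mx_compress n Tm) _ => j k.
by case: ifPn => // /m0.
Qed.

Lemma compact_compress n T : compact_op (P_op e n * T * P_op e n).
Proof. by apply: compact_opMl; exact: compact_P_op. Qed.

Lemma P_compress_norm n T : `|P_op e n * T * P_op e n| <= `|T|.
Proof.
apply: le_trans (bop_normM _ _) _; rewrite -[leRHS]mulr1.
apply: ler_pM => //; last exact: P_op_norm.
apply: le_trans (bop_normM _ _) _; rewrite -[leRHS]mul1r.
by apply: ler_wpM2r => //; exact: P_op_norm.
Qed.

(** This gives a matrix supported on the first row and column the form that
    [block_norm] asks of [Z - W]. *)
Lemma cross_rank2 T m : imag_mx T m -> (forall j k, m j k = m k j) -> m 0%N 0%N = 0 ->
  (forall j k, m j.+1 k.+1 = 0) ->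
  T = rank1 (e 0%N) (T (e 0%N)) - rank1 (T (e 0%N)) (e 0%N).
Proof.
move=> Tm ms m00 m11; apply: (bop_ext_entries e_basis) => j k.
rewrite !bopE dotBl /= !dotZl !(e_dot e_basis) (dotC (T _) (e k)) !Tm.
case: j k => [|j] [|k] /=; rewrite ?m00 ?m11 //=; simpc => //.
  by rewrite ms.
Qed.

End ImaginaryMatrices.

(** * The entries of the example *)

Section Example.
Variables (R : realType) (H : hilbertType R) (e : nat -> H) (gamma : R).
Hypothesis e_basis : orthonormal_basis e.
Hypothesis gamma_bnd : 0 < `|gamma| < 1.
Implicit Types (S T : bop H) (j k n : nat).

Let q : R := `|gamma|.
Let s : R := Num.sqrt (Num.sqrt q).

Let q0 : 0 < q. Proof. by case/andP: gamma_bnd. Qed.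
Let q1 : q < 1. Proof. by case/andP: gamma_bnd. Qed.

Let q_ge0 : 0 <= q. Proof. exact: normr_ge0. Qed.

Let s4 : s ^+ 4 = q.
Proof. by rewrite (exprM s 2 2) !sqr_sqrtr ?sqrtr_ge0 // ltW. Qed.

Let s0 : 0 < s. Proof. by rewrite !sqrtr_gt0. Qed.

Let s1 : s < 1.
Proof.
rewrite ltNge; apply/negP => s1; have : 1 <= s ^+ 4 by rewrite exprn_ege1.
by rewrite s4 leNgt q1.
Qed.

Let s01 : 0 <= s < 1. Proof. by rewrite ltW. Qed.

Let gamma0 : gamma != 0. Proof. by rewrite -normr_gt0. Qed.

Let gamma1 : gamma < 1. Proof. exact: le_lt_trans (ler_norm _) q1. Qed.

Let c := (1 - gamma)^-1.

Let onemg : 1 - gamma != 0. Proof. by rewrite subr_eq0 gt_eqF. Qed.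

Let onemg2 : 1 - gamma ^+ 2 != 0.
Proof.
rewrite subr_eq0 eq_sym -real_normK ?num_real // lt_eqF //.
by rewrite exprn_ilt1 // ?normr_ge0.
Qed.

Let geom_const : R := (1 - s)^-1 * (1 - s)^-1.

(** Half of the exponent of [q ^ max j k] pays for the two geometric factors
    needed for summation, the other half for the decay in [n]. *)
Lemma max_entries_norm T (C : R) n : 0 <= C ->
  (forall j k, cmod (dot (T (e k)) (e j)) <= C * q ^+ maxn (maxn j k) n) ->
  compact_op T /\ `|T| <= C * geom_const * (s ^+ 2) ^+ n.
Proof.
move=> C0 TC; have h j k : cmod (dot (T (e k)) (e j)) <= C * (s ^+ 2) ^+ n * s ^+ j * s ^+ k.
  apply: le_trans (TC j k) _; rewrite -!mulrA ler_wpM2l //.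
  rewrite -s4 -!exprM -!exprD.
  by apply: ler_wiXn2l; [exact: ltW | exact: ltW | exact: max_exponent].
have [cT nT] := geom_entries e_basis s01 h; split => //.
apply: le_trans nT _; rewrite le_eqVlt; apply/orP; left; apply/eqP.
by rewrite /geom_const; move: ((1 - s)^-1) => i; ring.
Qed.

Lemma rate_cvg (u : nat -> bop H) T (C : R) :
  (forall n, `|u n - T| <= C * (s ^+ 2) ^+ n) -> u @ \oo --> T.
Proof.
move=> uC; apply/subr_cvg0/norm_cvg0P.
have L : (fun n => C * (s ^+ 2) ^+ n) @ \oo --> (0 : R).
  by apply: cvg_geometric; rewrite ger0_norm ?sqr_ge0 // expr_lt1 // ltW.
by apply: (squeeze_cvgr _ (cvg_cst _) L); apply: nearW => n; rewrite normr_ge0 uC.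
Qed.

Lemma imag_mx_exists m (C : R) : 0 <= C -> (forall j k, `|m j k| <= C * q ^+ maxn j k) ->
  exists T, imag_mx e T m.
Proof.
move=> C0 mC.
have h j k : cmod (0 +i* m j k)%C <= C * s ^+ j * s ^+ k.
  rewrite cmodI; apply: le_trans (mC j k) _; rewrite -!mulrA ler_wpM2l //.
  rewrite -s4 -!exprM -!exprD.
  by apply: ler_wiXn2l; [exact: ltW | exact: ltW | exact: double_max_exponent].
by have [T [TE _ _]] := matrix_op_exists e_basis s01 h; exists T.
Qed.

Definition Lmx j k := L_entry gamma j.+1 k.+1.
Definition Y1mx j k := Y1_entry gamma j.+1 k.+1.
Definition diagmx (d : nat -> R) j k := if j == k then d k else 0.

Lemma Lmx_le j k : `|Lmx j k| <= 1 * q ^+ maxn j k.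
Proof.
rewrite mul1r /Lmx /L_entry; case: j k => [|j] [|k] //=; rewrite ?normr0 ?exprn_ge0 //.
- by rewrite subn1 normrX max0n.
- by rewrite subn1 normrX maxn0.
Qed.

Lemma Lmx_sym j k : Lmx j k = Lmx k j.
Proof. by rewrite /Lmx /L_entry; case: j k => [|j] [|k]. Qed.

Lemma Y1mx_le j k : `|Y1mx j k| <= q^-1 * q ^+ maxn j k.
Proof.
rewrite /Y1mx /Y1_entry; case: ifP => [|_]; last first.
  by rewrite normr0 mulr_ge0 ?exprn_ge0 ?invr_ge0.
case: j k => [|j] [|k] //= _.
by rewrite maxnSS maxnSS !subSS subn0 normrX exprS mulrA mulVf ?mul1r ?gt_eqF.
Qed.

Lemma Y1mx_sym j k : Y1mx j k = Y1mx k j.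
Proof. by rewrite /Y1mx /Y1_entry maxnC eq_sym andbCA. Qed.

Lemma diagmx_sym d j k : diagmx d j k = diagmx d k j.
Proof. by rewrite /diagmx eq_sym; case: eqP => // ->. Qed.

(** The operator [i / (1 - gamma)]: adding it to [D0] makes the diagonal tend to
    zero, hence the sum compact. *)
Definition Jop : bop H := cscale (0 +i* c)%C 1.

Lemma J_mx : imag_mx e Jop (diagmx (fun=> c)).
Proof.
move=> j k; rewrite /= dotZl (e_dot e_basis) /diagmx eq_sym; by case: eqP => _; simpc.
Qed.

(** The diagonal of [Y1 + D0 + i / (1 - gamma)], which tends to zero. *)
Definition kd k := d0 gamma k.+1 + c.

Lemma kdS k : kd k.+1 = gamma ^+ k * c - gamma ^+ k.+2 / (1 - gamma ^+ 2).
Proof.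
rewrite /kd /d0 /= !subSS subn0 /c; field.
by rewrite onemg onemg2.
Qed.

Definition Cd : R := `|c| + q^-1 * `|c| + `|(1 - gamma ^+ 2)^-1|.

Lemma Cd_ge0 : 0 <= Cd.
Proof. by rewrite !addr_ge0 ?mulr_ge0 ?invr_ge0. Qed.

Lemma kd_le k : `|kd k| <= Cd * q ^+ k.
Proof.
case: k => [|k].
  by rewrite /kd /d0 /= add0r mulr1 /Cd -addrA lerDl addr_ge0 ?mulr_ge0 ?invr_ge0.
rewrite kdS; apply: le_trans (ler_normB _ _) _.
rewrite (normrM (gamma ^+ k)) (normrM (gamma ^+ k.+2)) !normrX -/q /Cd.
rewrite !mulrDl -addrA; apply: ler_wpDl; first by rewrite mulr_ge0 ?exprn_ge0.
apply: lerD; first by rewrite exprS mulrAC mulrA mulVf ?mul1r ?gt_eqF.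
rewrite mulrC ler_wpM2l //; apply: ler_wiXn2l => //; exact: ltW.
Qed.

Lemma L_mx : imag_mx e (L_op e gamma) Lmx.
Proof. by apply: op_of_matrixP; exact: imag_mx_exists Lmx_le. Qed.

Lemma Y1_mx : imag_mx e (Y1_op e gamma) Y1mx.
Proof. by apply: op_of_matrixP; apply: imag_mx_exists Y1mx_le; rewrite invr_ge0. Qed.

Lemma Diag_mx (d : nat -> R) : (exists T, imag_mx e T (diagmx d)) ->
  imag_mx e (Diag e (fun k => (0 +i* d k)%C)) (diagmx d).
Proof.
move=> [T Td] j k; rewrite /Diag op_of_matrixP; last first.
  by exists T => j' k'; rewrite Td /diagmx; case: eqP.
by rewrite /diagmx; case: eqP.
Qed.

(** [D0] is bounded but its entries do not tend to zero, so it is obtained as the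
    difference of a summable diagonal and of [Jop]. *)
Lemma D0_mx : imag_mx e (D0_op e gamma) (diagmx (fun k => d0 gamma k.+1)).
Proof.
apply: Diag_mx; have [T Tk] : exists T, imag_mx e T (diagmx kd).
  apply: (imag_mx_exists Cd_ge0) => j k; rewrite /diagmx; case: eqP => [->|_].
    by rewrite maxnn kd_le.
  by rewrite normr0 mulr_ge0 ?Cd_ge0 ?exprn_ge0.
exists (T - Jop) => j k; rewrite (imag_mxD Tk (imag_mxN J_mx)) /diagmx /kd.
by case: eqP => _; rewrite ?addrK ?subrr.
Qed.

Lemma Dn_mx n : imag_mx e (Dn_op e gamma n) (diagmx (fun k => dn gamma n k.+1)).
Proof.
apply: Diag_mx; pose d k : R[i] := (0 +i* dn gamma n k.+1)%C.
exists (\sum_(0 <= k < n) rank1 (e k) (d k *: e k)) => j k; rewrite bop_sumE /=.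
under eq_bigr do rewrite scalerA; rewrite (dot_e_suml e_basis) (e_dot e_basis) /diagmx eq_sym.
case: (eqVneq j k) => [->|_]; last by rewrite mul0r; case: ifP.
rewrite mul1r; case: ltnP => // nk.
by rewrite /dn [X in _ && X]ltnNge nk andbF.
Qed.

Lemma iP_opE n x : iP_op e gamma n x = (0 +i* c)%C *: P_op e n x.
Proof.
suff /getPex : exists Q : bop H, forall x, Q x = (0 +i* c)%C *: P_op e n x by exact.
by exists (cscale (0 +i* c)%C (P_op e n)).
Qed.

Lemma iP_mx n : imag_mx e (iP_op e gamma n) (diagmx (fun k => if (k < n)%N then c else 0)).
Proof.
move=> j k; rewrite iP_opE dotZl (P_op_dot e_basis) (e_dot e_basis) /diagmx eq_sym.
by case: eqP => [->|_]; case: ifP => _; simpc; rewrite ?mulr1.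
Qed.

Lemma geometric_sum n : \sum_(0 <= j < n) gamma ^+ j = (1 - gamma ^+ n) * c.
Proof.
elim: n => [|n IH]; first by rewrite big_geq // expr0 subrr mul0r.
by rewrite big_nat_recr //= IH exprSr /c; field; rewrite onemg.
Qed.

Lemma geometric_tail_sum m n : (m <= n)%N ->
  \sum_(m <= j < n) gamma ^+ (2 * j - m) =
  (gamma ^+ m - gamma ^+ (2 * n - m)) / (1 - gamma ^+ 2).
Proof.
move=> mn; rewrite -(subnKC mn); elim: (n - m)%N => [|p IH].
  by rewrite addn0 big_geq // mul2n -addnn addnK subrr mul0r.
rewrite addnS big_nat_recr ?leq_addr //= IH.
have -> : (2 * (m + p).+1 - m = (2 * (m + p) - m).+2)%N.
  rewrite mulnS add2n -addn2 -addnBAC ?addn2 //.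
  by apply: leq_trans (leq_addr p m) _; rewrite leq_pmull.
move: (2 * (m + p) - m)%N => r.
have -> : gamma ^+ r.+2 = gamma ^+ r * gamma ^+ 2 by rewrite -exprD addn2.
by field; rewrite onemg2.
Qed.

Lemma dnE n k : (k.+1 < n)%N ->
  dn gamma n k.+2 = - (\sum_(0 <= j < k) gamma ^+ j) - \sum_(k.+2 <= j < n) gamma ^+ (2 * j - k.+2).
Proof. by move=> kn; rewrite /dn kn /= !subSS subn0. Qed.

(** The truncated sums in [dn] are geometric; what they miss of [d0] is the tail
    [gamma ^ (2 n - k) / (1 - gamma ^ 2)]. *)
Lemma diag_diff n k :
  `|dn gamma n k.+1 + (if (k < n)%N then c else 0) - kd k| <= Cd * q ^+ maxn k n.
Proof.
case: ltnP => kn; last first.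
  rewrite /dn [X in _ && X]ltnNge kn andbF add0r sub0r normrN.
  exact: kd_le.
rewrite /kd opprD addrACA subrr addr0.
case: k kn => [|k] kn.
  by rewrite /dn /d0 /= subrr normr0 mulr_ge0 ?Cd_ge0 ?exprn_ge0.
rewrite dnE // geometric_sum geometric_tail_sum // /d0 /= !subSS subn0.
have -> : - ((1 - gamma ^+ k) * c) - (gamma ^+ k.+2 - gamma ^+ (2 * n - k.+2)) / (1 - gamma ^+ 2)
    - (- ((1 - gamma ^+ k) / (1 - gamma)) - gamma ^+ k.+2 / (1 - gamma ^+ 2)) =
    gamma ^+ (2 * n - k.+2) / (1 - gamma ^+ 2).
  by rewrite /c; ring.
rewrite normrM normrX -/q mulrC; apply: ler_pM => //.
- exact: exprn_ge0.
- by rewrite /Cd lerDr addr_ge0 ?mulr_ge0 ?invr_ge0.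
apply: ler_wiXn2l => //; first exact: ltW.
by rewrite mul2n -addnn -addnBA // leq_addr.
Qed.

(** The column [k >= 1] of the compressed matrix is orthogonal to the first
    column of [L]: this is what the diagonal entries are chosen for. *)
Lemma column_orthogonal n k : (k.+1 < n)%N ->
  \sum_(0 <= j < n) Lmx j 0 * (Y1mx j k.+1 + diagmx (fun i => dn gamma n i.+1) j k.+1) = 0.
Proof.
move=> kn; rewrite big_ltn ?(ltn_trans _ kn) //.
have -> : Lmx 0 0 = 0 by [].
rewrite mul0r add0r (@big_cat_nat _ _ _ k.+1) //=; last exact: ltnW.
rewrite [X in _ + X]big_ltn // /diagmx eqxx.
have LE j : (0 < j)%N -> Lmx j 0 = gamma ^+ j.
  by case: j => // j _; rewrite /Lmx /L_entry /= subn1.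
have YE j : (0 < j)%N -> j != k.+1 -> Y1mx j k.+1 = gamma ^+ (maxn j k.+1).-1.
  case: j => // j _ jk; rewrite /Y1mx /Y1_entry /= eqSS jk.
  by rewrite maxnSS subSS subn1.
have -> : \sum_(1 <= j < k.+1) Lmx j 0 * (Y1mx j k.+1 + (if j == k.+1 then dn gamma n k.+2 else 0))
   = gamma ^+ k.+1 * \sum_(0 <= j < k) gamma ^+ j.
  rewrite big_add1 mulr_sumr; apply: eq_big_nat => j /andP[_ jk].
  rewrite (ltn_eqF (_ : (j.+1 < k.+1)%N)) // addr0 LE // YE // ?(ltn_eqF (_ : (j.+1 < k.+1)%N)) //.
  by rewrite -!exprD below_diagonal_exponent.
have -> : \sum_(k.+2 <= j < n) Lmx j 0 * (Y1mx j k.+1 + (if j == k.+1 then dn gamma n k.+2 else 0))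
   = gamma ^+ k.+1 * \sum_(k.+2 <= j < n) gamma ^+ (2 * j - k.+2).
  rewrite mulr_sumr; apply: eq_big_nat => j /andP[kj _].
  have j0 : (0 < j)%N by exact: leq_trans kj.
  rewrite (gtn_eqF kj) addr0 LE // YE // ?(gtn_eqF kj) //.
  by rewrite -!exprD above_diagonal_exponent.
rewrite LE // (_ : Y1mx k.+1 k.+1 = 0); last by rewrite /Y1mx /Y1_entry eqxx andbF.
by rewrite dnE //; ring.
Qed.

Lemma imag_norm T m (C : R) n : 0 <= C -> imag_mx e T m ->
  (forall j k, `|m j k| <= C * q ^+ maxn (maxn j k) n) ->
  compact_op T /\ `|T| <= C * geom_const * (s ^+ 2) ^+ n.
Proof. by move=> C0 Tm mC; apply: max_entries_norm => // j k; rewrite Tm cmodI. Qed.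

Lemma imag_compact T m (C : R) : 0 <= C -> imag_mx e T m ->
  (forall j k, `|m j k| <= C * q ^+ maxn j k) -> compact_op T.
Proof. by move=> C0 Tm mC; have [] := imag_norm (n := 0) C0 Tm mC. Qed.

Lemma diagmx_le (d : nat -> R) (C : R) n : 0 <= C -> (forall k, `|d k| <= C * q ^+ maxn k n) ->
  forall j k, `|diagmx d j k| <= C * q ^+ maxn (maxn j k) n.
Proof.
move=> C0 dC j k; rewrite /diagmx; case: eqP => [->|_]; first by rewrite maxnn.
by rewrite normr0 mulr_ge0 ?exprn_ge0.
Qed.

Let L := L_op e gamma.
Let Y1 := Y1_op e gamma.
Let D0 := D0_op e gamma.
Let Dn := Dn_op e gamma.
Let P := P_op e.
Let iP := iP_op e gamma.
Let M := M0 e gamma.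

Lemma D0J_mx : imag_mx e (D0 + Jop) (diagmx kd).
Proof.
move=> j k; rewrite (imag_mxD D0_mx J_mx) /diagmx /kd.
by case: eqP => _ //; rewrite addr0.
Qed.

Lemma compact_L : compact_op L.
Proof. exact: imag_compact ler01 L_mx Lmx_le. Qed.

Lemma compact_Y1 : compact_op Y1.
Proof. by apply: imag_compact Y1_mx Y1mx_le; rewrite invr_ge0. Qed.

Lemma compact_D0J : compact_op (D0 + Jop).
Proof.
have [//|//] := @imag_norm (D0 + Jop) _ Cd 0 Cd_ge0 D0J_mx.
by apply: diagmx_le Cd_ge0 _ => k; rewrite maxn0 kd_le.
Qed.

(** The entries of the compressions differ from the limit ones only where
    [max j k >= n]. *)
Lemma compress_cvg T m (C : R) : 0 <= C -> imag_mx e T m ->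
  (forall j k, `|m j k| <= C * q ^+ maxn j k) -> (fun n => P n * T * P n) @ \oo --> T.
Proof.
move=> C0 Tm mC; apply: (@rate_cvg _ _ (C * geom_const)) => n.
have [] // := imag_norm C0 (n := n) (imag_mxD (imag_mx_compress e_basis n Tm) (imag_mxN Tm)).
move=> j k; case: ifPn => [_|jk].
  by rewrite subrr normr0 mulr_ge0 ?exprn_ge0.
rewrite sub0r normrN (maxn_idPl _) //; move: jk.
by rewrite negb_and -!leqNgt leq_max.
Qed.

Lemma L_compress_cvg : (fun n => P n * L * P n) @ \oo --> L.
Proof. exact: compress_cvg ler01 L_mx Lmx_le. Qed.

Lemma Y1_compress_cvg : (fun n => P n * Y1 * P n) @ \oo --> Y1.
Proof. by apply: compress_cvg Y1_mx Y1mx_le; rewrite invr_ge0. Qed.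

Lemma DJ_mx n : imag_mx e (Dn n + iP n)
  (diagmx (fun k => dn gamma n k.+1 + (if (k < n)%N then c else 0))).
Proof.
move=> j k; rewrite (imag_mxD (Dn_mx n) (iP_mx n)) /diagmx.
by case: eqP => _ //; rewrite addr0.
Qed.

Lemma DJ_cvg : (fun n => Dn n + iP n) @ \oo --> D0 + Jop.
Proof.
apply: (@rate_cvg _ _ (Cd * geom_const)) => n.
have [] // := imag_norm Cd_ge0 (n := n) (imag_mxD (DJ_mx n) (imag_mxN D0J_mx)).
move=> j k; have := diagmx_le Cd_ge0 (diag_diff n) j k; rewrite /diagmx.
by case: eqP => _; rewrite ?subrr.
Qed.

(** * The block structure of the generators *)

Let W := Y1 + D0.
Let Wn n := P n * Y1 * P n + Dn n.

(** The supremum in [M0] dominates its members only if the family is bounded,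
    which holds because the compressed operators converge. *)
Lemma Wn_le n : (1 <= n)%N -> `|Wn n| <= M.
Proof.
move=> n1; rewrite /M /M0 le_max; apply/orP; left; apply: sup_upper_bound; last by exists n.
split; first by exists `|Wn 1|, 1%N.
have [B BP] := bop_cvg_bounded (cvgD Y1_compress_cvg DJ_cvg).
exists (B + `|c|) => _ [p _ <-].
have -> : P p * Y1 * P p + Dn p = (P p * Y1 * P p + (Dn p + iP p)) - iP p.
  by rewrite addrA addrK.
apply: le_trans (ler_normB _ _) _; apply: lerD; first exact: BP.
have -> : iP p = P p * cscale (0 +i* c)%C 1 * P p.
  apply: (imag_mx_eq e_basis (iP_mx p) (imag_mx_compress e_basis p J_mx)) => j k.
  by rewrite /diagmx; case: eqP => [->|_]; rewrite ?andbb ?if_same.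
apply: le_trans (P_compress_norm e_basis _ _) _; apply: le_trans (cscale_norm _ _) _.
by rewrite cmodI ler_piMr // bop_norm1.
Qed.

Lemma W_le : `|W| <= M.
Proof. by rewrite /M /M0 le_max lexx orbT. Qed.

Lemma W_mx : imag_mx e W (fun j k => Y1mx j k + diagmx (fun i => d0 gamma i.+1) j k).
Proof. exact: imag_mxD Y1_mx D0_mx. Qed.

Lemma Wn_mx n : imag_mx e (Wn n) (fun j k =>
  (if (j < n)%N && (k < n)%N then Y1mx j k else 0) + diagmx (fun i => dn gamma n i.+1) j k).
Proof. exact: imag_mxD (imag_mx_compress e_basis n Y1_mx) (Dn_mx n). Qed.

Lemma M_gt0 : 0 < M.
Proof.
apply: lt_le_trans W_le; rewrite normr_gt0; apply/eqP => W0.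
have := W_mx 1 2; rewrite W0 bop_zeroE dot0l /Y1mx /Y1_entry /diagmx /= addr0.
by move=> [] /esym/eqP; rewrite expf_eq0 /= (negPf gamma0).
Qed.

Lemma W_antiherm : op_antihermitian W.
Proof.
apply: (imag_mx_antiherm e_basis W_mx) => j k.
by rewrite Y1mx_sym diagmx_sym.
Qed.

Lemma Wn_antiherm n : op_antihermitian (Wn n).
Proof.
apply: (imag_mx_antiherm e_basis (Wn_mx n)) => j k.
by rewrite Y1mx_sym diagmx_sym andbC.
Qed.

Lemma W_first : W (e 0%N) = 0.
Proof.
apply: (vec_ext e_basis) => j; rewrite W_mx dot0l /Y1mx /Y1_entry /= andbF /diagmx.
by case: eqP => _; rewrite addr0.
Qed.

Lemma Wn_first n : Wn n (e 0%N) = 0.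
Proof.
apply: (vec_ext e_basis) => j; rewrite Wn_mx dot0l /Y1mx /Y1_entry /= andbF if_same add0r /diagmx.
by case: eqP => _.
Qed.

Let v := L (e 0%N).
Let vn n := (P n * L * P n) (e 0%N).

Lemma vn_sum n : (0 < n)%N -> vn n = \sum_(0 <= j < n) (0 +i* Lmx j 0)%C *: e j.
Proof.
move=> n0; apply: (vec_ext e_basis) => j.
rewrite (dot_e_suml e_basis) (imag_mx_compress e_basis n L_mx) n0 andbT.
by case: ifP.
Qed.

Lemma Wn_vn n : (0 < n)%N -> Wn n (vn n) = 0.
Proof.
move=> n0; apply: (vec_ext e_basis) => k; rewrite dot0l Wn_antiherm vn_sum // dot_suml.
have -> : \sum_(0 <= j < n) dot ((0 +i* Lmx j 0)%C *: e j) (Wn n (e k)) =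
    (\sum_(0 <= j < n) Lmx j 0 * ((if (j < n)%N && (k < n)%N then Y1mx j k else 0) +
       diagmx (fun i => dn gamma n i.+1) j k))%:C%C.
  rewrite rmorph_sum; apply: eq_bigr => j _.
  by rewrite dotZl (dotC (Wn n (e k)) (e j)) Wn_mx; simpc.
suff -> : \sum_(0 <= j < n) Lmx j 0 * ((if (j < n)%N && (k < n)%N then Y1mx j k else 0) +
       diagmx (fun i => dn gamma n i.+1) j k) = 0 by rewrite oppr0.
case: (ltnP k n) => kn; last first.
  rewrite big_nat_cond big1 // => j; rewrite andbT => /andP[_ jn].
  by rewrite andbF add0r /diagmx (ltn_eqF (leq_trans jn kn)) mulr0.
case: k kn => [|k] kn.
  rewrite big1 // => j _; rewrite /Y1mx /Y1_entry /= andbF if_same add0r /diagmx.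
  by case: eqP => _; rewrite mulr0.
rewrite -[RHS](column_orthogonal kn); apply: eq_big_nat => j /andP[_ jn].
by rewrite jn.
Qed.

Lemma P_vn n : P n (vn n) = vn n.
Proof.
rewrite /vn /P !bop_mulE; apply: (vec_ext e_basis) => j.
by rewrite !(P_op_dot e_basis); case: (j < n)%N.
Qed.

(** The finite orthogonality relations [Wn_vn] pass to the limit once [Jop] is
    added and subtracted, since [Wn] does not converge to [W] in norm. *)
Lemma W_v : W v = 0.
Proof.
apply: (vec_ext e_basis) => k; rewrite dot0l.
have A_cvg : (fun n => P n * Y1 * P n + (Dn n + iP n)) @ \oo --> Y1 + (D0 + Jop).
  exact: cvgD Y1_compress_cvg DJ_cvg.
have cJ : (fun=> Jop) @ \oo --> Jop by exact: cvg_cst.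
have lim : (fun n => (P n * Y1 * P n + (Dn n + iP n)) * (P n * L * P n) -
    Jop * (P n * L * P n)) @ \oo --> W * L.
  have -> : W * L = (Y1 + (D0 + Jop)) * L - Jop * L.
    by rewrite -mulrBl addrA addrK.
  by apply: cvgB; apply: cvg_bopM => //; exact: L_compress_cvg.
apply: ccvg_unique (ccvg_dotl (e 0%N) (e k) lim) _; apply: ccvg_near_eq.
exists 1%N => // n n1; have {}n1 : (0 < n)%N := n1.
have -> : ((P n * Y1 * P n + (Dn n + iP n)) * (P n * L * P n) - Jop * (P n * L * P n)) (e 0%N) =
    Wn n (vn n) + (iP n (vn n) - Jop (vn n)).
  by rewrite /Wn /vn !bopE !addrA.
by rewrite Wn_vn // add0r /iP iP_opE P_vn /= subrr dot0l.
Qed.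

Lemma v_entry j : dot v (e j) = (0 +i* Lmx j 0)%C.
Proof. exact: L_mx. Qed.

Lemma vn_entry n j : dot (vn n) (e j) =
  (0 +i* (if (j < n)%N && (0 < n)%N then Lmx j 0 else 0))%C.
Proof. exact: (imag_mx_compress e_basis n L_mx). Qed.

Lemma v_gt0 : 0 < hnorm v.
Proof.
apply: (@hnorm_gt0_of_dot _ _ _ (e 1%N)); rewrite v_entry /Lmx /L_entry /=.
by move=> [] /eqP; rewrite expf_eq0 /= (negPf gamma0).
Qed.

Lemma vn_gt0 n : (2 <= n)%N -> 0 < hnorm (vn n).
Proof.
move=> n2; apply: (@hnorm_gt0_of_dot _ _ _ (e 1%N)); rewrite vn_entry n2 (ltnW n2) /Lmx /L_entry /=.
by move=> [] /eqP; rewrite expf_eq0 /= (negPf gamma0).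
Qed.

(** Both [Z_r] and its finite analogues fall under the block structure. *)
Lemma cross_block T W0 m (r : R) : imag_mx e T m -> (forall j k, m j k = m k j) ->
  m 0%N 0%N = 0 -> (forall j k, m j.+1 k.+1 = 0) ->
  op_antihermitian W0 -> `|W0| <= M -> W0 (e 0%N) = 0 -> W0 (T (e 0%N)) = 0 ->
  0 < hnorm (T (e 0%N)) -> r = M / hnorm (T (e 0%N)) ->
  let Z := r *: T + W0 in
  [/\ `|Z| <= M, dot (Z (e 0%N)) (e 0%N) = 0, hnorm (Z (e 0%N)) = M &
    forall t, dot (exp_op (t *: Z) (e 0%N)) (e 0%N) = (cos (M * t))%:C%C].
Proof.
move=> Tm ms m00 m11 aW WM Wf Wv Tgt rE Z.
pose f := e 0%N; pose x := r%:C%C *: T f.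
have f1 : hnorm f = 1 by exact: hnorm_e.
have xM : hnorm x = M.
  rewrite hnormZ rE ger0_norm ?divr_ge0 ?(ltW M_gt0) ?hnorm_ge0 //.
  by rewrite divfK // gt_eqF.
have xf : dot x f = 0 by rewrite dotZl Tm m00 mulr0.
have Wx : W0 x = 0 by rewrite bopZ Wv scaler0.
have ZE y : Z y = dot y f *: x - dot y x *: f + W0 y.
  rewrite /Z bop_addE bop_scaleE; congr (_ + _).
  rewrite (cross_rank2 e_basis Tm ms m00 m11) !bopE /= scalerBr !scalerA dotZr conjc_real.
  by rewrite (mulrC _%:C%C).
have Zf : Z f = x by exact: block_first ZE.
split; rewrite ?Zf //.
- exact: (block_norm f1 xM M_gt0 xf aW WM Wf Wx ZE).
- by move=> t; exact: (block_cos f1 xM xf Wf Wx ZE).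
Qed.

Let Zr := Zr_op e gamma.
Let Yr := Yr_op e gamma.
Let Yn := Yn_op e gamma.
Let Zn n := Yn n + Dn n.
Let Kr := Zr + Jop.
Let Kn n := Yn n + Dn n + iP n.

Lemma Zr_block : [/\ `|Zr| <= M, dot (Zr (e 0%N)) (e 0%N) = 0 & hnorm (Zr (e 0%N)) = M].
Proof.
have [] // := @cross_block L W Lmx (r_coef e gamma) L_mx Lmx_sym _ _
  W_antiherm W_le W_first W_v v_gt0.
by rewrite /W addrA.
Qed.

Lemma Zn_block n : (2 <= n)%N ->
  [/\ `|Zn n| <= M, dot (Zn n (e 0%N)) (e 0%N) = 0, hnorm (Zn n (e 0%N)) = M &
    forall t, dot (exp_op (t *: Zn n) (e 0%N)) (e 0%N) = (cos (M * t))%:C%C].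
Proof.
move=> n2; have n1 := ltnW n2; have -> : Zn n = rn_coef e gamma n *: (P n * L * P n) + Wn n.
  by rewrite /Zn /Yn /Yn_op /Wn addrA.
apply: (cross_block (imag_mx_compress e_basis n L_mx)).
- by move=> j k; rewrite Lmx_sym andbC.
- by case: ifP.
- by move=> j k; case: ifP.
- exact: Wn_antiherm.
- exact: Wn_le.
- exact: Wn_first.
- exact: Wn_vn.
- exact: vn_gt0.
- by [].
Qed.

Lemma Yn_cvg : Yn @ \oo --> Yr.
Proof.
have -> : Yn = (fun n => rn_coef e gamma n *: (P n * L * P n) + P n * Y1 * P n) by [].
apply: cvgD; last exact: Y1_compress_cvg.
apply: cvgZ; last exact: L_compress_cvg.
apply: cvgM; first exact: cvg_cst.
apply: cvgV; first by rewrite gt_eqF // v_gt0.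
exact: hnorm_op_cvg L_compress_cvg.
Qed.

Lemma Kn_cvg : Kn @ \oo --> Kr.
Proof.
have -> : Kr = Yr + (D0 + Jop) by rewrite /Kr /Zr /Zr_op -addrA.
have -> : Kn = (fun n => Yn n + (Dn n + iP n)) by apply: funext => n; rewrite /Kn -addrA.
by apply: cvgD; [exact: Yn_cvg | exact: DJ_cvg].
Qed.

Lemma antiherm_diag T d : imag_mx e T (diagmx d) -> op_antihermitian T.
Proof. by move=> /(imag_mx_antiherm e_basis); apply; exact: diagmx_sym. Qed.

Lemma Kah_Yr : Kah Yr.
Proof.
split; last first.
  apply: antihermD; last exact: (imag_mx_antiherm e_basis Y1_mx Y1mx_sym).
  by apply: antihermZ; exact: (imag_mx_antiherm e_basis L_mx Lmx_sym).
by apply: compact_opD; [apply: compact_opZ; exact: compact_L | exact: compact_Y1].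
Qed.

Lemma Kah_Kr : Kah Kr.
Proof.
rewrite /Kr /Zr /Zr_op -addrA; apply: KahD; first exact: Kah_Yr.
by split; [exact: compact_D0J | exact: antiherm_diag D0J_mx].
Qed.

Lemma Kah_compress n T m : imag_mx e T m -> (forall j k, m j k = m k j) ->
  Kah (P n * T * P n).
Proof.
move=> Tm ms; split; first exact: compact_compress.
apply: (imag_mx_antiherm e_basis (imag_mx_compress e_basis n Tm)) => j k.
by rewrite andbC ms.
Qed.

Lemma Kah_Yn n : Kah (Yn n).
Proof.
apply: KahD; last exact: Kah_compress Y1_mx Y1mx_sym.
by apply: KahZ; exact: Kah_compress L_mx Lmx_sym.
Qed.

Lemma Kah_finite_diag n T d : imag_mx e T (diagmx d) -> (forall k, (n <= k)%N -> d k = 0) -> Kah T.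
Proof.
move=> Td d0; rewrite (imag_mx_finite e_basis (n := n) Td).
  by apply: Kah_compress Td _ => j k; exact: diagmx_sym.
move=> j k; rewrite /diagmx; case: eqP => // ->; rewrite andbb -leqNgt; exact: d0.
Qed.

Lemma Kah_Dn n : Kah (Dn n).
Proof.
apply: (Kah_finite_diag (n := n) (Dn_mx n)) => k nk.
by rewrite /dn [X in _ && X]ltnNge nk andbF.
Qed.

Lemma Kah_iP n : Kah (iP n).
Proof. by apply: (Kah_finite_diag (n := n) (iP_mx n)) => k; rewrite leqNgt => /negPf ->. Qed.

Lemma Kah_Zn n : Kah (Zn n).
Proof. by apply: KahD; [exact: Kah_Yn | exact: Kah_Dn]. Qed.

Lemma Kah_Kn n : Kah (Kn n).
Proof. by apply: KahD; [exact: Kah_Zn | exact: Kah_iP]. Qed.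

(** * Quotient norm and Finsler speed *)

Implicit Types (D Z : bop H) (a t z : R).

Lemma imag_diagonal T d : imag_mx e T (diagmx d) -> diagonal e T.
Proof. by move=> Td j k jk; rewrite Td /diagmx (negPf jk). Qed.

(** The diagonal [Dn] attains the infimum, by [block_norm] and [diagonal_lower]. *)
Lemma qnorm_Yn n : (2 <= n)%N -> qnorm e (Yn n) = M.
Proof.
move=> n2; have [ZM Z0 Zf _] := Zn_block n2; rewrite /qnorm; set E := (X in inf X).
have dDn : diagonal e (Dn n) by exact: imag_diagonal (Dn_mx n).
have lbM : lbound E M.
  move=> _ [D [_ dD] <-]; rewrite -Zf.
  have -> : Yn n + D = Zn n + (D - Dn n) by rewrite /Zn addrACA subrr addr0.
  by apply: (diagonal_lower e_basis) Z0; exact: diagonalB.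
have EZ : E `|Zn n| by exists (Dn n) => //; split => //; exact: Kah_Dn.
apply/eqP; rewrite eq_le; apply/andP; split.
  by apply: le_trans ZM; apply: ge_inf EZ; exists M.
by apply: lb_le_inf => //; exists `|Zn n|.
Qed.

Variables (b : bop H) (lambda : nat -> R).
Hypotheses (bd : is_diag e b (fun k => (lambda k)%:C%C)) (bh : op_hermitian b).
Hypothesis linj : injective lambda.

Lemma diag_comm_b T d : imag_mx e T (diagmx d) -> T * b = b * T.
Proof.
move=> Td; apply: (diag_comm e_basis _ bd).
by apply: (imag_mx_diag e_basis Td) => j k jk; rewrite /diagmx (negPf jk).
Qed.

Lemma bracketD Z T : T * b = b * T -> (Z + T) * b - b * (Z + T) = Z * b - b * Z.
Proof. by move=> Tb; rewrite mulrDl mulrDr Tb opprD addrACA subrr addr0. Qed.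

(** The lifts of [[Z, b]] differ by diagonal operators, so none is shorter than
    the first column of [Z]. *)
Lemma finsler_value Z : dot (Z (e 0%N)) (e 0%N) = 0 -> hnorm (Z (e 0%N)) = M ->
  (forall eps : R, 0 < eps ->
     exists2 Y, Kah Y /\ Y * b - b * Y = Z * b - b * Z & `|Y| <= M + eps) ->
  finsler b (Z * b - b * Z) = M%:E.
Proof.
move=> Z0 ZM lifts; apply/eqP; rewrite eq_le; apply/andP; split.
  apply/lee_addgt0Pr => eps e0; have [Y KY YM] := lifts _ e0.
  apply: (@le_trans _ _ `|Y|%:E); last by rewrite -EFinD lee_fin.
  by apply: ereal_inf_lbound; exists Y.
apply: le_ereal_inf_tmp => _ [Y [_ Yb] <-]; rewrite lee_fin -ZM.
have -> : Y = Z + (Y - Z) by rewrite addrC subrK.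
apply: (diagonal_lower e_basis) Z0; apply: (commutant_diagonal bd bh linj).
rewrite mulrBl mulrBr; have -> : Y * b = Z * b - b * Z + b * Y by rewrite -Yb subrK.
by rewrite addrC !addrA addNr add0r addrC.
Qed.

Lemma finsler_Zn n : (2 <= n)%N -> finsler b (Zn n * b - b * Zn n) = M%:E.
Proof.
move=> n2; have [ZM Z0 Zf _] := Zn_block n2; apply: finsler_value => // eps e0.
exists (Zn n); first by split => //; exact: Kah_Zn.
by apply: le_trans ZM _; rewrite lerDl ltW.
Qed.

(** [Z_r] itself is not compact; its diagonal is cut off at a rank [N] beyond
    which the compact part of [Z_r] is negligible. *)
Lemma finsler_Zr : finsler b (Zr * b - b * Zr) = M%:E.
Proof.
have [ZM Z0 Zf] := Zr_block; apply: finsler_value => // eps e0.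
have Yr_cvg : (fun n => P n * Yr * P n) @ \oo --> Yr.
  have -> : (fun n => P n * Yr * P n) =
      (fun n => r_coef e gamma *: (P n * L * P n) + P n * Y1 * P n).
    apply: funext => n; rewrite /Yr /Yr_op mulrDr mulrDl.
    by rewrite bop_scaleAr bop_scaleAl.
  apply: cvgD; last exact: Y1_compress_cvg.
  by apply: cvgZr; exact: L_compress_cvg.
have /cvgrPdist_le/(_ _ e0)/filter_ex[N YN] := Yr_cvg.
exists (P N * Zr * P N + (Yr - P N * Yr * P N)); last first.
  apply: le_trans (ler_normD _ _) _; apply: lerD => //.
  exact: le_trans (P_compress_norm e_basis _ _) ZM.
split.
  apply: KahD.
    apply: (Kah_compress N (imag_mxD (imag_mxD (imag_mxZ _ L_mx) Y1_mx) D0_mx)) => j k.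
    by rewrite Lmx_sym Y1mx_sym diagmx_sym.
  apply: KahD; first exact: Kah_Yr.
  apply: KahN; apply: (Kah_compress N (imag_mxD (imag_mxZ _ L_mx) Y1_mx)) => j k.
  by rewrite Lmx_sym Y1mx_sym.
have -> : P N * Zr * P N + (Yr - P N * Yr * P N) = Zr + (P N * D0 * P N - D0).
  rewrite /Zr /Zr_op mulrDr mulrDl -/Yr -/D0 -/P addrC addrA subrK addrC.
  by rewrite -[RHS]addrA (addrC D0) subrK addrC.
apply: bracketD.
apply: (diag_comm_b (d := fun k => if (k < N)%N then 0 else - d0 gamma k.+1)) => j k.
rewrite (imag_mxD (imag_mx_compress e_basis N D0_mx) (imag_mxN D0_mx)) /diagmx.
case: eqP => [->|_]; last by rewrite if_same subrr.
by rewrite andbb; case: ifP => _; rewrite ?subrr ?sub0r.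
Qed.

(** * The curves and their convergence *)

Lemma Jop_comm T : Jop * T = T * Jop.
Proof. by apply: bopP => x; rewrite /= bopZ. Qed.

Lemma iP_comm n T : iP n * (P n * T * P n) = (P n * T * P n) * iP n.
Proof.
have PP x : P n (P n x) = P n x.
  by rewrite /P; apply: (vec_ext e_basis) => j; rewrite !(P_op_dot e_basis); case: (j < n)%N.
by apply: bopP => x; rewrite !bop_mulE /iP !iP_opE -/P !bopZ !PP.
Qed.

Lemma Zn_compress n : Zn n = P n * (rn_coef e gamma n *: L + Y1 + Dn n) * P n.
Proof.
have Dn0 : Dn n = P n * Dn n * P n.
  apply: (imag_mx_finite e_basis (Dn_mx n)) => j k; rewrite /diagmx.
  case: eqP => // ->; rewrite andbb -leqNgt => nk.
  by rewrite /dn [X in _ && X]ltnNge nk andbF.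
rewrite /Zn {1}Dn0 /Yn /Yn_op !mulrDr !mulrDl.
by rewrite bop_scaleAr bop_scaleAl.
Qed.

(** [Zr] and the compact [Kr] differ by a scalar operator, invisible to
    conjugation; the exponentials of [Kr] lie in the group [Uc]. *)
Lemma beta_conj t : beta e gamma b t = conj_curve Kr b t.
Proof.
have Jb : Jop * b = b * Jop by exact: Jop_comm.
by rewrite (@conj_curve_comm _ _ Zr Jop b t _ Jb) // -Jop_comm.
Qed.

Lemma betan_conj n t : betan e gamma b n t = conj_curve (Zn n) b t.
Proof.
have ZP : Zn n * iP n = iP n * Zn n by rewrite Zn_compress iP_comm.
exact: (conj_curve_comm t ZP (diag_comm_b (iP_mx n))).
Qed.

Lemma bracket_Kr : Kr * b - b * Kr = Zr * b - b * Zr.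
Proof. by apply: bracketD; exact: Jop_comm. Qed.

Lemma bracket_Kr_Yr : Kr * b - b * Kr = Yr * b - b * Yr.
Proof.
rewrite bracket_Kr /Zr /Zr_op; apply: bracketD; exact: diag_comm_b D0_mx.
Qed.

Lemma bracket_Zn n : Zn n * b - b * Zn n = Yn n * b - b * Yn n.
Proof. by apply: bracketD; exact: diag_comm_b (Dn_mx n). Qed.

Lemma finsler_neq0 x : finsler b x = M%:E -> x != 0.
Proof.
move=> xM; apply/eqP => x0; have := M_gt0; rewrite -lte_fin -xM ltNge => /negP; apply.
apply: ereal_inf_lbound; exists 0; last by rewrite normr0.
split; last by rewrite mul0r mulr0 subrr x0.
split; first exact: compact_op0.
by move=> y z; rewrite !bop_zeroE dot0l dot0r oppr0.
Qed.

Variables (A u : bop H).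
Hypotheses (uU : Uc u) (AE : A = u * b * adj u).

Lemma betan_smooth n a z : (2 <= n)%N -> a <= z -> smooth_curve A a z (betan e gamma b n).
Proof.
move=> n2 az; rewrite (_ : betan _ _ _ _ = conj_curve (Zn n) b); last first.
  by apply: funext => t; exact: betan_conj.
apply: conj_curve_smooth uU AE (Kah_Zn n) _ az.
by apply: finsler_neq0; exact: finsler_Zn.
Qed.

Lemma beta_smooth a z : a <= z -> smooth_curve A a z (beta e gamma b).
Proof.
move=> az; rewrite (_ : beta _ _ _ = conj_curve Kr b); last first.
  by apply: funext => t; exact: beta_conj.
apply: conj_curve_smooth uU AE Kah_Kr _ az.
by apply: finsler_neq0; rewrite bracket_Kr; exact: finsler_Zr.
Qed.

Lemma betan_length n a z : (2 <= n)%N -> a <= z ->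
  curve_length a z (betan e gamma b n) = ((z - a) * M)%:E.
Proof.
move=> n2 az; rewrite (_ : betan _ _ _ _ = conj_curve (Zn n) b); last first.
  by apply: funext => t; exact: betan_conj.
by apply: conj_curve_length => //; [case: (Kah_Zn n) | exact: finsler_Zn].
Qed.

Lemma beta_length a z : a <= z -> curve_length a z (beta e gamma b) = ((z - a) * M)%:E.
Proof.
move=> az; rewrite (_ : beta _ _ _ = conj_curve Kr b); last first.
  by apply: funext => t; exact: beta_conj.
apply: conj_curve_length => //; first by case: Kah_Kr.
by rewrite bracket_Kr; exact: finsler_Zr.
Qed.

(** For [|t0| M <= pi / 2] the first basis vector is turned by the angle
    [|t0| M], which [minimal_angle] makes a lower bound for every competitor. *)
Lemma betan_minimal n t0 : (2 <= n)%N -> `|t0| <= pi / (2 * M) ->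
  minimal_length_curve A (Num.min 0 t0) (Num.max 0 t0) (betan e gamma b n).
Proof.
move=> n2 t0M.
have mm : Num.min 0 t0 <= Num.max 0 t0 by rewrite le_max ge_min lexx.
split; first exact: betan_smooth.
move=> c1 c2 w wS wJ; rewrite betan_length //.
rewrite max_sub_min.
have Mn0 : M != 0 by rewrite gt_eqF // M_gt0.
pose U := exp_op (t0 *: Zn n).
have [_ aZ] := Kah_Zn n; have [UU adjU] := exp_unitary (antihermZ t0 aZ).
have thpi : `|t0| * M <= pi / 2.
  apply: le_trans (ler_wpM2r (ltW M_gt0) t0M) _.
  by rewrite le_eqVlt; apply/orP; left; apply/eqP; field.
have th0 : 0 <= `|t0| * M by rewrite mulr_ge0 // ltW // M_gt0.
apply: (minimal_angle e_basis bd bh linj uU AE UU _ _ wS).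
- by rewrite th0.
- rewrite adjU -scaleNr; have [_ _ _ ->] := Zn_block n2; rewrite cmodR.
  have -> : cos (M * - t0) = cos (`|t0| * M).
    rewrite mulrN cosN mulrC; case: (ger0P t0) => _ //.
    by rewrite mulNr cosN.
  rewrite ger0_norm // cos_ge0_pihalf //.
  by rewrite thpi andbT (le_trans _ th0) // oppr_le0 divr_ge0 // pi_ge0.
have b0 : betan e gamma b n 0 = b by rewrite betan_conj conj_curve0.
have bt : betan e gamma b n t0 = U * b * adj U by rewrite betan_conj conj_curveE.
move: wJ; rewrite /joins; have [h|h] := lerP 0 t0; rewrite b0 bt //.
by move=> -[[-> ->]|[-> ->]]; [right|left].
Qed.

Lemma is_derive_betan n :
  is_derive (0 : R) (1 : R) (betan e gamma b n) (Yn n * b - b * Yn n).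
Proof.
rewrite (_ : betan _ _ _ _ = conj_curve (Zn n) b); last first.
  by apply: funext => t; exact: betan_conj.
by have := is_derive_conj_curve (Zn n) b 0; rewrite conj_curve0 bracket_Zn.
Qed.

Lemma derive1_betan0 n : derive1 (betan e gamma b n) 0 = Yn n * b - b * Yn n.
Proof. by rewrite derive1E; case: (is_derive_betan n). Qed.

Lemma derive1_beta0 : derive1 (beta e gamma b) 0 = Yr * b - b * Yr.
Proof.
rewrite (_ : beta _ _ _ = conj_curve Kr b); last first.
  by apply: funext => t; exact: beta_conj.
by rewrite derive1_conj_curve conj_curve0 bracket_Kr_Yr.
Qed.

Lemma derive_betan_cvg :
  finsler b (derive1 (betan e gamma b n) 0 - derive1 (beta e gamma b) 0)
    @[n --> \oo] --> (0 : \bar R)%E.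
Proof.
have lim : `|Yn n - Yr|%:E @[n --> \oo] --> (0%:E : \bar R)%E.
  apply: cvg_EFin; first by apply: nearW.
  by apply/norm_cvg0P/subr_cvg0; exact: Yn_cvg.
apply: (squeeze_cvge _ (cvg_cst _) lim); apply: nearW => n; apply/andP; split.
  by apply: le_ereal_inf_tmp => _ [Y _ <-]; rewrite lee_fin.
apply: ereal_inf_lbound; exists (Yn n - Yr) => //; split.
  by apply: KahD; [exact: Kah_Yn | apply: KahN; exact: Kah_Yr].
rewrite derive1_betan0 derive1_beta0 mulrBl mulrBr.
set p1 := Yn n * b; set p2 := b * Yn n; set p3 := Yr * b; set p4 := b * Yr.
by rewrite !opprB addrACA [RHS]addrACA (addrC (- p3)).
Qed.

(** The generators [Kn] converge in norm to [Kr] and the exponential is Lipschitz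
    on bounded sets; [Zn] alone does not converge to [Zr]. *)
Lemma betan_uniform (a : R) :
  {uniform `[- a, a], betan e gamma b @ \oo --> beta e gamma b}.
Proof.
move=> U /uniform_nbhs[E [entE EU]].
have [eps /= eps0 epsE] : exists2 eps : R, 0 < eps & [set xy | ball xy.1 eps xy.2] `<=` E.
  by move: entE; rewrite -entourage_ballE => -[eps /= eps0 epsE]; exists eps.
have [B0 BP] := bop_cvg_bounded Kn_cvg.
have B00 : 0 <= B0 by exact: le_trans (normr_ge0 _) (BP 0%N).
have KrB : `|Kr| <= B0.
  by apply: (@bop_cvg_norm_le _ _ Kn (fun=> B0)) => //; [exact: Kn_cvg | exact: cvg_cst].
pose C := 2 * (`|a| * expR (`|a| * B0) * `|b|).
have lim : (fun n => C * `|Kn n - Kr|) @ \oo --> (0 : R).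
  rewrite -[X in _ --> X](mulr0 C); apply: cvgM; first exact: cvg_cst.
  by apply/norm_cvg0P/subr_cvg0; exact: Kn_cvg.
have small : \forall n \near \oo, C * `|Kn n - Kr| < eps by exact: cvgr_lt lim _ eps0.
suff : \forall n \near \oo, U (betan e gamma b n) by [].
apply: filterS small => n Cn; apply: EU => t tI; apply: epsE => /=.
rewrite -ball_normE /= distrC beta_conj -[betan e gamma b n t]/(conj_curve (Kn n) b t).
apply: le_lt_trans Cn.
have ta : `|t| <= `|a|.
  move: tI; rewrite /= in_itv /= -ler_norml => ta.
  by apply: le_trans ta _; exact: ler_norm.
have tB (K : bop H) : `|K| <= B0 -> `|t *: K| <= `|a| * B0.
  by move=> KB; rewrite normrZ; apply: ler_pM.
have [[_ aKn] [_ aKr]] := (Kah_Kn n, Kah_Kr).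
apply: le_trans (conj_curve_dist b aKn aKr (tB _ (BP n)) (tB _ KrB)) _.
rewrite /C -!mulrA ler_wpM2l // ler_pM ?mulr_ge0 ?expR_ge0 //.
by rewrite mulrC !mulrA.
Qed.

End Example.

Theorem theorem16 (R : realType) (H : hilbertType R) (e : nat -> H)
  (e_basis : orthonormal_basis e)
  (gamma : R) (gamma_bnd : 0 < `|gamma| < 1)
  (A u b : bop H) (lambda : nat -> R)
  (A_compact : compact_op A) (A_herm : op_hermitian A)
  (u_Uc : Uc u) (lambda_inj : injective lambda)
  (b_diag : is_diag e b (fun k => (lambda k)%:C%C))
  (A_def : A = u * b * adj u) :
  (forall n : nat, (2 <= n)%N ->
    [/\ [/\ betan e gamma b n 0 = b,
            is_derive (0 : R) (1 : R) (betan e gamma b n)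
              (Yn_op e gamma n * b - b * Yn_op e gamma n) &
            tangent b (Yn_op e gamma n * b - b * Yn_op e gamma n)],
        forall t : R, betan e gamma b n t =
          exp_op (t *: (Yn_op e gamma n + Dn_op e gamma n)) * b *
          exp_op (- (t *: (Yn_op e gamma n + Dn_op e gamma n))),
        qnorm e (Yn_op e gamma n) = M0 e gamma /\
        (forall t0 : R, t0 \in `[- (pi / (2 * M0 e gamma)), pi / (2 * M0 e gamma)] ->
          [/\ smooth_curve A (Num.min 0 t0) (Num.max 0 t0) (beta e gamma b),
              curve_length (Num.min 0 t0) (Num.max 0 t0) (betan e gamma b n) =
                (`|t0| * qnorm e (Yn_op e gamma n))%:E,
              `|t0| * qnorm e (Yn_op e gamma n) = `|t0| * M0 e gamma &
              (`|t0| * M0 e gamma)%:E =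
                curve_length (Num.min 0 t0) (Num.max 0 t0) (beta e gamma b)]) &
        forall t0 : R, t0 \in `[- (pi / (2 * M0 e gamma)), pi / (2 * M0 e gamma)] ->
          minimal_length_curve A (Num.min 0 t0) (Num.max 0 t0) (betan e gamma b n)]) /\
  [/\ tangent b (derive1 (beta e gamma b) 0),
      finsler b (derive1 (betan e gamma b n) 0 - derive1 (beta e gamma b) 0)
        @[n --> \oo] --> (0 : \bar R)%E &
      {uniform `[- (pi / (2 * M0 e gamma)), pi / (2 * M0 e gamma)],
        betan e gamma b @ \oo --> beta e gamma b}].
Proof.

have b_herm : op_hermitian b.
  have [[_ uu] _] := u_Uc; have [[uu1 _] _] := u_Uc.
  have -> : b = adj u * A * adj (adj u).
    have [_ ->] := unitary_adj_unitary u_Uc.1.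
    by rewrite A_def !mulrA uu1 mul1r -mulrA uu1 mulr1.
  by apply: unitary_conj_herm A_herm; case: (unitary_adj_unitary u_Uc.1).
have small t0 : t0 \in `[- (pi / (2 * M0 e gamma)), pi / (2 * M0 e gamma)] ->
    `|t0| <= pi / (2 * M0 e gamma).
  by rewrite in_itv /= -ler_norml.
have mm (t0 : R) : Num.min 0 t0 <= Num.max 0 t0 by rewrite le_max ge_min lexx.
split=> [n n2|].
  have bc := betan_conj gamma e_basis b_diag n.
  have qn := qnorm_Yn e_basis gamma_bnd n2.
  split.
  - split.
    + by rewrite bc conj_curve0.
    + exact (is_derive_betan gamma e_basis b_diag n).
    + by exists (Yn_op e gamma n) => //; exact: Kah_Yn.
  - exact: bc.
  - split => // t0 /small t0M; rewrite qn; split => //.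
    + exact: (beta_smooth e_basis gamma_bnd b_diag b_herm lambda_inj u_Uc A_def).
    + by rewrite (betan_length e_basis gamma_bnd b_diag) // max_sub_min.
    + by rewrite (beta_length e_basis gamma_bnd b_diag) // max_sub_min.
  - move=> t0 /small t0M.
    exact: (betan_minimal e_basis gamma_bnd b_diag b_herm lambda_inj u_Uc A_def).
split.
- rewrite (derive1_beta0 e_basis gamma_bnd b_diag).
  by exists (Yr_op e gamma) => //; exact: Kah_Yr.
- exact: (derive_betan_cvg e_basis gamma_bnd b_diag).
- exact: betan_uniform.
Qed.
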